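(* Let $G$ be a connected complex semisimple Lie group with Lie algebra $\mathfrak g$, let $M$ be a $G$-manifold with sheaf of functions $\mathcal A$, let $r$ be a classical r-matrix on $\mathfrak g$ and $U_h(\mathfrak g,r)$ the corresponding quantum group. Let $\mathcal A_{t,h}$ be a two parameter $U_h(\mathfrak g,r)$-invariant associative quantization of $\mathcal A$ with multiplication $$m_{t,h}=m_0+t\,m_1'+h\,m_1''+o(t,h).$$ Then the Poisson bracket $p(a,b)=m_1''(a,b)-m_1''(b,a)$ has the form $$p(a,b)=f(a,b)-r_M(a,b),$$ where $f$ is a $\varphi$-bracket on $M$ with $\varphi=[\![r,r]\!]$. The Poisson bracket $s(a,b)=m_1'(a,b)-m_1'(b,a)$ is $U(\mathfrak g)$-invariant and compatible with $f$ (and thus with $p$); that is, $f$ satisfies $[\![f,f]\!]=-\varphi_M$ and the additional condition $$[\![f,s]\!]=0.$$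
   Context: **Quantum group.** A classical r-matrix is an element $r\in\wedge^2\mathfrak g$ whose Schouten bracket $\varphi=[\![r,r]\!]\in\wedge^3\mathfrak g$ is $\mathfrak g$-invariant. Let $\Delta$ and $\varepsilon$ be the usual comultiplication and counit of $U(\mathfrak g)$. The quantum group $U_h(\mathfrak g,r)$ is $U(\mathfrak g)[[h]]$ as a topological $\mathbb C[[h]]$-algebra, with counit the natural extension of $\varepsilon$ and comultiplication $\Delta_h(x)=F_h\Delta(x)F_h^{-1}$, where $F_h\in U(\mathfrak g)^{\otimes 2}[[h]]$ satisfies $F_h=1\otimes1+\frac h2 r+o(h)$, $(\varepsilon\otimes1)F_h=(1\otimes\varepsilon)F_h=1\otimes 1$ (i.e. is the unit), and $$(F_h\otimes1)\cdot(\Delta\otimes \mathrm{id})(F_h)=(1\otimes F_h)\cdot(\mathrm{id}\otimes\Delta)(F_h)\cdot\Phi_h$$ for an invariant element $\Phi_h\in U(\mathfrak g)^{\otimes3}[[h]]$ with $\Phi_h=1\otimes1\otimes1+h^2\varphi+o(h^2)$ ($\varphi$ up to a normalizing scalar factor), chosen so that $\Phi_h\Phi_h^s=1$, where $\Phi_h^s=(s\otimes s\otimes s)(\Phi_h)$ and $s$ here is the antipode of $U(\mathfrak g)$. **Two parameter quantizations.** $\mathcal A$ is the sheaf of analytic, smooth or algebraic functions on $M$ with usual multiplication $m_0$; $U(\mathfrak g)$ acts on $\mathcal A$, and this action is extended to $\mathcal A[[t,h]]$. A two parameter quantization of $\mathcal A$ is a sheaf of associative algebras $\mathcal A_{t,h}$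 equal to $\mathcal A[[t,h]]$ as a $\mathbb C[[t,h]]$-module, with multiplication of the form $m_{t,h}=m_0+t\,m_1'+h\,m_1''+o(t,h)$ (as for one parameter quantizations, the higher coefficients are bidifferential operators vanishing on constants). It is $U_h(\mathfrak g,r)$-invariant if $b\,m_{t,h}(x\otimes y)=m_{t,h}(\Delta_h(b)(x\otimes y))$ for $b\in U(\mathfrak g)$, $x,y\in\mathcal A$. **Brackets.** A bracket on $M$ is a skew-symmetric map $f:\mathcal A^{\otimes2}\to\mathcal A$ satisfying the Leibniz rule $f(ab,c)=af(b,c)+f(a,c)b$; brackets are identified with bivector fields on $M$. A bracket is Poisson if $[\![f,f]\!]=0$; two brackets are compatible if their Schouten bracket vanishes. For $\psi\in\wedge^k\mathfrak g$ (skew-symmetric tensors in $\mathfrak g^{\otimes k}$), $\psi_M$ is the $k$-vector field on $M$ induced by the action map $\mathfrak g\to\mathrm{Vect}(M)$ (given by the action of $\mathfrak g$ on $\mathcal A$ by derivations); in particular $r_M(a,b)=m_0(r(a\otimes b))$. For invariant $\varphi\in\wedge^3\mathfrak g$, a $\varphi$-bracket is a $G$-invariant bracket $f$ with $[\![f,f]\!]=-\varphi_M$, where $[\![\cdot,\cdot]\!]$ is the Schouten bracket, normalized on $\wedge^\bullet\mathfrak g$ and on polyvector fields in the same way (so that $\psi\mapsto\psi_M$ respects it). *)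

(* Defs.v *)
From HB Require Import structures.
From mathcomp Require Import all_boot all_algebra.
From mathcomp Require Import complex.
From mathcomp Require mpoly.
From mathcomp Require Import all_classical all_reals all_analysis.

Set Implicit Arguments.
Unset Strict Implicit.
Unset Printing Implicit Defensive.

Import GRing.Theory Num.Theory.
Import numFieldNormedType.Exports.

Local Open Scope classical_set_scope.
Local Open Scope ring_scope.
Local Open Scope complex_scope.

Definition bilin (C : comNzRingType) (V W X : lmodType C) (f : V -> W -> X) :=
  (forall w, linear (f^~ w)) /\ (forall v, linear (f v)).

(* A structure of tensor product of V and W on the module T.  [tlift f] is the
   linear map v (x) w |-> f v w; it is only meaningful when f is bilinear. *)
Record tensor_on (C : comNzRingType) (V W T : lmodType C) := TensorOn {
  pure : V -> W -> T;
  pure_bilin : bilin pure;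
  tlift : forall X : lmodType C, (V -> W -> X) -> T -> X;
  tlift_linear : forall (X : lmodType C) (f : V -> W -> X),
    bilin f -> linear (tlift f);
  tlift_pure : forall (X : lmodType C) (f : V -> W -> X),
    bilin f -> forall v w, tlift f (pure v w) = f v w;
  tensor_ext : forall (X : lmodType C) (F G : T -> X),
    linear F -> linear G ->
    (forall v w, F (pure v w) = G (pure v w)) -> F =1 G
}.

Record tensor (C : comNzRingType) (V W : lmodType C) := Tensor {
  tensor_sort :> lmodType C;
  tensor_str :> tensor_on V W tensor_sort
}.

Record tensor_alg (C : comNzRingType) (A B : algType C) := TensorAlg {
  tensor_alg_sort :> algType C;
  tensor_alg_str :> tensor_on A B tensor_alg_sort;
  tensor_alg_mul : forall a a' b b',
    pure tensor_alg_str a b * pure tensor_alg_str a' b' =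
    pure tensor_alg_str (a * a') (b * b');
  tensor_alg_one : pure tensor_alg_str 1 1 = 1
}.

Record lie_algebra (C : fieldType) := LieAlgebra {
  lie_sort :> vectType C;
  lie_br : lie_sort -> lie_sort -> lie_sort;
  lie_bilin : bilin lie_br;
  lie_alt : forall x, lie_br x x = 0;
  lie_jacobi : forall x y z,
    lie_br x (lie_br y z) + lie_br y (lie_br z x) + lie_br z (lie_br x y) = 0
}.

Section LieAlgebras.
Variables (C : fieldType) (g : lie_algebra C).
Local Notation "[| x , y |]" := (lie_br x y) (at level 0).

Definition lie_ideal (I : {vspace g}) := forall x y, y \in I -> [| x, y |] \in I.

Definition lie_derived (I : {vspace g}) : {vspace g} :=
  <<[seq [| x, y |] | x <- vbasis I, y <- vbasis I]>>%VS.

Definition lie_solvable (I : {vspace g}) :=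
  exists n, iter n lie_derived I = 0%VS.

Definition lie_semisimple :=
  forall I : {vspace g}, lie_ideal I -> lie_solvable I -> I = 0%VS.

Record enveloping := Enveloping {
  env_sort :> algType C;
  env_inj : g -> env_sort;
  env_inj_linear : linear env_inj;
  env_inj_br : forall x y, env_inj [| x, y |] =
    env_inj x * env_inj y - env_inj y * env_inj x;
  env_lift : forall B : algType C, (g -> B) -> env_sort -> B;
  env_liftP : forall (B : algType C) (f : g -> B), linear f ->
    (forall x y, f [| x, y |] = f x * f y - f y * f x) ->
    [/\ linear (env_lift f), monoid_morphism (env_lift f) &
        forall x, env_lift f (env_inj x) = f x];
  env_ext : forall (B : algType C) (F G : env_sort -> B),
    linear F -> monoid_morphism F -> linear G -> monoid_morphism G ->
    (forall x, F (env_inj x) = G (env_inj x)) -> F =1 G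
}.

Section Hopf.
Variables (U : enveloping) (U2 : tensor_alg U U).

Definition env_comul : U -> U2 :=
  env_lift (fun x : g => pure U2 (env_inj U x) 1 + pure U2 1 (env_inj U x)).

Definition env_counit : U -> C^o := env_lift (fun _ : g => 0 : C^o).

Definition is_antipode (S : U -> U) :=
  [/\ linear S, S 1 = 1, forall u v, S (u * v) = S v * S u &
      forall x : g, S (env_inj U x) = - env_inj U x].
End Hopf.


Section RMatrices.
Variables (g2 : tensor g g) (g3 : tensor g2 g).

Definition skew2 (r : g2) := tlift g2 (fun x y => pure g2 y x) r = - r.

(* [r12, s13] + [r12, s23] + [r13, s23] *)
Definition yang_baxter (r s : g2) : g3 :=
  tlift g2 (fun x y => tlift g2 (fun x' y' =>
      pure g3 (pure g2 [| x, x' |] y) y'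
    + pure g3 (pure g2 x [| y, x' |]) y'
    + pure g3 (pure g2 x x') [| y, y' |]) s) r.

(* On skew-symmetric tensors this is the Schouten bracket
   [[x1 ^ x2, y1 ^ y2]] = sum_(i, j) (-1)^(i + j) [xi, yj] ^ xi' ^ yj'
   with xi' (yj') the remaining factor and ^ the alternating sum of tensors. *)
Definition schouten (r s : g2) : g3 := yang_baxter r s + yang_baxter s r.

Definition lie_invariant3 (phi : g3) := forall w,
  tlift g3 (fun T z =>
      pure g3 (tlift g2 (fun x y =>
        pure g2 [| w, x |] y + pure g2 x [| w, y |]) T) z
    + pure g3 T [| w, z |]) phi = 0.

Definition classical_rmatrix (r : g2) :=
  skew2 r /\ lie_invariant3 (schouten r r).

End RMatrices.
End LieAlgebras.

Arguments env_inj {C g} U x : rename.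

(* An element of A[[h]] is the sequence of its coefficients. *)
Definition hseries (A : Type) := nat -> A.

Section HSeries.
Variable A : pzRingType.
Definition hmul (x y : hseries A) : hseries A :=
  fun n => \sum_(i < n.+1) x i * y (n - i)%N.
Definition hconst (a : A) : hseries A := fun n => if n is 0%N then a else 0.
End HSeries.

Section QuantumGroup.
Variables (C : fieldType) (g : lie_algebra C).
Variables (g2 : tensor g g) (g3 : tensor g2 g).
Variables (U : enveloping g) (U2 : tensor_alg U U) (U3 : tensor_alg U2 U).

Definition inj2 (r : g2) : U2 :=
  tlift g2 (fun x y => pure U2 (env_inj U x) (env_inj U y)) r.
Definition inj3 (phi : g3) : U3 :=
  tlift g3 (fun T z => pure U3 (inj2 T) (env_inj U z)) phi.

(* T (x) 1, 1 (x) T, (Delta (x) id) T and (id (x) Delta) T *)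
Definition tens_one (T : U2) : U3 := pure U3 T 1.
Definition one_tens (T : U2) : U3 :=
  tlift U2 (fun u v => pure U3 (pure U2 1 u) v) T.
Definition comul_id (T : U2) : U3 :=
  tlift U2 (fun u v => pure U3 (env_comul U2 u) v) T.
Definition id_comul (T : U2) : U3 :=
  tlift U2 (fun u v =>
    tlift U2 (fun v1 v2 => pure U3 (pure U2 u v1) v2) (env_comul U2 v)) T.

Definition counit_id (T : U2) : U :=
  tlift U2 (fun u v => (env_counit u : C) *: v) T.
Definition id_counit (T : U2) : U :=
  tlift U2 (fun u v => (env_counit v : C) *: u) T.

Definition tensor3_map (S : U -> U) (T : U3) : U3 :=
  tlift U3 (fun T2 w =>
    pure U3 (tlift U2 (fun u v => pure U2 (S u) (S v)) T2) (S w)) T.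

Record quantum_group (r : g2) := QuantumGroup {
  qF : hseries U2;
  qFinv : hseries U2;
  qPhi : hseries U3;
  qantipode : U -> U;
  qscalar : C;
  qF0 : qF 0%N = 1;
  qF1 : qF 1%N = 2^-1 *: inj2 r;
  qF_inv_r : hmul qF qFinv = hconst 1;
  qF_inv_l : hmul qFinv qF = hconst 1;
  qF_counit_l : counit_id \o qF = hconst 1;
  qF_counit_r : id_counit \o qF = hconst 1;
  qF_Phi : hmul (tens_one \o qF) (comul_id \o qF) =
           hmul (hmul (one_tens \o qF) (id_comul \o qF)) qPhi;
  qPhi_invariant : forall n (x : g),
    let x3 := comul_id (env_comul U2 (env_inj U x)) in
    x3 * qPhi n = qPhi n * x3;
  qscalar_neq0 : qscalar != 0;
  qPhi0 : qPhi 0%N = 1;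
  qPhi1 : qPhi 1%N = 0;
  qPhi2 : qPhi 2%N = qscalar *: inj3 (schouten g3 r r);
  qantipodeP : is_antipode qantipode;
  qPhi_antipode : hmul qPhi (tensor3_map qantipode \o qPhi) = hconst 1
}.

(* The comultiplication and counit of U(g)[[h]]. *)
Definition qcomul (r : g2) (Q : quantum_group r) (x : hseries U) : hseries U2 :=
  hmul (hmul (qF Q) (env_comul U2 \o x)) (qFinv Q).
Definition qcounit (x : hseries U) : hseries C^o := (@env_counit C g U) \o x.

End QuantumGroup.

Section PartialDerivatives.
Variables (K : numFieldType) (n : nat).
Implicit Types (f : 'rV[K]_n -> K) (V : set 'rV[K]_n).

Definition partial (i : 'I_n) f : 'rV[K]_n -> K :=
  fun x => 'D_(delta_mx 0 i) f x.

(* All iterated partial derivatives are Frechet differentiable on the open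
   set V; for K the complex numbers this is holomorphy. *)
Definition smooth_in V f := forall (alpha : seq 'I_n) x, V x ->
  differentiable (foldr partial f alpha) x.

End PartialDerivatives.

(* The three classes of functions.  Manifolds are modelled on K^n, where K is
   the field of real numbers for smooth functions and the field of complex
   numbers for analytic and algebraic functions; functions are always complex
   valued. *)
Inductive geometry := Analytic | Smooth | Algebraic.

Section Geometry.
Variable R : realType.
Local Notation C := (R[i]).

Definition ground (k : geometry) : numFieldType :=
  match k with Smooth => R | _ => C end.

Definition ground_incl (k : geometry) : ground k -> C :=
  match k return ground k -> C with
  | Smooth => fun x : R => x%:C
  | _ => id
  end.

Definition ksmooth (k : geometry) n :
    set 'rV[ground k]_n -> ('rV[ground k]_n -> C) -> Prop :=
  match k return set 'rV[ground k]_n -> ('rV[ground k]_n -> C) -> Prop with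
  | Smooth => fun V f => smooth_in (K := R) V (fun x => complex.Re (f x)) /\
                         smooth_in (K := R) V (fun x => complex.Im (f x))
  | _ => @smooth_in C n
  end.

Definition kpartial (k : geometry) n (i : 'I_n) :
    ('rV[ground k]_n -> C) -> 'rV[ground k]_n -> C :=
  match k return ('rV[ground k]_n -> C) -> 'rV[ground k]_n -> C with
  | Smooth => fun f x => (partial (K := R) i (fun y => complex.Re (f y)) x)
                      +i* (partial (K := R) i (fun y => complex.Im (f y)) x)
  | _ => @partial C n i
  end.

Variable k : geometry.
Local Notation K := (ground k).

(* A homeomorphism between an open set of M and an open set of K^n, given with
   its inverse; [ch_fun] and [ch_inv] are arbitrary outside these sets. *)
Record chart (M : topologicalType) n := Chart {
  ch_dom : set M;
  ch_cod : set 'rV[K]_n;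
  ch_fun : M -> 'rV[K]_n;
  ch_inv : 'rV[K]_n -> M;
  ch_dom_open : open ch_dom;
  ch_cod_open : open ch_cod;
  ch_fun_in : forall m, ch_dom m -> ch_cod (ch_fun m);
  ch_inv_in : forall x, ch_cod x -> ch_dom (ch_inv x);
  ch_funK : forall m, ch_dom m -> ch_inv (ch_fun m) = m;
  ch_invK : forall x, ch_cod x -> ch_fun (ch_inv x) = x;
  ch_fun_cont : forall m, ch_dom m -> {for m, continuous ch_fun};
  ch_inv_cont : forall x, ch_cod x -> {for x, continuous ch_inv}
}.

Definition ch_transition (M : topologicalType) n (c d : chart M n) :=
  forall i : 'I_n,
    ksmooth (ch_cod c `&` ch_inv c @^-1` ch_dom d)
            (fun x => ground_incl (ch_fun d (ch_inv c x) 0 i)).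

Record manifold := Manifold {
  man_sort :> topologicalType;
  man_dim : nat;
  man_atlas : set (chart man_sort man_dim);
  man_cover : forall m, exists2 c, man_atlas c & ch_dom c m;
  man_compat : forall c d, man_atlas c -> man_atlas d -> ch_transition c d;
  man_hausdorff : hausdorff_space man_sort;
  man_countable : @second_countable man_sort
}.

(* The charts of the maximal atlas. *)
Definition compatible (M : manifold) (c : chart M (man_dim M)) :=
  forall d, man_atlas d -> ch_transition c d /\ ch_transition d c.

Definition smooth_fun (M : manifold) (W : set M) (a : M -> C) :=
  forall c, @man_atlas M c ->
    ksmooth (ch_cod c `&` ch_inv c @^-1` W) (a \o ch_inv c).

(* The same for functions on the product manifold. *)
Definition smooth_fun2 (X Y : manifold) (W : set (X * Y)) (a : X * Y -> C) :=
  forall c d, @man_atlas X c -> @man_atlas Y d ->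
    let h (u : 'rV[K]_(man_dim X + man_dim Y)) :=
      (ch_inv c (lsubmx u), ch_inv d (rsubmx u)) in
    ksmooth [set u | [/\ ch_cod c (lsubmx u), ch_cod d (rsubmx u) & W (h u)]]
            (a \o h).

Definition smooth_map (X Y : manifold) (f : X -> Y) :=
  continuous f /\ forall (V : set Y) a, open V -> smooth_fun V a ->
    smooth_fun (f @^-1` V) (a \o f).

Definition smooth_map2 (X Y Z : manifold) (f : X * Y -> Z) :=
  continuous f /\ forall (V : set Z) a, open V -> smooth_fun V a ->
    smooth_fun2 (f @^-1` V) (a \o f).

Definition smooth_near (M : manifold) (m : M) (a : M -> C) :=
  exists V, [/\ open V, V m & smooth_fun V a].

(* Complex tangent vectors, as operators on germs of functions: the complex
   combinations of the partial derivatives in a chart.  (For [Smooth] this is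
   the complexified tangent space.) *)
Definition tangent (M : manifold) (m : M) (v : (M -> C) -> C) :=
  exists c, exists w : 'rV[C]_(man_dim M),
    [/\ @man_atlas M c, ch_dom c m &
      forall a, smooth_near m a ->
        v a = \sum_i w 0 i * kpartial i (a \o ch_inv c) (ch_fun c m)].

(* Complex Lie groups for [Analytic] and [Algebraic], real ones for [Smooth]:
   the complex Lie algebra acting on smooth complex-valued functions is the
   complexified Lie algebra of a real Lie group. *)
Record lie_group := LieGroup {
  lg_man :> manifold;
  lg_mul : lg_man -> lg_man -> lg_man;
  lg_one : lg_man;
  lg_inv : lg_man -> lg_man;
  lg_mulA : associative lg_mul;
  lg_mul1 : left_id lg_one lg_mul;
  lg_mulV : left_inverse lg_one lg_inv lg_mul;
  lg_mul_smooth : smooth_map2 (fun p => lg_mul p.1 p.2);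
  lg_inv_smooth : smooth_map lg_inv
}.

(* The isomorphism tau identifies g with the (complex) tangent space at the
   identity, with the bracket of left-invariant vector fields: the value at x
   of the left-invariant field of v on a is v (y |-> a (x y)). *)
Record is_lie_algebra_of (G : lie_group) (g : lie_algebra C)
    (tau : g -> (G -> C) -> C) : Prop := {
  lao_tangent : forall x, tangent (lg_one G) (tau x);
  lao_linear : forall (z : C) x y a, smooth_near (lg_one G) a ->
    tau (z *: x + y) a = z * tau x a + tau y a;
  lao_inj : forall x,
    (forall a, smooth_near (lg_one G) a -> tau x a = 0) -> x = 0;
  lao_surj : forall v, tangent (lg_one G) v ->
    exists x, forall a, smooth_near (lg_one G) a -> tau x a = v a;
  lao_bracket : forall x y a, smooth_near (lg_one G) a ->
    tau (lie_br x y) a =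
      tau x (fun p => tau y (fun q => a (lg_mul p q))) -
      tau y (fun p => tau x (fun q => a (lg_mul p q)))
}.


(* A sheaf of algebras of complex-valued functions, for a topology [fs_open]
   which need not be the one of M as a manifold (Zariski topology).
   [fs_reg W a] says that a restricts to a section over W. *)
Record fun_sheaf (M : Type) := FunSheaf {
  fs_open : set (set M);
  fs_openT : fs_open setT;
  fs_openI : forall V W, fs_open V -> fs_open W -> fs_open (V `&` W);
  fs_open_bigcup : forall F : set (set M), (forall V, F V -> fs_open V) ->
    fs_open (\bigcup_(V in F) V);
  fs_reg : set M -> set (M -> C);
  fs_ext : forall W a b, fs_open W -> (forall m, W m -> a m = b m) ->
    fs_reg W a -> fs_reg W b;
  fs_cst : forall W (z : C), fs_open W -> fs_reg W (fun=> z);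
  fs_add : forall W a b, fs_open W -> fs_reg W a -> fs_reg W b ->
    fs_reg W (fun m => a m + b m);
  fs_mul : forall W a b, fs_open W -> fs_reg W a -> fs_reg W b ->
    fs_reg W (fun m => a m * b m);
  fs_res : forall V W a, fs_open V -> fs_open W -> V `<=` W ->
    fs_reg W a -> fs_reg V a;
  fs_glue : forall (F : set (set M)) a, (forall V, F V -> fs_open V) ->
    (forall V, F V -> fs_reg V a) -> fs_reg (\bigcup_(V in F) V) a
}.

Record opens M (A : fun_sheaf M) := Opens {
  oset :> set M;
  oset_open : fs_open A oset
}.

(* Sections over W are encoded as functions on M vanishing outside W. *)
Definition sec_pred M (A : fun_sheaf M) (W : opens A) : {pred M -> C} :=
  fun a => `[< fs_reg A W a /\ forall m, ~ oset W m -> a m = 0 >].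

Lemma sec_pred_submod M (A : fun_sheaf M) (W : opens A) :
  submod_closed (sec_pred W).
Proof.
split=> [|z a b /asboolP[ra a0] /asboolP[rb b0]]; apply/asboolP; split=> //.
- exact: fs_cst (oset_open W).
- have := oset_open W => oW.
  by apply: fs_add => //; apply: fs_mul => //; apply: fs_cst.
- move=> m Wm; have -> : (z *: a + b) m = z * a m + b m by [].
  by rewrite a0 // b0 // mulr0 addr0.
Qed.

HB.instance Definition _ M (A : fun_sheaf M) (W : opens A) :=
  GRing.isSubmodClosed.Build C (M -> C) (sec_pred W) (sec_pred_submod W).

Record sec M (A : fun_sheaf M) (W : opens A) := Sec {
  sec_fun :> M -> C;
  sec_funP : sec_fun \in sec_pred W
}.

HB.instance Definition _ M (A : fun_sheaf M) (W : opens A) :=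
  [isSub for @sec_fun M A W].
HB.instance Definition _ M (A : fun_sheaf M) (W : opens A) :=
  [Choice of sec W by <:].
HB.instance Definition _ M (A : fun_sheaf M) (W : opens A) :=
  [SubChoice_isSubLmodule of sec W by <:].

Section Sections.
Variables (M : Type) (A : fun_sheaf M).
Implicit Types V W : opens A.

Lemma sec_reg W (a : sec W) : fs_reg A W a.
Proof. by have /asboolP[] := sec_funP a. Qed.

Lemma sec_off W (a : sec W) m : ~ oset W m -> a m = 0.
Proof. by have /asboolP[_] := sec_funP a; apply. Qed.

Definition restr (a : M -> C) (W : set M) : M -> C :=
  fun m => if `[< W m >] then a m else 0.

Lemma restr_subproof W (a : M -> C) : fs_reg A W a -> restr a W \in sec_pred W.
Proof.
move=> ra; apply/asboolP; split=> [|m Wm]; last by rewrite /restr asboolF.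
by apply: fs_ext ra; [exact: oset_open | move=> m Wm; rewrite /restr asboolT].
Qed.

Definition mksec W (a : M -> C) (ra : fs_reg A W a) : sec W :=
  Sec (restr_subproof ra).

Definition sec_one W : sec W := mksec (fs_cst 1 (oset_open W)).

Definition sec_mul W (a b : sec W) : sec W :=
  mksec (fs_mul (oset_open W) (sec_reg a) (sec_reg b)).

Definition sec_res V W (VW : V `<=` W) (a : sec W) : sec V :=
  mksec (fs_res (oset_open V) (oset_open W) VW (sec_reg a)).

(* A map A (x) A -> A of sheaves is a compatible family of bilinear maps. *)
Definition sheaf_op2 := forall W : opens A, sec W -> sec W -> sec W.

Definition sheaf_bilin (B : sheaf_op2) :=
  (forall W, bilin (B W)) /\
  forall V W (VW : V `<=` W) (a b : sec W),
    sec_res VW (B W a b) = B V (sec_res VW a) (sec_res VW b).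

Definition is_bracket (f : sheaf_op2) :=
  [/\ sheaf_bilin f,
      forall W (a b : sec W), f W a b = - f W b a &
      forall W (a b c : sec W),
        f W (sec_mul a b) c = sec_mul a (f W b c) + sec_mul (f W a c) b].

(* The Schouten bracket of two bivector fields, as a map of three functions.
   Sign and factor are those for which r |-> r_M takes the bracket [schouten]
   of g to this one. *)
Definition schouten_bv (f f' : sheaf_op2) W (a b c : sec W) : sec W :=
  - (  f W (f' W a b) c + f' W (f W a b) c
     + f W (f' W b c) a + f' W (f W b c) a
     + f W (f' W c a) b + f' W (f W c a) b).

Definition compatible_brackets (f f' : sheaf_op2) :=
  forall W (a b c : sec W), schouten_bv f f' a b c = 0.

Definition is_poisson (f : sheaf_op2) := is_bracket f /\ compatible_brackets f f.

End Sections.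


Definition peval n (p : mpoly.mpoly n C) (x : 'rV[C]_n) : C :=
  mpoly.meval (fun i => x 0 i) p.

(* The open subset V of (M, A) is an affine variety: z identifies it with an
   algebraic subset of C^N, with its Zariski topology and regular functions,
   and this subset is a complex submanifold of C^N (so it is nonsingular),
   the complex structure being that of M. *)
Definition affine_patch (M : manifold) (A : fun_sheaf M) (V : set M) :=
  exists N, exists z : M -> 'rV[C]_N, exists I : set (mpoly.mpoly N C),
  [/\ fs_open A V /\ open V,
      {in V &, injective z} /\
        z @` V = [set x | forall p, I p -> peval p x = 0],
      forall W, W `<=` V -> (fs_open A W <->
        exists J : set (mpoly.mpoly N C),
          W = [set m | V m /\ exists2 p, J p & peval p (z m) != 0]),
      forall W a, W `<=` V -> fs_open A W -> (fs_reg A W a <->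
        forall m, W m -> exists p q, peval q (z m) != 0 /\
          forall m', W m' -> peval q (z m') != 0 ->
            a m' = peval p (z m') / peval q (z m')) &
      [/\ forall j, smooth_fun V (fun m => z m 0 j),
          forall W, W `<=` V -> open W ->
            exists2 O : set 'rV[(C : numFieldType)]_N,
              open O & W = V `&` z @^-1` O &
          forall m, V m -> exists c : chart M (man_dim M),
            exists s : 'I_(man_dim M) -> 'I_N,
            [/\ compatible c, ch_dom c m, ch_dom c `<=` V &
              forall m' i, ch_dom c m' ->
                ground_incl (ch_fun c m' 0 i) = z m' 0 (s i)]]].

(* A is the sheaf of functions of the given kind on M. *)
Definition functions_on (M : manifold) (A : fun_sheaf M) :=
  match k with
  | Algebraic =>
      (forall W, fs_open A W -> open W) /\
      exists n, exists V : 'I_n -> set M,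
        (forall i, affine_patch A (V i)) /\ \bigcup_i V i = setT
  | _ => (forall W, fs_open A W <-> open W) /\
         (forall W a, open W -> (fs_reg A W a <-> smooth_fun W a))
  end.

Section BidifferentialOperators.
Variables (M : manifold) (A : fun_sheaf M).

(* c is a chart in the domain V, with coordinates x. *)
Definition coord_chart (V : set M) (x : M -> 'rV[K]_(man_dim M))
    (c : chart M (man_dim M)) :=
  [/\ compatible c, ch_dom c `<=` V & forall m, ch_dom c m -> ch_fun c m = x m].

(* x is a system of local coordinates on V, made of functions in A; it need
   only be locally injective, since Zariski open sets are not domains of
   charts (etale coordinates). *)
Definition coordinates (V : opens A) (x : M -> 'rV[K]_(man_dim M)) :=
  (forall i, fs_reg A V (fun m => ground_incl (x m 0 i))) /\
  forall m, oset V m -> exists2 c, coord_chart V x c & ch_dom c m.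

Definition bidiff_term := (seq 'I_(man_dim M) * seq 'I_(man_dim M))%type.

Definition bidifferential (B : sheaf_op2 A) :=
  sheaf_bilin B /\
  forall m, exists (V : opens A) (x : M -> 'rV[K]_(man_dim M))
                   (L : seq (sec V * bidiff_term)),
    [/\ oset V m, coordinates V x &
      forall (W : opens A), W `<=` V -> forall c, coord_chart W x c ->
      forall (a b : sec W) m', ch_dom c m' ->
        B W a b m' = \sum_(t <- L) t.1 m' *
          foldr (@kpartial k _) (a \o ch_inv c) t.2.1 (x m') *
          foldr (@kpartial k _) (b \o ch_inv c) t.2.2 (x m')].

Definition vanishes_on_constants (B : sheaf_op2 A) :=
  forall (W : opens A) (a : sec W), B W (sec_one W) a = 0 /\ B W a (sec_one W) = 0.

End BidifferentialOperators.


(* For [Algebraic] the action need only be holomorphic and by automorphisms of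
   the algebraic variety. *)
Record G_manifold (G : lie_group) := GManifold {
  gm_man :> manifold;
  gm_act : G -> gm_man -> gm_man;
  gm_act1 : forall m, gm_act (lg_one G) m = m;
  gm_actM : forall p q m, gm_act (lg_mul p q) m = gm_act p (gm_act q m);
  gm_act_smooth : smooth_map2 (fun u : G * gm_man => gm_act u.1 u.2);
  gm_fun : fun_sheaf gm_man;
  gm_funP : functions_on gm_fun;
  gm_open : forall p W, fs_open gm_fun W -> fs_open gm_fun (gm_act p @` W);
  gm_reg : forall p W a, fs_open gm_fun W -> fs_reg gm_fun W a ->
    fs_reg gm_fun (gm_act p @` W) (a \o gm_act (lg_inv p))
}.

Section GManifolds.
Variables (G : lie_group) (M : G_manifold G).
Local Notation A := (gm_fun M).

Definition gm_opens (p : G) (W : opens A) : opens A :=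
  Opens (gm_open p (oset_open W)).

Definition gm_trans (p : G) (W : opens A) (a : sec W) : sec (gm_opens p W) :=
  mksec (W := gm_opens p W) (gm_reg p (oset_open W) (sec_reg a)).

Definition G_invariant (f : sheaf_op2 A) :=
  forall p (W : opens A) (a b : sec W),
    gm_trans p (f W a b) = f (gm_opens p W) (gm_trans p a) (gm_trans p b).

Variables (g : lie_algebra C) (tau : g -> (G -> C) -> C) (U : enveloping g).

(* The action of U(g) on A; g acts by the differential of the action of G on
   functions, (p a)(m) = a (p^-1 m). *)
Record U_action := UAction {
  uact : forall W : opens A, U -> sec W -> sec W;
  uact_bilin : forall W, bilin (@uact W);
  uact1 : forall W (a : sec W), uact 1 a = a;
  uactM : forall W u v (a : sec W), uact (u * v) a = uact u (uact v a);
  uact_inj : forall W (x : g) (a : sec W) m, oset W m ->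
    uact (env_inj U x) a m = tau x (fun p => a (gm_act (lg_inv p) m))
}.

Variable act : U_action.

(* (a, b) |-> B (T (a (x) b)) *)
Definition act2 (U2 : tensor_alg U U) (B : sheaf_op2 A) (T : U2) W
    (a b : sec W) : sec W :=
  tlift U2 (fun u v => B W (uact act u a) (uact act v b)) T.

Definition U_invariant (U2 : tensor_alg U U) (B : sheaf_op2 A) :=
  forall (u : U) W (a b : sec W),
    uact act u (B W a b) = act2 B (env_comul U2 u) a b.

Variables (g2 : tensor g g) (g3 : tensor g2 g).

Definition r_M (r : g2) : sheaf_op2 A := fun W a b =>
  tlift g2 (fun x y =>
    sec_mul (uact act (env_inj U x) a) (uact act (env_inj U y) b)) r.

Definition phi_M (phi : g3) W (a b c : sec W) : sec W :=
  tlift g3 (fun T z => sec_mul (r_M T a b) (uact act (env_inj U z) c)) phi.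

Definition is_phi_bracket (phi : g3) (f : sheaf_op2 A) :=
  [/\ is_bracket f, G_invariant f &
      forall W (a b c : sec W), schouten_bv f f a b c = - phi_M phi a b c].

End GManifolds.


Section Quantizations.
Variables (M : manifold) (A : fun_sheaf M).

(* m i j is the coefficient of t^i h^j of the multiplication of A[[t,h]]. *)
Definition th_mul (m : nat -> nat -> sheaf_op2 A) (W : opens A)
    (a b : nat -> nat -> sec W) : nat -> nat -> sec W := fun i j =>
  \sum_(i1 < i.+1) \sum_(i2 < (i - i1).+1)
  \sum_(j1 < j.+1) \sum_(j2 < (j - j1).+1)
    m i1 j1 W (a i2 j2) (b (i - i1 - i2)%N (j - j1 - j2)%N).

Record two_parameter_quantization (m : nat -> nat -> sheaf_op2 A) : Prop := {
  tpq_bidiff : forall i j, bidifferential (m i j);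
  tpq_00 : forall W (a b : sec W), m 0%N 0%N W a b = sec_mul a b;
  tpq_const : forall i j, (0 < i + j)%N -> vanishes_on_constants (m i j);
  tpq_assoc : forall W (a b c : nat -> nat -> sec W),
    th_mul m (th_mul m a b) c = th_mul m a (th_mul m b c)
}.

Definition antisym (B : sheaf_op2 A) : sheaf_op2 A :=
  fun W a b => B W a b - B W b a.

End Quantizations.

Section QuantumInvariance.
Variables (G : lie_group) (M : G_manifold G).
Variables (g : lie_algebra C) (tau : g -> (G -> C) -> C).
Variables (g2 : tensor g g) (g3 : tensor g2 g).
Variables (U : enveloping g) (U2 : tensor_alg U U) (U3 : tensor_alg U2 U).
Variables (r : g2) (Q : quantum_group g3 U3 r) (act : U_action M tau U).

(* b m_{t,h}(x (x) y) = m_{t,h}(Delta_h(b) (x (x) y)), coefficientwise. *)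
Definition quantum_invariant (m : nat -> nat -> sheaf_op2 (gm_fun M)) :=
  forall (u : U) W (a b : sec W) i j,
    uact act u (m i j W a b) =
    \sum_(l < j.+1) act2 act (m i (j - l)%N) (qcomul Q (hconst u) l) a b.

End QuantumInvariance.

End Geometry.

(* Main.v *)
Require Import Defs.
From mathcomp Require Import all_boot all_order all_algebra complex.
From mathcomp Require Import all_classical all_reals all_analysis.
From mathcomp Require Import ring lra.
From HB Require Import structures.

Set Implicit Arguments.
Unset Strict Implicit.
Unset Printing Implicit Defensive.

Import Order.TTheory GRing.Theory Num.Theory.
Import numFieldNormedType.Exports.
Local Open Scope classical_set_scope.
Local Open Scope ring_scope.
Local Open Scope complex_scope.

(** Let p and s be the skew-symmetrized coefficients of h and of t in the
    multiplication, and f = p + r_M.  The proof has an algebraic part, which is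
    short, and an analytic part, which turns invariance under the Lie algebra into
    invariance under the group.

    Algebra.  In first order, associativity says that the coefficients of h and t
    are Hochschild cocycles of a commutative algebra, so that p and s are
    biderivations ([antisym_bracket]).  Skew-symmetrizing the associativity
    identities of order h^2, t^2 and th gives [[p, p]] = 0, [[s, s]] = 0 and
    [[s, p]] = 0 ([antisym_compatible]).  In order t, quantum invariance says that s
    is invariant.  In order h it says that the coefficient of h fails to be invariant
    under x in g by half the commutator of r and Delta x, because F_h begins with
    1 + (h/2) r; skew-symmetrization turns this into the failure of invariance of
    - r_M, so f is invariant under g ([invariant_h]).  A bracket that is invariant
    under g has zero Schouten bracket with r_M ([invariant_compatible]), and
    [[r_M, r_M]] = phi_M ([schouten_r_M]).  Hence 0 = [[f, r_M]] = [[p, r_M]] + phi_M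
    and [[f, f]] = [[p, p]] + 2 [[p, r_M]] + [[r_M, r_M]] = - phi_M, while
    [[f, s]] = [[p, s]] + [[r_M, s]] = 0.

    Analysis.  It remains to see that f is invariant under the connected group G
    ([infinitesimal_invariance]).  Given sections a and b and a point m, consider the
    function q |-> f (q a, q b) (q m) on G.  Since f is a bidifferential operator,
    this function is smooth, and it can be differentiated at q = 1 under the partial
    derivatives that occur in f, because second derivatives are symmetric
    ([kpartial_comm]).  The derivative in the direction x is
    f (x a, b) (m) + f (a, x b) (m) - (x f (a, b)) (m) = 0 ([transport_partial]).  Right
    translations carry this to all points of G, so the function is constant.  That f is
    bidifferential holds by hypothesis for the part p, and for r_M because g acts by
    vector fields, with coefficients the derivatives of coordinate functions that are
    themselves sections of the sheaf ([bidiff_on_act]).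

    The three kinds of geometry are treated at once, by a notion of differentiability
    of complex-valued functions of variables in the ground field that is the usual one
    in each case ([ksmoothP]).  In the algebraic case, regular functions are holomorphic
    because they are locally quotients of polynomials in coordinates
    ([sheaf_smooth]). *)

(** * Differentiability in Caratheodory form *)

Section Caratheodory.
Variables (K C : numFieldType) (gi : K -> C) (n : nat).
Implicit Types (f : 'rV[K]_n -> C) (x : 'rV[K]_n) (w : 'I_n -> C).

(** Differentiability at x with partial derivatives w: the increment of f is a combination
    of the increments of the coordinates, with coefficients continuous at x.  This
    is equivalent to Frechet differentiability, and reduces the rules of calculus to
    algebra and continuity.  The values may lie in a larger field than the variables. *)
Definition caratheodory f x w := exists phi : 'I_n -> 'rV[K]_n -> C,
  [/\ forall i, phi i x = w i, forall i, {for x, continuous (phi i)} &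
      \forall y \near x, f y - f x = \sum_i phi i y * gi (y 0 i - x 0 i)].

End Caratheodory.

Lemma continuous_at_sum (T : topologicalType) (K : numFieldType) n
    (f : 'I_n -> T -> K) x : (forall i, {for x, continuous (f i)}) ->
  {for x, continuous (fun y => \sum_i f i y)}.
Proof.
move=> fc; have ac := @add_continuous K.
exact: (@cvg_big K 'I_n +%R 0 xpredT ac T (nbhs x) _ f _ _ (fun i _ => fc i)).
Qed.

Lemma continuous_at_mul (T : topologicalType) (K : numFieldType) (f g : T -> K) x :
  {for x, continuous f} -> {for x, continuous g} ->
  {for x, continuous (fun y => f y * g y)}.
Proof. by move=> fc gc; exact: (@cvgM K T (nbhs x) _ f g _ _ fc gc). Qed.

Lemma continuous_at_add (T : topologicalType) (K : numFieldType) (f g : T -> K) x :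
  {for x, continuous f} -> {for x, continuous g} ->
  {for x, continuous (fun y => f y + g y)}.
Proof. by move=> fc gc; exact: (@cvgD K K T (nbhs x) _ f g _ _ fc gc). Qed.

Lemma continuous_at_cst (T U : topologicalType) (a : U) (x : T) :
  {for x, continuous (fun=> a)}.
Proof. exact: cvg_cst. Qed.

Lemma shift_continuous (K : numFieldType) (V : normedModType K) (x y : V) :
  {for y, continuous (fun h => h + x)}.
Proof. by apply: cvgD; [exact: cvg_id|exact: cvg_cst]. Qed.

Lemma norm_coord_le (K : numDomainType) n (h : 'rV[K]_n) i : `|h 0 i| <= `|h|.
Proof.
rewrite [leRHS]/Num.norm /= mx_normE.
by rewrite -[leLHS]nngE num_le; exact: (le_bigmax _ _ (0, i)).
Qed.

Lemma continuous_at_distP (T : topologicalType) (K : numFieldType) (f : T -> K) x :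
  {for x, continuous f} <->
  forall e, 0 < e -> \forall y \near x, `|f x - f y| <= e.
Proof. exact: (@cvgrPdist_le K K T (nbhs x) _ f (f x)). Qed.

(** The remainder of the linear approximation is attributed to a single variable, one
    whose increment has the norm of the whole increment. *)
Lemma differentiable_caratheodory (K : numFieldType) n (f : 'rV[K]_n -> K) x :
  differentiable f x -> caratheodory idfun f x (fun i => partial i f x).
Proof.
move=> df; have /eqaddoP rho0 := diff_locally df.
pose rho h := f (h + x) - f x - 'd f x h.
have rhoE h : rho h = (f \o shift x - (cst (f x) + 'd f x)) h.
  by rewrite /rho opprD addrA.
have {}rho0 e : 0 < e -> \forall h \near 0, `|rho h| <= e * `|h|.
  by move=> e0; near=> h; rewrite rhoE; near: h; exact: rho0.
have rho00 : rho 0 = 0 by rewrite /rho add0r subrr sub0r linear0 oppr0.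
pose psi (i : 'I_n) (h : 'rV[K]_n) : K := if [pick j | `|h 0 j| == `|h|] == Some i then
  rho h / h 0 i else 0.
exists (fun i y => partial i f x + psi i (y - x)); split.
- by move=> i; rewrite subrr /psi rho00 mul0r if_same addr0.
- move=> i; apply/continuous_at_distP => e e0.
  have : \forall y \near x, `|rho (y - x)| <= e * `|y - x|.
    have := rho0 _ e0; rewrite -{1}(subrr x) => h.
    exact: (@shift_continuous K 'rV[K]_n (- x) x _ h).
  apply: filterS => y hy.
  rewrite subrr {1}/psi rho00 mul0r if_same addr0 opprD addrA subrr sub0r normrN.
  rewrite /psi; case: pickP => [j /eqP yj|_]; last by rewrite normr0 ltW.
  case: eqP => [[<-]|_]; last by rewrite normr0 ltW.
  have [->|yx0] := eqVneq (y - x) 0; first by rewrite rho00 mul0r normr0 ltW.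
  rewrite normrM normfV ler_pdivrMr; last by rewrite yj normr_gt0.
  by rewrite yj.
- near=> y.
  have -> : f y - f x = 'd f x (y - x) + rho (y - x) by rewrite [RHS]addrC /rho !subrK.
  under eq_bigr do rewrite mulrDl.
  rewrite big_split /=; congr (_ + _).
    rewrite {1}[y - x]matrix_sum_delta big_ord1 linear_sum; apply: eq_bigr => i _.
    by rewrite linearZ /= /partial deriveE// !mxE mulrC.
  have [->|yx0] := eqVneq (y - x) 0.
    by rewrite rho00 big1// => i _; rewrite /psi rho00 mul0r if_same mul0r.
  rewrite /psi; case: pickP => [j /eqP yj|/= nj].
    rewrite (bigD1 j)//= eqxx big1 ?addr0.
      have yj0 : (y - x) 0 j != 0 by rewrite -normr_gt0 yj normr_gt0.
      by move: yj0; rewrite !mxE => yj0; rewrite divfK.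
    by move=> i; rewrite eq_sym => /negbTE ij; case: eqP =>
      [[/eqP]|]; rewrite ?ij// mul0r.
  have /mx_norm_neq0[[i0 i]] : mx_norm (y - x) != 0.
    by apply: contra_neq yx0; exact: mx_norm_eq0.
  by rewrite ord1 => /esym/eqP; rewrite nj.
Unshelve. all: by end_near. Qed.

Lemma caratheodory_differentiable (K : numFieldType) n (f : 'rV[K]_n -> K) x w :
  caratheodory idfun f x w -> differentiable f x /\ forall i, partial i f x = w i.
Proof.
move=> [phi [phix phic fE]].
pose df (h : 'rV[K]_n) := \sum_i w i * h 0 i.
have dfl : linear df.
  move=> a u v; rewrite /df scaler_sumr -big_split; apply: eq_bigr => i _.
  by rewrite !mxE/= mulrDr mulrCA.
pose dfL : {linear 'rV[K]_n -> K} :=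
  HB.pack df (GRing.isLinear.Build _ _ _ _ df dfl).
have dfc : continuous dfL.
  move=> v; apply: continuous_at_sum => i.
  apply: continuous_at_mul; first exact: continuous_at_cst.
  exact: coord_continuous.
have fo : (f : 'rV[K]_n -> K^o) \o shift x =
    cst (f x) + (dfL : 'rV[K]_n -> K^o) +o_ (0 : 'rV[K]_n) id.
  apply/eqaddoP => e e0.
  (* n.+1 rather than n, which may be 0 *)
  pose d := e / n.+1%:R.
  have d0 : 0 < d by rewrite divr_gt0.
  have : \forall y \near x, forall i, `|phi i y - w i| <= d.
    apply: (@filter_forall _ _ _ (nbhs x)) => i.
    have /continuous_at_distP/(_ _ d0) := phic i.
    by apply: filterS => y; rewrite phix distrC.
  move=> near1.
  have sh : (fun h : 'rV[K]_n => h + x) @ (0 : 'rV[K]_n) --> x.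
    rewrite -[X in _ --> X]add0r.
    exact: shift_continuous.
  have h1 := sh _ near1; have h2 := sh _ fE.
  near=> h.
  have P1 : forall i, `|phi i (h + x) - w i| <= d by near: h.
  have P2 : f (h + x) - f x = \sum_i phi i (h + x) * ((h + x) 0 i - x 0 i) by near: h.
  set D := (X in `|X|); have -> : D = \sum_i (phi i (h + x) * ((h + x) 0 i - x 0 i)
    - w i * h 0 i).
    by rewrite sumrB -P2 -addrA -opprD.
  apply: (le_trans (ler_norm_sum _ _ _)).
  apply: (@le_trans _ _ (\sum_(i < n) d * `|h|)).
    apply: ler_sum => i _; rewrite !mxE addrK -mulrBl normrM.
    by apply: ler_pM => //; exact: norm_coord_le.
  rewrite sumr_const card_ord -[_ *+ _]mulr_natl mulrA ler_wpM2r//.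
  rewrite /d mulrCA; apply: ler_piMr; first exact: ltW.
  by rewrite ler_pdivrMr// mul1r ler_nat.
have /= dE := diff_unique dfc fo.
have fd : differentiable f x.
  apply/diff_locallyP; rewrite dE; split => //.
split=> // i; rewrite /partial deriveE// dE /= /df (bigD1 i)//= !mxE !eqxx mulr1.
by rewrite big1 ?addr0// => j ji; rewrite mxE eqxx (negbTE ji) mulr0.
Unshelve. all: by end_near. Qed.

(** * The ground fields *)

Section ComplexContinuity.
Variable R : realType.
Local Notation C := (complex R : numFieldType).

Lemma real_complex_continuous : continuous (real_complex R : R -> C).
Proof.
move=> x; apply/continuous_at_distP => e e0.
have [e1 e10 ee] : exists2 e1 : R, 0 < e1 & e = e1%:C.
  by exists (complex.Re e); [move: e0; rewrite ltcE => /andP[] | rewrite RRe_real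
    ?gtr0_real].
have /continuous_at_distP/(_ _ e10) : {for x, continuous (@id R)} by exact: cvg_id.
apply: filterS => y hy.
by rewrite -rmorphB normc_def/= expr0n addr0 sqrtr_sqr ee lecR.
Qed.

Lemma Re_continuous : continuous (@complex.Re R : C -> R).
Proof.
move=> x; apply/continuous_at_distP => e e0.
have e1 : (0 : C) < e%:C by rewrite ltcR.
have /continuous_at_distP/(_ _ e1) : {for x, continuous (@id C)} by exact: cvg_id.
apply: filterS => y hy; rewrite -lecR -raddfB.
exact: le_trans (normc_ge_Re _) hy.
Qed.

Lemma Im_continuous : continuous (@complex.Im R : C -> R).
Proof.
move=> x; have -> : @complex.Im R = (fun y : C => complex.Re (- 'i * y)) :> (C -> R).
  by apply/funext => -[a b]; simpc.
apply: (@continuous_comp C C R); last exact: Re_continuous.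
by apply: continuous_at_mul; [exact: continuous_at_cst|exact: cvg_id].
Qed.

Lemma caratheodory_Re n (f : 'rV[R]_n -> C) x w : caratheodory (real_complex R) f x w ->
  caratheodory idfun (fun y => complex.Re (f y)) x (fun i => complex.Re (w i)).
Proof.
move=> [phi [phix phic fE]].
exists (fun i y => complex.Re (phi i y)); split=> [j|j|].
- by rewrite phix.
- by apply: (@continuous_comp _ C R); [exact: phic|exact: Re_continuous].
- apply: filterS fE => y; rewrite -raddfB => ->.
  rewrite raddf_sum; apply: eq_bigr => j _.
  by case: (phi j y) => a b /=; rewrite mulr0 subr0.
Qed.

Lemma caratheodory_Im n (f : 'rV[R]_n -> C) x w : caratheodory (real_complex R) f x w ->
  caratheodory idfun (fun y => complex.Im (f y)) x (fun i => complex.Im (w i)).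
Proof.
move=> [phi [phix phic fE]].
exists (fun i y => complex.Im (phi i y)); split=> [j|j|].
- by rewrite phix.
- by apply: (@continuous_comp _ C R); [exact: phic|exact: Im_continuous].
- apply: filterS fE => y; rewrite -raddfB => ->.
  rewrite raddf_sum; apply: eq_bigr => j _.
  by case: (phi j y) => a b /=; rewrite mulr0 add0r mulrC.
Qed.

End ComplexContinuity.

Section GroundField.
Variables (R : realType) (k : geometry).
Local Notation C := (complex R : numFieldType).
Local Notation K := (ground R k).
Local Notation gi := (@ground_incl R k).

Lemma ground_incl_additive : {morph gi : x y / x - y}.
Proof. by case: k => //= x y; rewrite rmorphB. Qed.
Lemma ground_incl_multiplicative : monoid_morphism gi.
Proof. by case: k => //=; split => // x y; rewrite rmorphM. Qed.
HB.instance Definition _ := GRing.isZmodMorphism.Build K C gi ground_incl_additive.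
HB.instance Definition _ := GRing.isMonoidMorphism.Build K C gi
  ground_incl_multiplicative.

Lemma ground_incl_norm x : `|gi x| = gi `|x|.
Proof. by case: k x => //= x; rewrite normc_def/= expr0n addr0 sqrtr_sqr. Qed.

Lemma ground_incl_le x y : (gi x <= gi y) = (x <= y).
Proof. by case: k x y => //= x y; rewrite lecR. Qed.

Lemma ground_incl_inj : injective gi.
Proof. by case: k => //= x y []. Qed.

Lemma ground_incl_continuous : continuous (gi : K -> C).
Proof. by case: k; [move=> x; exact: cvg_id|exact: real_complex_continuous|move=> x;
  exact: cvg_id]. Qed.

(** A continuous left inverse of the inclusion in C, so that continuity of maps to K^n
    can be tested in C. *)
Definition ground_proj : C -> K :=
  match k return C -> ground R k with
  | Smooth => @complex.Re R
  | _ => id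
  end.

Lemma ground_inclK : cancel gi ground_proj.
Proof. by rewrite /ground_proj; case: k. Qed.

Lemma ground_proj_continuous : continuous (ground_proj : C -> K).
Proof. by rewrite /ground_proj; case: k; [move=> x;
  exact: cvg_id|exact: Re_continuous|move=> x; exact: cvg_id]. Qed.

(** Statements over both ground fields are reduced to real calculus by restriction to
    real lines and planes in K^n. *)
Definition ground_real : R -> K :=
  match k return R -> ground R k with
  | Smooth => id
  | _ => real_complex R
  end.

Lemma ground_realE t : gi (ground_real t) = t%:C.
Proof. by rewrite /ground_real; case: k. Qed.

Lemma ground_real_continuous : continuous (ground_real : R -> K).
Proof. by rewrite /ground_real; case: k; [exact: real_complex_continuous|move=> x;
  exact: cvg_id|exact: real_complex_continuous]. Qed.

Lemma ground_real0 : ground_real 0 = 0.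
Proof. by apply: ground_incl_inj; rewrite ground_realE !rmorph0. Qed.

Variable n : nat.
Implicit Types (f : 'rV[K]_n -> C) (x : 'rV[K]_n).

Local Notation has_gradient := (@caratheodory K C gi n).

(** Gradients are unique. *)
Lemma has_gradient_partial f x w : has_gradient f x w -> forall i, kpartial i f x = w i.
Proof.
move: f x w; rewrite /kpartial; case: k => /= f x w fw.
- exact: (@caratheodory_differentiable C n f x w fw).2.
- move=> i; have [_ ->] := caratheodory_differentiable (caratheodory_Re fw).
  by have [_ ->] := caratheodory_differentiable (caratheodory_Im fw); case: (w i).
- exact: (@caratheodory_differentiable C n f x w fw).2.
Qed.

End GroundField.

(** * Calculus over the ground field *)

Lemma near_neq0 (T : topologicalType) (K : numFieldType) (f : T -> K) x :
  {for x, continuous f} -> f x != 0 -> \forall y \near x, f y != 0.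
Proof.
move=> /continuous_at_distP fc fx0.
have /fc : 0 < `|f x| / 2 by rewrite divr_gt0// normr_gt0.
apply: filterS => y; apply: contraTneq => ->; rewrite subr0 lt_geF//.
by rewrite ltr_pdivrMr// ltr_pMr ?normr_gt0// ltr1n.
Qed.

Section Calculus.
Variables (R : realType) (k : geometry).
Local Notation C := (complex R : numFieldType).
Local Notation K := (ground R k).
Local Notation gi := (@ground_incl R k).

Definition has_gradient n (f : 'rV[K]_n -> C) x w := @caratheodory K C gi n f x w.
Definition kdiff n (f : 'rV[K]_n -> C) x := has_gradient f x (fun i => kpartial i f x).

Section OneSpace.
Variable n : nat.
Implicit Types (f g : 'rV[K]_n -> C) (x : 'rV[K]_n).

Lemma has_gradient_kdiff f x w : has_gradient f x w -> kdiff f x.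
Proof. by move=> fw; rewrite /kdiff (_ : (fun i => _) = w)//; apply/funext =>
  i; exact: has_gradient_partial. Qed.

Lemma has_gradient_near f g x w : (\forall y \near x, f y = g y)
  -> has_gradient f x w -> has_gradient g x w.
Proof.
move=> fg [phi [h1 h2 h3]]; exists phi; split=> //.
have fgx := nbhs_singleton fg.
by near=> y; rewrite -fgx -(near fg y)//; near: y.
Unshelve. all: by end_near. Qed.

Lemma has_gradient_continuous f x w : has_gradient f x w -> {for x, continuous f}.
Proof.
move=> [phi [h1 h2 h3]].
have c : {for x, continuous (fun y => f x + \sum_i phi i y * gi (y 0 i - x 0 i))}.
  apply: continuous_at_add; first exact: continuous_at_cst.
  apply: continuous_at_sum => i; apply: continuous_at_mul => //.
  apply: (@continuous_comp _ K C (fun y : 'rV[K]_n => y 0 i - x 0 i));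
    last exact: ground_incl_continuous.
  apply: continuous_at_add; first exact: coord_continuous.
  exact: continuous_at_cst.
have E : f x + \sum_i phi i x * gi (x 0 i - x 0 i) = f x.
  by rewrite big1 ?addr0// => i _; rewrite subrr rmorph0 mulr0.
move: c; rewrite /prop_for /continuous_at E; apply: cvg_trans.
have h4 : \forall y \near x, f x + \sum_i phi i y * gi (y 0 i - x 0 i) = f y.
  by apply: filterS h3 => y <-; rewrite addrC subrK.
exact: (near_eq_cvg h4).
Qed.

Lemma has_gradient_cst (a : C) x : has_gradient (fun=> a) x (fun=> 0).
Proof.
exists (fun _ _ => 0); split=> [//|i|]; first exact: continuous_at_cst.
by near=> y; rewrite subrr big1// => i _; rewrite mul0r.
Unshelve. all: by end_near. Qed.

Lemma has_gradient_coord i x : has_gradient (fun y => gi (y 0 i)) x (fun j =>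
  (j == i)%:R).
Proof.
exists (fun j _ => (j == i)%:R); split=> [//|j|]; first exact: continuous_at_cst.
near=> y; rewrite (bigD1 i)//= eqxx mul1r rmorphB big1 ?addr0//.
by move=> j /negbTE ->; rewrite mul0r.
Unshelve. all: by end_near. Qed.

Lemma has_gradientD f g x v w : has_gradient f x v -> has_gradient g x w ->
  has_gradient (fun y => f y + g y) x (fun i => v i + w i).
Proof.
move=> [phi [a1 a2 a3]] [psi [b1 b2 b3]].
exists (fun i y => phi i y + psi i y); split=> [i|i|].
- by rewrite a1 b1.
- exact: (continuous_at_add (a2 i) (b2 i)).
- near=> y; rewrite opprD addrACA.
  have -> : f y - f x = \sum_i phi i y * gi (y 0 i - x 0 i) by near: y.
  have -> : g y - g x = \sum_i psi i y * gi (y 0 i - x 0 i) by near: y.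
  by rewrite -big_split; apply: eq_bigr => i _; rewrite mulrDl.
Unshelve. all: by end_near. Qed.

Lemma has_gradientM f g x v w : has_gradient f x v -> has_gradient g x w ->
  has_gradient (fun y => f y * g y) x (fun i => v i * g x + f x * w i).
Proof.
move=> fv gw; have gc := has_gradient_continuous gw.
move: fv gw => [phi [a1 a2 a3]] [psi [b1 b2 b3]].
exists (fun i y => phi i y * g y + f x * psi i y); split=> [i|i|].
- by rewrite a1 b1.
- apply: (continuous_at_add (continuous_at_mul (a2 i) gc)).
  exact: (continuous_at_mul (@continuous_at_cst _ C (f x) x) (b2 i)).
- near=> y.
  have -> : f y * g y - f x * g x = (f y - f x) * g y + f x * (g y - g x) by ring.
  have -> : f y - f x = \sum_i phi i y * gi (y 0 i - x 0 i) by near: y.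
  have -> : g y - g x = \sum_i psi i y * gi (y 0 i - x 0 i) by near: y.
  rewrite mulr_suml mulr_sumr -big_split; apply: eq_bigr => i _ /=; ring.
Unshelve. all: by end_near. Qed.

Lemma has_gradientV f x v : f x != 0 -> has_gradient f x v ->
  has_gradient (fun y => (f y)^-1) x (fun i => - v i / f x ^+ 2).
Proof.
move=> fx0 fv; have fc := has_gradient_continuous fv.
have fn0 : \forall y \near x, f y != 0.
  exact: near_neq0 fc fx0.
move: fv => [phi [a1 a2 a3]].
exists (fun i y => - phi i y * ((f y)^-1 * (f x)^-1)); split=> [i|i|].
- by rewrite a1 -invfM expr2.
- apply: (continuous_at_mul (@continuousN _ C _ (phi i) x (a2 i))).
  exact: (continuous_at_mul (@continuousV C _ f x fx0 fc) (@continuous_at_cst _ C _ x)).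
- near=> y.
  have fy0 : f y != 0 by near: y.
  have -> : (f y)^-1 - (f x)^-1 = - (f y - f x) * ((f y)^-1 * (f x)^-1).
    by field; rewrite fy0 fx0.
  have -> : f y - f x = \sum_i phi i y * gi (y 0 i - x 0 i) by near: y.
  by rewrite -sumrN mulr_suml; apply: eq_bigr => i _; ring.
Unshelve. all: by end_near. Qed.

Lemma kpartial_near f g i x : (\forall y \near x, f y = g y) ->
  kpartial i f x = kpartial i g x.
Proof.
move: f g x; rewrite /kpartial /partial; case: k => f g x fg.
- exact: (near_eq_derive _ fg).
- have re : \forall y \near x, complex.Re (f y) = complex.Re (g y).
    by apply: filterS fg => y ->.
  have im : \forall y \near x, complex.Im (f y) = complex.Im (g y).
    by apply: filterS fg => y ->.
  by congr (_ +i* _); [exact: (near_eq_derive _ re)|exact: (near_eq_derive _ im)].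
- exact: (near_eq_derive _ fg).
Qed.

Lemma foldr_kpartial_eq f g V al x : open V -> (forall y, V y -> f y = g y) -> V x ->
  foldr (@kpartial R k n) f al x = foldr (@kpartial R k n) g al x.
Proof.
move=> Vo fg; elim: al x => [|i al IH] x Vx /=; first exact: fg.
by apply: kpartial_near; apply: filterS (open_nbhs_nbhs (conj Vo Vx)) => y /IH.
Qed.

End OneSpace.
End Calculus.

Lemma kdiff_holomorphic (R : realType) n
    (f : 'rV[complex R : numFieldType]_n -> (complex R : numFieldType)) x :
  @kdiff R Analytic n f x <-> differentiable f x.
Proof. by split=> [/(@caratheodory_differentiable _
  n)[]//|/(@differentiable_caratheodory _ n)]. Qed.

(** The coefficients of the real and imaginary parts combine to complex ones. *)
Lemma kdiff_real (R : realType) n (f : 'rV[R]_n -> complex R) x :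
  @kdiff R Smooth n f x <->
  differentiable (fun y => complex.Re (f y)) x /\
  differentiable (fun y => complex.Im (f y)) x.
Proof.
split=> [fw|[/(@differentiable_caratheodory _ n) re /(@differentiable_caratheodory _ n)
  im]].
  by split; [exact: (caratheodory_differentiable (caratheodory_Re fw)).1|exact:
    (caratheodory_differentiable (caratheodory_Im fw)).1].
move: re im => [phi [a1 a2 a3]] [psi [b1 b2 b3]].
apply: has_gradient_kdiff; exists (fun i y => (phi i y)%:C + 'i * (psi i y)%:C);
  split=> [//|i|].
  apply: (@continuous_at_add _ (complex R : numFieldType)).
    by apply: (@continuous_comp _ R); [exact: a2|exact: real_complex_continuous].
  apply: (@continuous_at_mul _ (complex R : numFieldType));
    first exact: continuous_at_cst.
  by apply: (@continuous_comp _ R); [exact: b2|exact: real_complex_continuous].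
near=> y; rewrite [f y]complexE [f x]complexE opprD addrACA -mulrBr -!rmorphB.
have -> : complex.Re (f y) - complex.Re (f x) = \sum_i phi i y * idfun (y 0 i - x 0 i)
  by near: y.
have -> : complex.Im (f y) - complex.Im (f x) = \sum_i psi i y * idfun (y 0 i - x 0 i)
  by near: y.
rewrite !rmorph_sum mulr_sumr -big_split; apply: eq_bigr => i _ /=.
by rewrite !rmorphM mulrDl mulrA.
Unshelve. all: by end_near. Qed.

Lemma foldr_kpartial_real (R : realType) n (f : 'rV[R]_n -> complex R) al :
  foldr (@kpartial R Smooth n) f al =
  fun x => foldr (@partial R n) (fun y => complex.Re (f y)) al x
        +i* foldr (@partial R n) (fun y => complex.Im (f y)) al x.
Proof.
elim: al => [|i al IH] /=; first by apply/funext => x; case: (f x).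
by rewrite IH.
Qed.

(** Every later argument about smoothness goes through this description, the same in
    the three geometries. *)
Lemma ksmoothP (R : realType) k n V (f : 'rV[ground R k]_n -> complex R) :
  ksmooth V f <-> forall al x, V x -> kdiff (foldr (@kpartial R k n) f al) x.
Proof.
move: V f; case: k => V f; rewrite /ksmooth /smooth_in; split.
- by move=> h al x Vx; apply/kdiff_holomorphic/h.
- by move=> h al x Vx; apply/kdiff_holomorphic/h.
- move=> [h1 h2] al x Vx; rewrite foldr_kpartial_real; apply/kdiff_real.
  by split; [exact: h1|exact: h2].
- move=> h; split=> al x Vx; have := h al x Vx;
    by rewrite foldr_kpartial_real => /kdiff_real[].
- by move=> h al x Vx; apply/kdiff_holomorphic/h.
- by move=> h al x Vx; apply/kdiff_holomorphic/h.
Qed.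

(** * The chain rule *)

Section Composition.
Variables (R : realType) (k : geometry).
Local Notation C := (complex R : numFieldType).
Local Notation K := (ground R k).
Local Notation gi := (@ground_incl R k).

Lemma row_continuous (T : topologicalType) p (phi : T -> 'rV[K]_p) x :
  (forall j, {for x, continuous (fun y => phi y 0 j)}) -> {for x, continuous phi}.
Proof.
move=> phic A [P Px PA]; rewrite /nbhs /=.
have : \forall y \near x, forall ij : 'I_1 * 'I_p, P ij.1 ij.2 (phi y ij.1 ij.2).
  apply: (@filter_forall _ _ _ (nbhs x)) => -[i j]; rewrite ord1 /=.
  by apply: (phic j); have := Px 0 j.
by apply: filterS => y Py; apply: PA => i j; exact: Py (i, j).
Qed.

Lemma incl_row_continuous (T : topologicalType) p (phi : T -> 'rV[K]_p) x :
  (forall j, {for x, continuous (fun y => gi (phi y 0 j) : C)}) ->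
  {for x, continuous phi}.
Proof.
move=> phic; apply: row_continuous => j.
have -> : (fun y => phi y 0 j) = @ground_proj R k \o (fun y => gi (phi y 0 j)).
  by apply/funext => y /=; rewrite ground_inclK.
by apply: continuous_comp; [exact: phic|exact: ground_proj_continuous].
Qed.

Lemma has_gradient_comp n p (f : 'rV[K]_p -> C) (phi : 'rV[K]_n -> 'rV[K]_p) x w v :
  has_gradient f (phi x) w -> (forall j, has_gradient (fun y =>
    gi (phi y 0 j)) x (v j)) ->
  has_gradient (f \o phi) x (fun i => \sum_j w j * v j i).
Proof.
move=> [F [F1 F2 F3]] phiv.
have phic : {for x, continuous phi}.
  by apply: incl_row_continuous => j; exact: has_gradient_continuous (phiv j).
have [P PP] := choice phiv.
exists (fun i y => \sum_j F j (phi y) * P j i y); split=> [i|i|].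
- by apply: eq_bigr => j _; rewrite F1; have [->] := PP j.
- apply: continuous_at_sum => j; apply: continuous_at_mul.
    by apply: continuous_comp phic _; exact: F2.
  by have [_ + _] := PP j; exact.
- have : \forall y \near x, forall j, gi (phi y 0 j) - gi (phi x 0 j)
    = \sum_i P j i y * gi (y 0 i - x 0 i).
    by apply: (@filter_forall _ _ _ (nbhs x)) => j; have [] := PP j.
  move=> near1; have near2 := phic _ F3.
  near=> y.
  have Py : forall j, gi (phi y 0 j) - gi (phi x 0 j) = \sum_i P j i y * gi (y 0 i - x
    0 i) by near: y.
  have -> : (f \o phi) y - (f \o phi) x = \sum_j F j (phi y)
    * gi (phi y 0 j - phi x 0 j) by near: y.
  transitivity (\sum_j \sum_i F j (phi y) * P j i y * gi (y 0 i - x 0 i)).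
    apply: eq_bigr => j _; rewrite rmorphB Py mulr_sumr.
    by apply: eq_bigr => i _; rewrite mulrA.
  by rewrite exchange_big; apply: eq_bigr => i _; rewrite mulr_suml.
Unshelve. all: by end_near. Qed.

Lemma kpartial_comp n p (f : 'rV[K]_p -> C) (phi : 'rV[K]_n -> 'rV[K]_p) x i :
  kdiff f (phi x) -> (forall j, kdiff (fun y => gi (phi y 0 j)) x) ->
  kpartial i (f \o phi) x =
  \sum_j kpartial j f (phi x) * kpartial i (fun y => gi (phi y 0 j)) x.
Proof. by move=> fd phid; rewrite (has_gradient_partial (has_gradient_comp fd phid)). Qed.

End Composition.

(** * Closure properties of smooth functions *)

Section Smooth.
Variables (R : realType) (k : geometry).
Local Notation C := (complex R : numFieldType).
Local Notation K := (ground R k).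
Local Notation gi := (@ground_incl R k).

(** Closure properties are proved by induction on the order, splitting off the
    innermost derivative. *)
Definition ksmooth_upto N n (V : set 'rV[K]_n) (f : 'rV[K]_n -> C) :=
  forall al x, (size al <= N)%N -> V x -> kdiff (foldr (@kpartial R k n) f al) x.

Section OneSpace.
Variable n : nat.
Implicit Types (f g : 'rV[K]_n -> C) (V : set 'rV[K]_n).

Lemma ksmooth_uptoP V f : ksmooth V f <-> forall N, ksmooth_upto N V f.
Proof.
split=> [/ksmoothP h N al x _|h]; first exact: h.
by apply/ksmoothP => al x; exact: h (leqnn _).
Qed.

Lemma ksmooth_upto0 V f : ksmooth_upto 0 V f <-> forall x, V x -> kdiff f x.
Proof. by split=> [h x /(h [::])|h [|//] x _ /h]; [exact|]. Qed.

Lemma ksmooth_uptoS N V f :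
  ksmooth_upto N.+1 V f <->
  (forall x, V x -> kdiff f x) /\ forall i, ksmooth_upto N V (kpartial i f).
Proof.
split=> [h|[h0 h] al x].
  split=> [x Vx|i al x aln Vx]; first exact: (h [::]).
  by have := h (rcons al i) x; rewrite size_rcons foldr_rcons; exact.
case/lastP: al => [_|al i]; first exact: h0.
by rewrite size_rcons foldr_rcons; exact: h.
Qed.

Lemma kdiff_near f g x : (\forall y \near x, f y = g y) -> kdiff f x -> kdiff g x.
Proof. by move=> fg fd; apply: has_gradient_kdiff (has_gradient_near fg fd). Qed.

Lemma kdiff_eq f g V x : open V -> (forall y, V y -> f y = g y) -> V x ->
  kdiff f x -> kdiff g x.
Proof. by move=> Vo fg Vx; apply: kdiff_near; exact: filterS (open_nbhs_nbhs (conj Vo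
  Vx)). Qed.

Lemma ksmooth_upto_eq N f g V : open V -> (forall y, V y -> f y = g y) ->
  ksmooth_upto N V f -> ksmooth_upto N V g.
Proof.
move=> Vo fg h al x aln Vx; apply: (kdiff_eq Vo _ Vx (h al x aln Vx)) => y Vy.
exact: foldr_kpartial_eq Vo fg Vy.
Qed.

Lemma ksmooth_uptoD N f g V : open V ->
  ksmooth_upto N V f -> ksmooth_upto N V g -> ksmooth_upto N V (fun y => f y + g y).
Proof.
move=> Vo; elim: N f g => [|N IH] f g.
  rewrite !ksmooth_upto0 => fd gd x Vx.
  exact: has_gradient_kdiff (has_gradientD (fd x Vx) (gd x Vx)).
rewrite !ksmooth_uptoS => -[f0 f1] [g0 g1]; split=> [x Vx|i].
  exact: has_gradient_kdiff (has_gradientD (f0 x Vx) (g0 x Vx)).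
apply: ksmooth_upto_eq (IH _ _ (f1 i) (g1 i)) => // y Vy.
by rewrite (has_gradient_partial (has_gradientD (f0 y Vy) (g0 y Vy))).
Qed.

Lemma ksmooth_uptoW N f V : ksmooth_upto N.+1 V f -> ksmooth_upto N V f.
Proof. by move=> h al x aln; apply: h; exact: leqW. Qed.

Lemma ksmooth_uptoM N f g V : open V ->
  ksmooth_upto N V f -> ksmooth_upto N V g -> ksmooth_upto N V (fun y => f y * g y).
Proof.
move=> Vo; elim: N f g => [|N IH] f g.
  rewrite !ksmooth_upto0 => fd gd x Vx.
  exact: has_gradient_kdiff (has_gradientM (fd x Vx) (gd x Vx)).
move=> fs gs; have fN := ksmooth_uptoW fs; have gN := ksmooth_uptoW gs.
move: fs gs; rewrite !ksmooth_uptoS => -[f0 f1] [g0 g1]; split=> [x Vx|i].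
  exact: has_gradient_kdiff (has_gradientM (f0 x Vx) (g0 x Vx)).
apply: ksmooth_upto_eq (ksmooth_uptoD Vo (IH _ _ (f1 i) gN) (IH _ _ fN (g1 i))) =>
  // y Vy.
by rewrite (has_gradient_partial (has_gradientM (f0 y Vy) (g0 y Vy))).
Qed.

Lemma ksmooth_upto_cst N (a : C) V : ksmooth_upto N V (fun=> a).
Proof.
elim: N a => [|N IH] a; first by apply/ksmooth_upto0 => x _;
  exact: has_gradient_kdiff (has_gradient_cst _ _).
apply/ksmooth_uptoS; split=> [x _|i]; first exact: has_gradient_kdiff (has_gradient_cst
  _ _).
rewrite (_ : kpartial i _ = fun=> 0)//.
by apply/funext => x; rewrite (has_gradient_partial (has_gradient_cst _ _)).
Qed.

Lemma ksmooth_upto_sum N I (r : seq I) (F : I -> 'rV[K]_n -> C) V : open V ->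
  (forall i, ksmooth_upto N V (F i)) -> ksmooth_upto N V (fun y => \sum_(i <- r) F i y).
Proof.
move=> Vo Fs; elim: r => [|i r IH].
  under eq_fun do rewrite big_nil.
  exact: ksmooth_upto_cst.
under eq_fun do rewrite big_cons.
exact: ksmooth_uptoD.
Qed.

Lemma ksmooth_uptoV N f V : open V -> (forall x, V x -> f x != 0) ->
  ksmooth_upto N V f -> ksmooth_upto N V (fun y => (f y)^-1).
Proof.
move=> Vo fn0; elim: N => [|N IH].
  rewrite !ksmooth_upto0 => fd x Vx.
  exact: has_gradient_kdiff (has_gradientV (fn0 x Vx) (fd x Vx)).
move=> fs; have Vs := IH (ksmooth_uptoW fs).
move: fs; rewrite !ksmooth_uptoS => -[f0 f1]; split=> [x Vx|i].
  exact: has_gradient_kdiff (has_gradientV (fn0 x Vx) (f0 x Vx)).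
apply: (@ksmooth_upto_eq _ (fun y => (-1 * kpartial i f y) * ((f y)^-1 * (f y)^-1))) =>
  //.
  move=> y Vy; rewrite (has_gradient_partial (has_gradientV (fn0 y Vy) (f0 y Vy))).
  by rewrite mulN1r -invfM expr2.
by do 2 ?apply: ksmooth_uptoM => //; exact: ksmooth_upto_cst.
Qed.

End OneSpace.

Lemma ksmooth_upto_comp N n p (f : 'rV[K]_p -> C) (phi : 'rV[K]_n -> 'rV[K]_p) V W :
  open V -> open W -> (forall x, V x -> W (phi x)) ->
  ksmooth_upto N W f -> (forall j, ksmooth_upto N V (fun y => gi (phi y 0 j))) ->
  ksmooth_upto N V (f \o phi).
Proof.
move=> Vo Wo VW; elim: N f => [|N IH] f.
  rewrite ksmooth_upto0 => fd phid; apply/ksmooth_upto0 => x Vx.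
  apply: has_gradient_kdiff (has_gradient_comp (fd _ (VW x Vx)) _) => j.
  by have /ksmooth_upto0 := phid j; exact.
move=> fs phis; have phiN j := ksmooth_uptoW (phis j).
have /ksmooth_uptoS [f0 f1] := fs.
have phi0 j : forall x, V x -> kdiff (fun y => gi (phi y 0 j)) x.
  by have /ksmooth_uptoS [] := phis j.
have phi1 j : forall i, ksmooth_upto N V (kpartial i (fun y => gi (phi y 0 j))).
  by have /ksmooth_uptoS [] := phis j.
apply/ksmooth_uptoS; split=> [x Vx|i].
  by apply: has_gradient_kdiff (has_gradient_comp (f0 _ (VW x Vx)) _) => j; exact: phi0.
apply: (@ksmooth_upto_eq _ _ (fun y => \sum_j (kpartial j f \o phi)
  y * kpartial i (fun y => gi (phi y 0 j)) y)) => //.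
  by move=> y Vy; rewrite (kpartial_comp _ (f0 _ (VW y Vy)))// => j; exact: phi0.
apply: ksmooth_upto_sum => // j; apply: ksmooth_uptoM => //.
by apply: IH => //; exact: f1.
Qed.

Section Closure.
Variable n : nat.
Implicit Types (f g : 'rV[K]_n -> C) (V : set 'rV[K]_n).

Lemma ksmooth_kdiff f V x : ksmooth V f -> V x -> kdiff f x.
Proof. by move=> /ksmoothP/(_ [::] x) h /h. Qed.

Lemma ksmooth_foldr f V al : ksmooth V f -> ksmooth V (foldr (@kpartial R k n) f al).
Proof.
by move=> /ksmoothP h; apply/ksmoothP => be x Vx; rewrite -foldr_cat; exact: h.
Qed.

Lemma ksmooth_sub f V W : W `<=` V -> ksmooth V f -> ksmooth W f.
Proof. by move=> WV /ksmoothP h; apply/ksmoothP => al x /WV; exact: h. Qed.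

Lemma ksmooth_local f V : (forall x, V x -> exists2 W : set 'rV[K]_n,
  W x & ksmooth W f) -> ksmooth V f.
Proof.
move=> h; apply/ksmoothP => al x Vx; have [W Wx /ksmoothP] := h x Vx; exact.
Qed.

Lemma ksmooth_eq f g V : open V -> (forall y, V y -> f y = g y) ->
  ksmooth V f -> ksmooth V g.
Proof. by move=> Vo fg /ksmooth_uptoP fs; apply/ksmooth_uptoP =>
  N; exact: ksmooth_upto_eq (fs N). Qed.

Lemma ksmooth_cst (a : C) V : ksmooth V (fun=> a : C).
Proof. by apply/ksmooth_uptoP => N; exact: ksmooth_upto_cst. Qed.

Lemma ksmooth_coord i V : ksmooth V (fun x => gi (x 0 i)).
Proof.
apply/ksmooth_uptoP => -[|N].
  by apply/ksmooth_upto0 => x _; exact: has_gradient_kdiff (has_gradient_coord _ _).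
apply/ksmooth_uptoS; split=> [x _|j]; first exact: has_gradient_kdiff
  (has_gradient_coord _ _).
rewrite (_ : kpartial j _ = fun=> (j == i)%:R); first exact: ksmooth_upto_cst.
by apply/funext => x; rewrite (has_gradient_partial (has_gradient_coord _ _)).
Qed.

Lemma ksmoothM f g V : open V -> ksmooth V f -> ksmooth V g -> ksmooth V (fun y =>
  f y * g y).
Proof. by move=> Vo /ksmooth_uptoP fs /ksmooth_uptoP gs; apply/ksmooth_uptoP =>
  N; exact: ksmooth_uptoM. Qed.

Lemma ksmoothV f V : open V -> (forall x, V x -> f x != 0) ->
  ksmooth V f -> ksmooth V (fun y => (f y)^-1).
Proof. by move=> Vo f0 /ksmooth_uptoP fs; apply/ksmooth_uptoP =>
  N; exact: ksmooth_uptoV. Qed.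

Lemma ksmooth_sum I (r : seq I) (F : I -> 'rV[K]_n -> C) V : open V ->
  (forall i, ksmooth V (F i)) -> ksmooth V (fun y => \sum_(i <- r) F i y).
Proof.
move=> Vo Fs; apply/ksmooth_uptoP => N; apply: ksmooth_upto_sum => // i.
by have /ksmooth_uptoP := Fs i; exact.
Qed.

End Closure.

Lemma ksmooth_comp n p (f : 'rV[K]_p -> C) (phi : 'rV[K]_n -> 'rV[K]_p) V W :
  open V -> open W -> (forall x, V x -> W (phi x)) ->
  ksmooth W f -> (forall j, ksmooth V (fun y => gi (phi y 0 j))) ->
  ksmooth V (f \o phi).
Proof.
move=> Vo Wo VW /ksmooth_uptoP fs phis; apply/ksmooth_uptoP => N.
apply: (ksmooth_upto_comp Vo Wo VW) => // j.
by have /ksmooth_uptoP := phis j; exact.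
Qed.

End Smooth.

(** * Partial derivatives on a product *)

Section Slices.
Variables (R : realType) (k : geometry) (m n : nat).
Local Notation C := (complex R : numFieldType).
Local Notation K := (ground R k).

Lemma delta_mx_rshift (F : pzRingType) (i : 'I_n) :
  delta_mx 0 (rshift m i) = row_mx 0 (delta_mx 0 i) :> 'rV[F]_(m + n).
Proof.
apply/rowP => j; rewrite !mxE eqxx; case: split_ordP => l ->; rewrite !mxE ?eqxx /=.
  by rewrite eq_lrshift.
by rewrite eq_rshift.
Qed.

Lemma delta_mx_lshift (F : pzRingType) (i : 'I_m) :
  delta_mx 0 (lshift n i) = row_mx (delta_mx 0 i) 0 :> 'rV[F]_(m + n).
Proof.
apply/rowP => j; rewrite !mxE eqxx; case: split_ordP => l ->; rewrite !mxE ?eqxx /=.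
  by rewrite eq_lshift.
by rewrite eq_rlshift.
Qed.

Lemma partial_rshift (F : numFieldType) i (h : 'rV[F]_(m + n) -> F) u y :
  partial (rshift m i) h (row_mx u y) = partial i (fun y => h (row_mx u y)) y.
Proof.
rewrite /partial /derive.
have -> : (fun c => c^-1 *: ((h \o shift (row_mx u y)) (c *: delta_mx 0 (rshift m i))
  - h (row_mx u y)))
  = (fun c => c^-1 *: (((fun y => h (row_mx u y)) \o shift y) (c *: delta_mx 0 i)
    - h (row_mx u y))).
  apply/funext => c /=.
  by rewrite delta_mx_rshift scale_row_mx scaler0 add_row_mx add0r.
by [].
Qed.

Lemma partial_lshift (F : numFieldType) i (h : 'rV[F]_(m + n) -> F) u y :
  partial (lshift n i) h (row_mx u y) = partial i (fun u => h (row_mx u y)) u.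
Proof.
rewrite /partial /derive.
have -> : (fun c => c^-1 *: ((h \o shift (row_mx u y)) (c *: delta_mx 0 (lshift n i))
  - h (row_mx u y)))
  = (fun c => c^-1 *: (((fun u => h (row_mx u y)) \o shift u) (c *: delta_mx 0 i)
    - h (row_mx u y))).
  apply/funext => c /=.
  by rewrite delta_mx_lshift scale_row_mx scaler0 add_row_mx add0r.
by [].
Qed.

Lemma kpartial_rshift i (h : 'rV[K]_(m + n) -> C) u y :
  kpartial (rshift m i) h (row_mx u y) = kpartial i (fun y => h (row_mx u y)) y.
Proof.
move: h u y; rewrite /kpartial; case: k => h u y.
- exact: (@partial_rshift C).
- exact: (congr2 (@Complex R) (@partial_rshift R _ _ _ _) (@partial_rshift R _ _ _ _)).
- exact: (@partial_rshift C).
Qed.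

Lemma kpartial_lshift i (h : 'rV[K]_(m + n) -> C) u y :
  kpartial (lshift n i) h (row_mx u y) = kpartial i (fun u => h (row_mx u y)) u.
Proof.
move: h u y; rewrite /kpartial; case: k => h u y.
- exact: (@partial_lshift C).
- exact: (congr2 (@Complex R) (@partial_lshift R _ _ _ _) (@partial_lshift R _ _ _ _)).
- exact: (@partial_lshift C).
Qed.

Lemma foldr_kpartial_rshift al (h : 'rV[K]_(m + n) -> C) u y :
  foldr (@kpartial R k _) h (map (@rshift m n) al) (row_mx u y) =
  foldr (@kpartial R k _) (fun y => h (row_mx u y)) al y.
Proof.
elim: al y => [//|i al IH] y /=; rewrite kpartial_rshift.
by congr (kpartial i _ y); apply/funext => z; exact: IH.
Qed.

End Slices.

(** * Symmetry of second derivatives *)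

Section RealSchwarz.
Variable R : realType.

Lemma MVT0 (f df : R -> R) (b : R) : 0 < b ->
  (forall x, 0 <= x <= b -> is_derive x 1 f (df x)) ->
  exists c, 0 < c < b /\ f b - f 0 = b * df c.
Proof.
move=> b0 fd.
have [||c cb ->] := MVT b0 (f := f) (df := df).
- by move=> x; rewrite in_itv /= => /andP[/ltW x0 /ltW xb]; apply: fd; rewrite x0.
- apply: derivable_within_continuous => x; rewrite in_itv /= => xb.
  exact: (fd x xb).(ex_derive).
- by exists c; move: cb; rewrite in_itv /= subr0 mulrC.
Qed.

(** By the mean value theorem for s |-> F s t - F s 0, the second difference is t times
    a difference of values of P, which the expansion of P at 0 controls. *)
Lemma second_difference (F P : R -> R -> R) (a b e d : R) :
  (forall s t : R, `|s| < d -> `|t| < d -> is_derive s 1 (F^~ t) (P s t)) ->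
  (forall s t : R, `|s| < d -> `|t| < d ->
     `|P s t - P 0 0 - (s * a + t * b)| <= e * (`|s| + `|t|)) ->
  0 <= e -> forall t, 0 < t < d ->
  `|F t t - F t 0 - F 0 t + F 0 0 - t * (t * b)| <= t * (e * (t + t + t)).
Proof.
move=> Fd Pe e0 t /andP[t0 td].
have dpos : 0 < d by exact: lt_trans td.
have [|c [/andP[c0 ct]]] := @MVT0 (fun s => F s t - F s 0) (fun s => P s t - P s 0) t t0.
  move=> s /andP[s0 st].
  have sd : `|s| < d by rewrite ger0_norm// (le_lt_trans st).
  have := Fd s t sd; rewrite ger0_norm ?ltW// => /(_ td) d1.
  have := Fd s 0 sd; rewrite normr0 => /(_ dpos) d2.
  exact: is_deriveB.
have -> : F t t - F t 0 - (F 0 t - F 0 0) = F t t - F t 0 - F 0 t + F 0 0 by ring.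
move=> ->; rewrite -mulrBr normrM (gtr0_norm t0); apply: ler_wpM2l; first exact: ltW.
have cd : `|c| < d by rewrite gtr0_norm// (lt_trans ct).
have := Pe c t cd; rewrite (gtr0_norm c0) (gtr0_norm t0) => /(_ td) h1.
have := Pe c 0 cd; rewrite (gtr0_norm c0) normr0 => /(_ dpos) h2.
have -> : P c t - P c 0 - t * b =
  (P c t - P 0 0 - (c * a + t * b)) - (P c 0 - P 0 0 - (c * a + 0 * b)) by ring.
apply: (le_trans (ler_normB _ _)); apply: (le_trans (lerD h1 h2)).
rewrite -mulrDr ler_wpM2l// addr0; lra.
Qed.

(** Both mixed derivatives are the limit of the second difference divided by t^2. *)
Lemma real_schwarz (F P Q : R -> R -> R) (a b b' a' : R) :
  (exists2 d, 0 < d & forall s t : R, `|s| < d -> `|t| < d ->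
     is_derive s 1 (F^~ t) (P s t) /\ is_derive t 1 (F s) (Q s t)) ->
  (forall e, 0 < e -> exists2 d, 0 < d & forall s t : R, `|s| < d -> `|t| < d ->
     `|P s t - P 0 0 - (s * a + t * b)| <= e * (`|s| + `|t|)) ->
  (forall e, 0 < e -> exists2 d, 0 < d & forall s t : R, `|s| < d -> `|t| < d ->
     `|Q s t - Q 0 0 - (s * b' + t * a')| <= e * (`|s| + `|t|)) ->
  b = b'.
Proof.
move=> [d0 d0p Fd] Pe Qe; apply/eqP; rewrite -subr_eq0 -normr_le0;
  apply/ler_addgt0Pr => e e0.
(* each second difference is off by at most 3 t^2 (e / 6) *)
rewrite add0r; have e6 : 0 < e / 6 by rewrite divr_gt0.
have [d1 d1p {}Pe] := Pe _ e6; have [d2 d2p {}Qe] := Qe _ e6.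
pose d : R := Num.min d0 (Num.min d1 d2).
have dp : 0 < d by rewrite !lt_min d0p d1p d2p.
have lts (s : R) : `|s| < d -> [/\ `|s| < d0, `|s| < d1 & `|s| < d2].
  by rewrite !lt_min => /and3P[].
have [t td] : exists t : R, 0 < t < d.
  by exists (d / 2); rewrite divr_gt0//= ltr_pdivrMr// ltr_pMr// ltr1n.
have h1 : `|F t t - F t 0 - F 0 t + F 0 0 - t * (t * b)| <= t * (e / 6 * (t + t + t)).
  apply: (@second_difference F P a b (e / 6) d _ _ (ltW e6) t td) =>
    s u /lts[s0 s1 _] /lts[u0 u1 _].
    exact: (Fd s u s0 u0).1.
  exact: Pe.
have h2 : `|F t t - F 0 t - F t 0 + F 0 0 - t * (t * b')| <= t * (e / 6 * (t + t + t)).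
  apply: (@second_difference (fun s t => F t s) (fun s t =>
    Q t s) a' b' (e / 6) d _ _ (ltW e6) t td) => s u /lts[s0 _ s1] /lts[u0 _ u1].
    exact: (Fd u s u0 s0).2.
  by rewrite [s * _ + _]addrC [`|s| + _]addrC; exact: Qe.
move: td => /andP[t0 _].
have : `|t * (t * (b - b'))| <= t * (t * e).
  have -> : t * (t * (b - b')) = (F t t - F 0 t - F t 0 + F 0 0 - t * (t * b'))
     - (F t t - F t 0 - F 0 t + F 0 0 - t * (t * b)) by ring.
  apply: (le_trans (ler_normB _ _)); apply: (le_trans (lerD h2 h1)).
  by rewrite le_eqVlt; apply/orP; left; apply/eqP; field.
by rewrite normrM normrM (@gtr0_norm R t t0) (ler_pM2l t0) (ler_pM2l t0).
Qed.

End RealSchwarz.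

Section Gradient.
Variables (R : realType) (k : geometry).
Local Notation C := (complex R : numFieldType).
Local Notation K := (ground R k).
Local Notation gi := (@ground_incl R k).
Local Notation gr := (@ground_real R k).

Lemma is_derive_quotient (h : R -> R) (kap : R -> R) t :
  {for t, continuous kap} -> (\forall s \near t, h s - h t = (s - t) * kap s) ->
  is_derive t 1 h (kap t).
Proof.
move=> kc hk.
have sh : {for 0, continuous (fun c : R => c + t)} by exact: (@shift_continuous R R).
have cv : (fun c => c^-1 *: ((h \o shift t) (c *: (1 : R)) - h t)) @ 0^' --> kap t.
  have k2 : (fun c : R => kap (c + t)) @ 0^' --> kap t.
    apply: cvg_within_filter; rewrite -{2}[t]add0r.
    apply: (@continuous_comp _ _ _ (fun c : R => c + t) kap 0 sh).
    by rewrite add0r.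
  apply: cvg_trans k2; apply: near_eq_cvg.
  have hk' : \forall c \near 0, h (c + t) - h t = (c + t - t) * kap (c + t).
    by move: hk; rewrite -{1}[t]add0r => /sh.
  move: hk'; rewrite !nearE /= => hk'.
  apply: (@filterS _ (nbhs 0) _ _ _ _ hk') => c hc c0 /=.
  by rewrite -[c *: 1]/(c * 1) mulr1 hc addrK -[_ *: _]/(_ * _) mulKf.
split; first by apply/cvg_ex; exists (kap t).
exact: cvg_lim cv.
Qed.

Variable n : nat.
Implicit Types (f : 'rV[K]_n -> C) (x y v : 'rV[K]_n).

Lemma line_continuous y v t : {for t, continuous (fun s : R => y + gr s *: v)}.
Proof.
apply: row_continuous => j.
rewrite (_ : (fun s => _) = (fun s : R => y 0 j + gr s * v 0 j)); last first.
  by apply/funext => s; rewrite !mxE.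
apply: (continuous_at_add (@continuous_at_cst _ K _ t)).
apply: (continuous_at_mul _ (@continuous_at_cst _ K _ t)).
exact: ground_real_continuous.
Qed.

(** Real functions Re (c f) on real lines; c = 1 and c = i recover f. *)
Lemma has_gradient_line (c : C) f w y v t : has_gradient f (y + gr t *: v) w ->
  is_derive t 1 (fun s : R => complex.Re (c * f (y + gr s *: v)))
    (complex.Re (c * \sum_i w i * gi (v 0 i))).
Proof.
move=> [phi [phix phic fE]].
pose kap (s : R) := complex.Re (c * \sum_i phi i (y + gr s *: v) * gi (v 0 i)).
have -> : complex.Re (c * \sum_i w i * gi (v 0 i)) = kap t.
  by congr (complex.Re (c * _)); apply: eq_bigr => i _; rewrite phix.
apply: is_derive_quotient.
  apply: (@continuous_comp _ C R _ (@complex.Re R)); last exact: Re_continuous.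
  apply: (continuous_at_mul (@continuous_at_cst _ C _ t)).
  apply: (@continuous_at_sum R C n (fun i s => phi i (y + gr s *: v) * gi (v 0 i))) => i.
  apply: (continuous_at_mul _ (@continuous_at_cst _ C _ t)).
  apply: (@continuous_comp R 'rV[K]_n C (fun s => y + gr s *: v) (phi i) t _ (phic i)).
  exact: line_continuous.
near=> s.
have fs : f (y + gr s *: v) - f (y + gr t *: v) =
    \sum_i phi i (y + gr s *: v) * gi ((y + gr s *: v) 0 i - (y + gr t *: v) 0 i).
  by near: s; exact: (@line_continuous y v t _ fE).
rewrite -raddfB -mulrBr fs.
have -> : \sum_i phi i (y + gr s *: v) * gi ((y + gr s *: v) 0 i - (y + gr t *: v) 0 i)
        = (s - t)%:C * \sum_i phi i (y + gr s *: v) * gi (v 0 i).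
  rewrite mulr_sumr; apply: eq_bigr => i _; rewrite !mxE.
  rewrite opprD addrACA subrr add0r -mulrBl.
  have -> : gi ((gr s - gr t) * v 0 i) = (s - t)%:C * gi (v 0 i).
    by rewrite rmorphM /= [X in X * _ = _]rmorphB /= !ground_realE -rmorphB.
  by rewrite mulrCA.
rewrite mulrCA /kap; set S := c * _; clearbody S; case: S => a b /=.
by rewrite mul0r subr0.
Unshelve. all: by end_near. Qed.

Lemma sum_delta (w : 'I_n -> C) i :
  \sum_l w l * gi ((delta_mx 0 i : 'rV[K]_n) 0 l) = w i.
Proof.
rewrite (bigD1 i)//= mxE !eqxx rmorph1 mulr1 big1 ?addr0//.
by move=> j /negbTE ji; rewrite mxE eqxx ji rmorph0 mulr0.
Qed.

Lemma kdiff_line (c : C) f y i t : kdiff f (y + gr t *: delta_mx 0 i) ->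
  is_derive t 1 (fun s : R => complex.Re (c * f (y + gr s *: delta_mx 0 i)))
    (complex.Re (c * kpartial i f (y + gr t *: delta_mx 0 i))).
Proof.
move=> fd; have h := @has_gradient_line c f _ y (delta_mx 0 i) t fd.
by rewrite (sum_delta (fun l => kpartial l f (y + gr t *: delta_mx 0 i))) in h.
Qed.

Lemma square_near (P : R * R -> Prop) : (\forall z \near ((0, 0) : R * R), P z) ->
  exists2 d : R, 0 < d & forall s t, `|s| < d -> `|t| < d -> P (s, t).
Proof.
move=> /nbhs_ballP[d /= d0 dP]; exists d => // s t sd td; apply: dP.
by split; rewrite /ball /= sub0r normrN.
Qed.

Lemma ReD (a b : C) : complex.Re (a + b) = complex.Re a + complex.Re b.
Proof. by case: a b => [? ?] [? ?]. Qed.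

Lemma ReB (a b : C) : complex.Re (a - b) = complex.Re a - complex.Re b.
Proof. by case: a b => [? ?] [? ?]. Qed.

Lemma eq_complexRe (a b : C) :
  (forall c : C, complex.Re (c * a) = complex.Re (c * b)) -> a = b.
Proof.
move=> E; have := E 1; have := E 'i; rewrite !mul1r ![_ * a]mulrC ![_ * b]mulrC !ReiNIm.
by case: a b {E} => a a' [b b'] /= /oppr_inj -> ->.
Qed.

Lemma Re_realM (t : R) (S : C) : complex.Re (t%:C * S) = t * complex.Re S.
Proof. by case: S => a b /=; rewrite mul0r subr0. Qed.

Definition plane x i j (z : R * R) : 'rV[K]_n :=
  x + gr z.1 *: delta_mx 0 i + gr z.2 *: delta_mx 0 j.

Lemma plane0 x i j : plane x i j (0, 0) = x.
Proof. by rewrite /plane ground_real0 !scale0r !addr0. Qed.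

Lemma plane_continuous x i j z : {for z, continuous (plane x i j)}.
Proof.
apply: row_continuous => l.
have -> : (fun z => plane x i j z 0 l) = (fun z : R * R =>
  x 0 l + gr z.1 * (delta_mx 0 i : 'rV[K]_n) 0 l + gr z.2 * (delta_mx 0 j : 'rV[K]_n)
  0 l).
  by apply/funext => s; rewrite !mxE.
have gc1 : {for z, continuous (fun z : R * R => gr z.1)}.
  by apply: (@continuous_comp _ R K fst gr); [exact: cvg_fst|exact:
    ground_real_continuous].
have gc2 : {for z, continuous (fun z : R * R => gr z.2)}.
  by apply: (@continuous_comp _ R K snd gr); [exact: cvg_snd|exact:
    ground_real_continuous].
apply: (continuous_at_add (continuous_at_add (@continuous_at_cst _ K _ z) _)).
  exact: (continuous_at_mul gc1 (@continuous_at_cst _ K _ z)).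
exact: (continuous_at_mul gc2 (@continuous_at_cst _ K _ z)).
Qed.

(** The expansion in a real plane that [real_schwarz] requires. *)
Lemma has_gradient_square (c : C) f x w i j : has_gradient f x w -> forall e, 0 < e ->
  exists2 d : R, 0 < d & forall s t : R, `|s| < d -> `|t| < d ->
    `|complex.Re (c * f (plane x i j (s, t))) - complex.Re (c * f (plane x i j (0, 0)))
      - (s * complex.Re (c * w i) + t * complex.Re (c * w j))|
    <= e * (`|s| + `|t|).
Proof.
move=> [phi [phix phic fE]] e e0.
pose rho l z := complex.Re (c * phi l (plane x i j z)).
have rhoc l : {for (0, 0), continuous (rho l)}.
  apply: (@continuous_comp _ C R _ (@complex.Re R)); last exact: Re_continuous.
  apply: (continuous_at_mul (@continuous_at_cst _ C c ((0, 0) : R * R))).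
  apply: (@continuous_comp _ 'rV[K]_n C (plane x i j) (phi l));
    first exact: plane_continuous.
  by rewrite plane0; exact: phic.
have rho0 l : rho l (0, 0) = complex.Re (c * w l) by rewrite /rho plane0 phix.
have /continuous_at_distP/(_ _ e0) ni := rhoc i.
have /continuous_at_distP/(_ _ e0) nj := rhoc j.
have nf : \forall z \near ((0, 0) : R * R), f (plane x i j z) - f x =
    \sum_l phi l (plane x i j z) * gi ((plane x i j z) 0 l - x 0 l).
  have := @plane_continuous x i j (0, 0).
  rewrite /prop_for /continuous_at plane0 => h; exact: h fE.
apply: (@square_near (fun z => `|complex.Re (c * f (plane x i j z))
  - complex.Re (c * f (plane x i j (0, 0)))
      - (z.1 * complex.Re (c * w i) + z.2 * complex.Re (c * w j))|
    <= e * (`|z.1| + `|z.2|))).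
near=> z.
have ni1 : `|rho i (0, 0) - rho i z| <= e by near: z.
have nj1 : `|rho j (0, 0) - rho j z| <= e by near: z.
have nf1 : f (plane x i j z) - f x =
    \sum_l phi l (plane x i j z) * gi ((plane x i j z) 0 l - x 0 l) by near: z.
have nf2 : f (plane x i j z) - f x = z.1%:C * phi i (plane x i j z)
  + z.2%:C * phi j (plane x i j z).
  rewrite nf1.
  transitivity (\sum_l (z.1%:C * (phi l (plane x i j z) * gi ((delta_mx 0 i : 'rV[K]_n)
    0 l)) + z.2%:C * (phi l (plane x i j z) * gi ((delta_mx 0 j : 'rV[K]_n) 0 l)))).
    apply: eq_bigr => l _.
    have -> : plane x i j z 0 l - x 0 l =
       gr z.1 * (delta_mx 0 i : 'rV[K]_n) 0 l + gr z.2 * (delta_mx 0 j : 'rV[K]_n) 0 l.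
      by rewrite !mxE; ring.
    by rewrite rmorphD /= !rmorphM /= !ground_realE; ring.
  by rewrite big_split -!mulr_sumr (sum_delta (fun l => phi l _)) (sum_delta (fun l =>
    phi l _)).
have E : complex.Re (c * f (plane x i j z)) - complex.Re (c * f (plane x i j (0, 0))) =
    z.1 * rho i z + z.2 * rho j z.
  by rewrite plane0 -ReB -mulrBr nf2 mulrDr ReD ![c * (_%:C * _)]mulrCA !Re_realM.
move: (complex.Re (c * f (plane x i j z)) - _) E => _ ->.
rewrite -(rho0 i).
rewrite -(rho0 j).
clearbody rho.
rewrite opprD addrACA -!mulrBr [e * _]mulrDr.
apply: (le_trans (ler_normD _ _)).
by apply: lerD; rewrite normrM [e * _]mulrC; apply: ler_wpM2l; rewrite // distrC.
Unshelve. all: by end_near. Qed.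

(** Schwarz's theorem for Re (c f) in the real plane of two coordinate directions. *)
Lemma kpartial_comm f V i j x : open V -> ksmooth V f -> V x ->
  kpartial i (kpartial j f) x = kpartial j (kpartial i f) x.
Proof.
move=> Vo fs Vx.
have fd al : forall y, V y -> kdiff (foldr (@kpartial R k n) f al) y.
  by move=> y Vy; have /ksmoothP := fs; apply.
have key (c : C) : complex.Re (c * kpartial j (kpartial i f) x)
  = complex.Re (c * kpartial i (kpartial j f) x).
  apply: (@real_schwarz R (fun s t => complex.Re (c * f (plane x i j (s, t))))
    (fun s t => complex.Re (c * kpartial i f (plane x i j (s, t))))
    (fun s t => complex.Re (c * kpartial j f (plane x i j (s, t))))
    (complex.Re (c * kpartial i (kpartial i f) x)) _ _
    (complex.Re (c * kpartial j (kpartial j f) x))).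
  - have nV : \forall z \near ((0, 0) : R * R), V (plane x i j z).
      have := @plane_continuous x i j (0, 0).
      rewrite /prop_for /continuous_at plane0 => h; apply: h.
      by apply: open_nbhs_nbhs; split.
    have [d d0 dV] := square_near nV; exists d => // s t sd td.
    have Vst := dV s t sd td; split; last exact: (kdiff_line c (fd [::] _ Vst)).
    have E (s' : R) : plane x i j (s', t) = (x + gr t *: delta_mx 0 j)
      + gr s' *: delta_mx 0 i.
      by rewrite /plane addrAC.
    move: Vst; rewrite E => /(fd [::])/= Vst; have := kdiff_line c Vst.
    by under eq_fun do rewrite -E.
  - exact: (@has_gradient_square c (kpartial i f) x _ i j (fd [:: i] x Vx)).
  - exact: (@has_gradient_square c (kpartial j f) x _ i j (fd [:: j] x Vx)).
exact/esym/eq_complexRe.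
Qed.

Lemma kpartial_foldr f V i al x : open V -> ksmooth V f -> V x ->
  kpartial i (foldr (@kpartial R k n) f al) x = foldr (@kpartial R k n) (kpartial i f)
    al x.
Proof.
move=> Vo fs; elim: al x => [//|j al IH] x Vx /=.
rewrite (kpartial_comm _ _ Vo (ksmooth_foldr al fs) Vx).
by apply: kpartial_near; apply: filterS (open_nbhs_nbhs (conj Vo Vx)) => y /IH.
Qed.

(** The mean value theorem on real segments. *)
Lemma has_gradient0_const f x (r : K) : 0 < r ->
  (forall y, ball x r y -> has_gradient f y (fun=> 0)) -> forall y,
    ball x r y -> f y = f x.
Proof.
move=> r0 f0 y xy.
have gr_le t : 0 <= t <= 1 -> ball x r (x + gr t *: (y - x)).
  move=> /andP[t0 t1]; move: xy; rewrite -!ball_normE /ball_ /=.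
  rewrite opprD addrA subrr sub0r normrN normrZ; apply: le_lt_trans.
  rewrite distrC; apply: ler_piMl => //.
  by rewrite -ground_incl_le -ground_incl_norm ground_realE normc_def/= expr0n addr0
    sqrtr_sqr ger0_norm// rmorph1 lecR.
have key (c : C) : complex.Re (c * f y) = complex.Re (c * f x).
  have [|s [_]] := @MVT0 R (fun t => complex.Re (c * f (x + gr t *: (y - x))))
    (fun=> 0) 1 ltr01.
    move=> t /gr_le/f0 /(has_gradient_line c); rewrite big1 ?mulr0//=.
    by move=> i _; rewrite mul0r.
  have -> : gr 1 = 1 by apply: ground_incl_inj; rewrite ground_realE !rmorph1.
  rewrite ground_real0 scale1r scale0r addr0 [x + (y - x)]addrC subrK mulr0 => /eqP.
  by rewrite subr_eq0 => /eqP.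
exact: eq_complexRe.
Qed.

End Gradient.

(** * Charts and smooth maps *)

Lemma open_near (T : topologicalType) (S : set T) :
  (forall x, S x -> \forall y \near x, S y) -> open S.
Proof. by move=> h; rewrite openE => x /h; rewrite /interior. Qed.

Lemma near_open (T : topologicalType) (S : set T) x : open S -> S x ->
  \forall y \near x, S y.
Proof. by move=> So Sx; apply: open_nbhs_nbhs. Qed.

Section Manifolds.
Variables (R : realType) (k : geometry).
Local Notation C := (complex R : numFieldType).
Local Notation K := (ground R k).
Local Notation gi := (@ground_incl R k).

Lemma ksmooth_continuous n (f : 'rV[K]_n -> C) V x :
  ksmooth V f -> V x -> {for x, continuous f}.
Proof. by move=> fs Vx; exact: has_gradient_continuous (ksmooth_kdiff fs Vx). Qed.

Lemma open_neq0 n (f : 'rV[K]_n -> C) V : open V -> ksmooth V f ->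
  open (V `&` [set x | f x != 0]).
Proof.
move=> Vo fs; apply: open_near => x [Vx fx].
apply: filterI; first exact: (near_open Vo Vx).
exact: near_neq0 (ksmooth_continuous fs Vx) fx.
Qed.

Section Charts.
Variables (M : topologicalType) (n : nat).
Implicit Types (c d : chart R k M n).

Lemma open_chart_preim c (W : set M) : open W ->
  open (ch_cod c `&` ch_inv c @^-1` W).
Proof.
move=> Wo; apply: open_near => x [cx Wx].
exact: (filterI (near_open (@ch_cod_open _ _ _ _ c) cx) (ch_inv_cont cx (near_open Wo
  Wx))).
Qed.

End Charts.

Section OneManifold.
Variable M : manifold R k.
Implicit Types (c d : chart R k M (man_dim M)) (W : set M) (a : M -> complex R).

Lemma atlas_compatible c : man_atlas c -> compatible c.
Proof. by move=> cA d dA; split; exact: man_compat. Qed.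

Lemma compatible_coord c i : compatible c ->
  smooth_fun (ch_dom c) (fun m => gi (ch_fun c m 0 i)).
Proof. by move=> cM d dA; have [_] := cM d dA; exact. Qed.

(** Smoothness is defined by the charts of the atlas; a chart of the maximal atlas
    differs from them by a smooth change of coordinates. *)
Lemma smooth_compatible c W a : compatible c -> open W -> smooth_fun W a ->
  ksmooth (ch_cod c `&` ch_inv c @^-1` W) (a \o ch_inv c).
Proof.
move=> cM Wo aW; apply: ksmooth_local => x [cx Wx].
have [d dA dx] := man_cover (ch_inv c x).
have [cd _] := cM d dA.
have Wdo : open (W `&` ch_dom d) by apply: openI => //; exact: ch_dom_open.
exists (ch_cod c `&` ch_inv c @^-1` (W `&` ch_dom d)); first by [].
apply: (@ksmooth_eq _ _ _ ((a \o ch_inv d) \o (fun x => ch_fun d (ch_inv c x)))).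
- exact: open_chart_preim.
- by move=> y [_ [_ dy]] /=; rewrite ch_funK.
- apply: (ksmooth_comp (W := ch_cod d `&` ch_inv d @^-1` W)).
  + exact: open_chart_preim.
  + exact: open_chart_preim.
  + by move=> y [cy [Wy dy]]; split; [exact: ch_fun_in|rewrite /= ch_funK].
  + exact: aW.
  + move=> j; apply: ksmooth_sub (cd j) => y [cy [_ dy]]; by split.
Qed.

Lemma smooth_fun_res V W a : V `<=` W -> smooth_fun W a -> smooth_fun V a.
Proof.
move=> VW aW c cA; apply: ksmooth_sub (aW c cA) => x [cx Vx]; split=> //.
exact: VW.
Qed.

Lemma smooth_fun_local W a :
  (forall m, W m -> exists2 V : set M, V m & smooth_fun V a) -> smooth_fun W a.
Proof.
move=> h c cA; apply: ksmooth_local => x [cx Wx]; have [V Vx aV] := h _ Wx.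
by exists (ch_cod c `&` ch_inv c @^-1` V); [|exact: aV].
Qed.

Lemma smooth_fun_eq W a b : open W -> (forall m, W m -> a m = b m) ->
  smooth_fun W a -> smooth_fun W b.
Proof.
move=> Wo ab aW c cA; apply: ksmooth_eq (aW c cA); first exact: open_chart_preim.
by move=> x [_ Wx]; exact: ab.
Qed.

Lemma smooth_funM W a b : open W -> smooth_fun W a -> smooth_fun W b ->
  smooth_fun W (fun m => a m * b m).
Proof. by move=> Wo aW bW c cA; apply: ksmoothM; [exact: open_chart_preim|exact:
  aW|exact: bW]. Qed.

End OneManifold.

Section Maps.
Variables X Y Z : manifold R k.

Lemma smooth_map_id : @smooth_map R k X X id.
Proof. by split; [move=> x; exact: cvg_id|]. Qed.

Lemma smooth_map_comp (f : X -> Y) (h : Y -> Z) :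
  smooth_map f -> smooth_map h -> smooth_map (h \o f).
Proof.
move=> [fc fs] [hc hs]; split=> [x|V a Vo aV].
  by apply: continuous_comp; [exact: fc|exact: hc].
apply: (fs (h @^-1` V) (a \o h)); last exact: hs.
by apply: open_comp => // y _; exact: hc.
Qed.

Lemma smooth_map_coord (f : X -> Y) c d i : smooth_map f -> compatible c ->
  compatible d ->
  ksmooth (ch_cod c `&` ch_inv c @^-1` (f @^-1` ch_dom d))
    (fun x => gi (ch_fun d (f (ch_inv c x)) 0 i)).
Proof.
move=> [fc fs] cX dY.
have ddo := @ch_dom_open _ _ _ _ d.
have fo : open (f @^-1` ch_dom d) by apply: open_comp ddo => y _; exact: fc.
exact: (@smooth_compatible X c _ (fun x => gi (ch_fun d (f x) 0 i)) cX fo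
  (fs _ _ ddo (compatible_coord i dY))).
Qed.

Lemma lsubmx_continuous n m (u : 'rV[K]_(n + m)) :
  {for u, continuous (@lsubmx K 1 n m)}.
Proof.
apply: row_continuous => j; have -> : (fun v => @lsubmx K 1 n m v 0 j) = (fun v =>
  v 0 (lshift m j)).
  by apply/funext => v; rewrite mxE.
exact: coord_continuous.
Qed.

Lemma rsubmx_continuous n m (u : 'rV[K]_(n + m)) :
  {for u, continuous (@rsubmx K 1 n m)}.
Proof.
apply: row_continuous => j; have -> : (fun v => @rsubmx K 1 n m v 0 j) = (fun v =>
  v 0 (rshift n j)).
  by apply/funext => v; rewrite mxE.
exact: coord_continuous.
Qed.

End Maps.

Section Products.
Variables X' X Y Z : manifold R k.
Variables (F : X * Y -> Z) (f : X' -> X).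
Hypotheses (Fs : smooth_map2 F) (fs : smooth_map f).

Definition product_dom c d (V : set Z) :
    set 'rV[K]_(man_dim X' + man_dim Y) :=
  [set u | [/\ @ch_cod _ _ X' _ c (lsubmx u), @ch_cod _ _ Y _ d (rsubmx u) &
     V (F (f (ch_inv c (lsubmx u)), ch_inv d (rsubmx u)))]].

Lemma product_map_continuous c d (u : 'rV[K]_(man_dim X' + man_dim Y)) :
  @ch_cod _ _ X' _ c (lsubmx u) -> @ch_cod _ _ Y _ d (rsubmx u) ->
  {for u, continuous (fun u => (f (ch_inv c (lsubmx u)), ch_inv d (rsubmx u)))}.
Proof.
move=> cu du.
have h1 : {for u, continuous (f \o (ch_inv c \o @lsubmx K 1 (man_dim X') (man_dim Y)))}.
  apply: continuous_comp; last exact: fs.1.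
  by apply: continuous_comp; [exact: lsubmx_continuous|exact: ch_inv_cont].
have h2 : {for u, continuous (ch_inv d \o @rsubmx K 1 (man_dim X') (man_dim Y))}.
  by apply: continuous_comp; [exact: rsubmx_continuous|exact: ch_inv_cont].
exact: (cvg_pair h1 h2).
Qed.

Lemma product_dom_open c d V : open V -> open (product_dom c d V).
Proof.
move=> Vo; apply: open_near => u [cu du Vu].
have h1 := lsubmx_continuous (near_open (@ch_cod_open _ _ _ _ c) cu).
have h2 := rsubmx_continuous (near_open (@ch_cod_open _ _ _ _ d) du).
have Fc : {for u, continuous (F \o (fun u => (f (ch_inv c (lsubmx u)),
  ch_inv d (rsubmx u))))}.
  by apply: continuous_comp; [exact: product_map_continuous|exact: Fs.1].
have h3 := Fc _ (near_open Vo Vu).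
by near=> v; split; near: v.
Unshelve. all: by end_near. Qed.

End Products.

(** The map f is the inversion of G in the application to (p, m) |-> p^-1 m. *)
Lemma product_smooth (X' X Y Z : manifold R k) (F : X * Y -> Z) (f : X' -> X)
    (c : chart R k X' (man_dim X')) (d : chart R k Y (man_dim Y)) V (a : Z -> C) :
  smooth_map2 F -> smooth_map f -> compatible c -> compatible d -> open V -> smooth_fun
    V a ->
  ksmooth (product_dom F f c d V)
    (fun u => a (F (f (ch_inv c (lsubmx u)), ch_inv d (rsubmx u)))).
Proof.
move=> Fs fs cX dY Vo aV; apply: ksmooth_local => u [cu du Vu].
have [c1 c1A c1u] := man_cover (f (ch_inv c (lsubmx u))).
have [d1 d1A d1u] := man_cover (ch_inv d (rsubmx u)).
pose phi (u : 'rV[K]_(man_dim X' + man_dim Y)) : 'rV[K]_(man_dim X + man_dim Y) :=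
  row_mx (ch_fun c1 (f (ch_inv c (lsubmx u)))) (ch_fun d1 (ch_inv d (rsubmx u))).
pose W := product_dom F f c d V `&`
  [set u | (ch_dom c1 `*` ch_dom d1) (f (ch_inv c (lsubmx u)), ch_inv d (rsubmx u))].
have Wo : open W.
  apply: open_near => v [[cv dv Vv] Dv].
  have h1 := near_open (@product_dom_open _ _ _ _ _ _ Fs fs c d V Vo) (And3 cv dv Vv).
  have o1 : \forall z \near (f (ch_inv c (lsubmx v)), ch_inv d (rsubmx v)),
    (ch_dom c1 `*` ch_dom d1) z.
    by exists (ch_dom c1, ch_dom d1) => //; split; apply: near_open;
      [exact: ch_dom_open|exact: Dv.1|exact: ch_dom_open|exact: Dv.2].
  have h2 := product_map_continuous fs cv dv o1.
  exact: (filterI h1 h2).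
exists W; first by [].
pose H (v : 'rV[K]_(man_dim X + man_dim Y)) := a (F (ch_inv c1 (lsubmx v),
  ch_inv d1 (rsubmx v))).
apply: (@ksmooth_eq _ _ _ (H \o phi)) => //.
  by move=> v [_ [/= h1 h2]]; rewrite /H /phi row_mxKl row_mxKr !ch_funK.
have So := @product_dom_open _ _ _ _ F id Fs (smooth_map_id X) c1 d1 V Vo.
apply: (ksmooth_comp Wo So).
- by move=> v [[h1 h2 h3] [/= h4 h5]]; split; rewrite /phi ?row_mxKl ?row_mxKr
    ?ch_funK//; exact: ch_fun_in.
- exact: Fs.2 V a Vo aV c1 d1 c1A d1A.
- move=> j; case: (split_ordP j) => l ->.
    apply: (@ksmooth_eq _ _ _ ((fun x => gi (ch_fun c1 (f (ch_inv c x)) 0 l))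
      \o @lsubmx K 1 _ _)) => //.
      by move=> v _ /=; rewrite /phi row_mxEl.
    apply: (ksmooth_comp Wo _ _ (smooth_map_coord l fs cX (atlas_compatible c1A))).
    + by apply: open_chart_preim; apply: open_comp => [x _|];
        [exact: fs.1|exact: ch_dom_open].
    + by move=> v [[h1 _ _] [/= h4 _]]; split.
    + move=> i; apply: (@ksmooth_eq _ _ _ (fun v => gi (v 0 (lshift _ i)))) => //.
        by move=> v _; rewrite mxE.
      exact: ksmooth_coord.
  apply: (@ksmooth_eq _ _ _ ((fun x => gi (ch_fun d1 (id (ch_inv d x)) 0 l))
    \o @rsubmx K 1 _ _)) => //.
    by move=> v _ /=; rewrite /phi row_mxEr.
  apply: (ksmooth_comp Wo _ _ (smooth_map_coord l (smooth_map_id Y)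
    dY (atlas_compatible d1A))).
  + by apply: open_chart_preim; exact: ch_dom_open.
  + by move=> v [[_ h1 _] [/= _ h4]]; split.
  + move=> i; apply: (@ksmooth_eq _ _ _ (fun v => gi (v 0 (rshift _ i)))) => //.
      by move=> v _; rewrite mxE.
    exact: ksmooth_coord.
Qed.

Lemma smooth_map_slice (X Y Z : manifold R k) (F : X * Y -> Z) y :
  smooth_map2 F -> smooth_map (fun x => F (x, y)).
Proof.
move=> Fs; split=> [x|V a Vo aV c cA].
  apply: (@continuous_comp _ _ _ (fun x => (x, y)) F); last exact: Fs.1.
  by apply: cvg_pair; [exact: cvg_id|exact: cvg_cst].
have [d dA dy] := man_cover y.
have Fxc : continuous (fun x => F (x, y)).
  move=> x; apply: (@continuous_comp _ _ _ (fun x => (x, y)) F); last exact: Fs.1.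
  by apply: cvg_pair; [exact: cvg_id|exact: cvg_cst].
have Wo : open (ch_cod c `&` ch_inv c @^-1` ((fun x => F (x, y)) @^-1` V)).
  by apply: open_chart_preim; apply: open_comp Vo => x _; exact: Fxc.
pose H (v : 'rV[K]_(man_dim X + man_dim Y)) := a (F (ch_inv c (lsubmx v),
  ch_inv d (rsubmx v))).
apply: (@ksmooth_eq _ _ _ (H \o (fun x => row_mx x (ch_fun d y)))) => //.
  by move=> x _; rewrite /H /= row_mxKl row_mxKr ch_funK.
apply: (ksmooth_comp Wo (product_dom_open Fs (smooth_map_id X) Vo)
  (W := product_dom F id c d V)).
- move=> x [cx Vx]; split; rewrite ?row_mxKl ?row_mxKr ?ch_funK//; exact: ch_fun_in.
- exact: Fs.2 V a Vo aV c d cA dA.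
- move=> j; case: (split_ordP j) => l ->.
    apply: (@ksmooth_eq _ _ _ (fun x => gi (x 0 l))) => //; last exact: ksmooth_coord.
    by move=> x _; rewrite row_mxEl.
  apply: (@ksmooth_eq _ _ _ (fun x => gi (ch_fun d y 0 l))) =>
    //; last exact: ksmooth_cst.
  by move=> x _; rewrite row_mxEr.
Qed.

End Manifolds.

(** * Sections of the structure sheaf are smooth *)

Section Sheaf.
Variables (R : realType) (k : geometry).
Local Notation C := (complex R : numFieldType).
Local Notation K := (ground R k).

Lemma ksmooth_prod n N (z : 'I_N -> 'rV[K]_n -> C) V : open V ->
  (forall j, ksmooth V (z j)) -> ksmooth V (fun x => \prod_j z j x).
Proof.
move=> Vo zs; rewrite [fun _ => _](_ : _ = fun x => \prod_(j <- index_enum 'I_N) z j x)//.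
elim: (index_enum _) => [|i r IH].
  under eq_fun do rewrite big_nil.
  exact: ksmooth_cst.
under eq_fun do rewrite big_cons.
exact: ksmoothM.
Qed.

Lemma ksmooth_exp n (z : 'rV[K]_n -> C) i V : open V ->
  ksmooth V z -> ksmooth V (fun x => z x ^+ i).
Proof.
move=> Vo zs; elim: i => [|i IH]; first exact: ksmooth_cst.
under eq_fun do rewrite exprS.
exact: ksmoothM.
Qed.

Lemma ksmooth_peval n N (p : mpoly.mpoly N C) (z : 'rV[K]_n -> 'rV[C]_N) V : open V ->
  (forall j, ksmooth V (fun x => z x 0 j)) -> ksmooth V (fun x => peval p (z x)).
Proof.
move=> Vo zs.
have -> : (fun x => peval p (z x)) = fun x => \sum_(m <- mpoly.msupp p)
    mpoly.mcoeff m p * \prod_i z x 0 i ^+ (mpoly.fun_of_multinom m i).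
  by apply/funext => x; rewrite /peval mpoly.mevalE.
apply: ksmooth_sum => // m; apply: ksmoothM => //; first exact: ksmooth_cst.
by apply: ksmooth_prod => // i; apply: ksmooth_exp.
Qed.
End Sheaf.

Lemma sheaf_open (R : realType) (k : geometry) (M : manifold R k) (A : fun_sheaf R M) W :
  functions_on A -> fs_open A W -> open W.
Proof. by case: k M A W => M A W /= [h _] /h. Qed.

(** In the algebraic case, the section is near each point a quotient of polynomials in
    the functions z j, which are smooth on an affine patch. *)
Lemma sheaf_smooth (R : realType) (k : geometry) (M : manifold R k) (A : fun_sheaf R M)
  W a :
  functions_on A -> fs_open A W -> fs_reg A W a -> smooth_fun W a.
Proof.
case: k M A W a => M A W a.
- by move=> [h1 h2] /h1 Wo; apply: (h2 _ _ Wo).1.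
- by move=> [h1 h2] /h1 Wo; apply: (h2 _ _ Wo).1.
move=> MA Wo aW; have [h [n [V [Vaff Vcover]]]] := MA.
apply: smooth_fun_local => m Wm.
have [i _ Vm] : (\bigcup_i V i) m by rewrite Vcover.
have [N [z [I [[Vfo Vio] _ _ Vreg [zs _ _]]]]] := Vaff i.
have W1o : fs_open A (W `&` V i) by exact: fs_openI.
have W1V : W `&` V i `<=` V i by exact: subIsetr.
have aW1 : fs_reg A (W `&` V i) a by apply: fs_res aW => //; exact: subIsetl.
have [p [q [qm aE]]] := (Vreg _ a W1V W1o).1 aW1 m (conj Wm Vm).
exists ((W `&` V i) `&` [set m' | peval q (z m') != 0]); first by [].
move=> c cA.
pose O := ch_cod c `&` ch_inv c @^-1` (W `&` V i).
have Oo : open O by apply: open_chart_preim; exact: h.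
have zO j : ksmooth O (fun x => z (ch_inv c x) 0 j).
  by apply: ksmooth_sub (zs j c cA) => x [cx [_ Vx]].
have qO := ksmooth_peval q Oo zO; have pO := ksmooth_peval p Oo zO.
have -> : ch_cod c `&` ch_inv c @^-1` ((W `&` V i) `&` [set m' | peval q (z m') != 0]) =
   O `&` [set x | peval q (z (ch_inv c x)) != 0].
  exact: (setIA (ch_cod c) (ch_inv c @^-1` (W `&` V i))).
have Oq := open_neq0 Oo qO.
apply: (@ksmooth_eq _ _ _ (fun x => peval p (z (ch_inv c x))
  * (peval q (z (ch_inv c x)))^-1)) => //.
  by move=> x [[cx Wx] qx] /=; rewrite aE.
apply: ksmoothM => //; first by apply: ksmooth_sub pO => x [].
by apply: ksmoothV => //; [move=> x []|apply: ksmooth_sub qO => x []].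
Qed.

(** * Sections and operations on them *)

Section SectionAlgebra.
Variables (R : realType) (M : Type) (A : fun_sheaf R M).
Implicit Types V W : opens A.

Lemma mksecE W (a : M -> R[i]) (ra : fs_reg A W a) m : oset W m -> mksec ra m = a m.
Proof. by move=> Wm; rewrite /= /restr asboolT. Qed.

Lemma sec_eqP W (a b : sec W) : (forall m, oset W m -> a m = b m) -> a = b.
Proof.
move=> ab; apply: val_inj => /=; apply/funext => m.
have [/ab//|Wm] := pselect (oset W m); by rewrite !sec_off.
Qed.

Lemma secDE W (a b : sec W) m : (a + b) m = a m + b m. Proof. by []. Qed.
Lemma secZE W z (a : sec W) m : (z *: a) m = z * a m. Proof. by []. Qed.
Lemma secNE W (a : sec W) m : (- a) m = - a m. Proof. by []. Qed.
Lemma sec0E W m : (0 : sec W) m = 0. Proof. by []. Qed.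

Lemma sec_mulE W (a b : sec W) m : sec_mul a b m = a m * b m.
Proof.
have [Wm|Wm] := pselect (oset W m); first by rewrite mksecE.
by rewrite !sec_off// mul0r.
Qed.

Lemma sec_resE V W (VW : V `<=` W) (a : sec W) m : oset V m -> sec_res VW a m = a m.
Proof. exact: mksecE. Qed.

Definition opensI V W : opens A := Opens (fs_openI (oset_open V) (oset_open W)).

Lemma opensIl V W : opensI V W `<=` V. Proof. by move=> m []. Qed.
Lemma opensIr V W : opensI V W `<=` W. Proof. by move=> m []. Qed.

(** Both values can be computed on the intersection of V and W. *)
Lemma op2_local (B : sheaf_op2 A) V W (a b : sec V) (a' b' : sec W) m :
  sheaf_bilin B -> oset V m -> oset W m ->
  (forall n, oset V n -> oset W n -> a n = a' n) ->
  (forall n, oset V n -> oset W n -> b n = b' n) -> B V a b m = B W a' b' m.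
Proof.
move=> [_ Bres] Vm Wm aa bb.
have Im : oset (opensI V W) m by [].
rewrite -(sec_resE (@opensIl V W) _ Im) -(sec_resE (@opensIr V W) _ Im) !Bres.
have -> : sec_res (@opensIl V W) a = sec_res (@opensIr V W) a'.
  by apply: sec_eqP => n In; rewrite !sec_resE//; case: In; exact: aa.
have -> // : sec_res (@opensIl V W) b = sec_res (@opensIr V W) b'.
by apply: sec_eqP => n In; rewrite !sec_resE//; case: In; exact: bb.
Qed.

End SectionAlgebra.

(** * Tangent vectors are derivations *)

Section Tangent.
Variables (R : realType) (k : geometry) (M : manifold R k) (m : M).
Variable (v : (M -> R[i]) -> R[i]).
Hypothesis vT : tangent m v.
Implicit Types a b : M -> R[i].

Lemma smooth_near_kdiff c a : man_atlas c -> ch_dom c m -> smooth_near m a ->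
  kdiff (a \o ch_inv c) (ch_fun c m).
Proof.
move=> cA cm [V [Vo Vm aV]]; apply: ksmooth_kdiff (aV c cA) _.
by split; [exact: ch_fun_in|rewrite /= ch_funK].
Qed.

Lemma near_chart c (P : M -> Prop) : ch_dom c m -> (\forall n \near m, P n) ->
  \forall u \near ch_fun c m, P (@ch_inv R k M (man_dim M) c u).
Proof.
move=> cm; have ic := ch_inv_cont (ch_fun_in cm).
by move: ic; rewrite /prop_for /continuous_at ch_funK// => ic /ic.
Qed.

Lemma smooth_near_eq a b : (\forall n \near m, a n = b n) ->
  smooth_near m a -> smooth_near m b.
Proof.
move=> ab; have := ab; rewrite -[X in X -> _]/(nbhs m [set n | a n = b n]) nbhsE =>
  -[S [So Sm] Sab] [V [Vo Vm aV]].
exists (V `&` S); split=> //; first exact: openI.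
apply: (@smooth_fun_eq _ _ _ _ a) => //; first exact: openI.
  by move=> n [_ /Sab].
by apply: smooth_fun_res aV => n [].
Qed.

Lemma tangent_near a b : smooth_near m a -> (\forall n \near m, a n = b n) ->
  v a = v b.
Proof.
move=> as_ ab; have bs := smooth_near_eq ab as_.
have [c [w [cA cm vE]]] := vT; rewrite !vE//; apply: eq_bigr => i _.
by congr (_ * _); apply: kpartial_near; exact: (@near_chart c (fun n => a n = b n) cm ab).
Qed.

Lemma tangentM a b : smooth_near m a -> smooth_near m b ->
  v (fun n => a n * b n) = v a * b m + a m * v b.
Proof.
move=> as_ bs; have [V [Vo Vm aV]] := as_; have [W [Wo Wm bW]] := bs.
have abs : smooth_near m (fun n => a n * b n).
  exists (V `&` W); split=> //; first exact: openI.
  apply: smooth_funM; first exact: openI.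
    by apply: smooth_fun_res aV => n [].
  by apply: smooth_fun_res bW => n [].
have [c [w [cA cm vE]]] := vT; rewrite !vE// mulr_suml mulr_sumr -big_split.
apply: eq_bigr => i _.
have fd := smooth_near_kdiff cA cm as_; have gd := smooth_near_kdiff cA cm bs.
rewrite (_ : kpartial i _ _ = kpartial i (a \o ch_inv c) (ch_fun c m) * b m
   + a m * kpartial i (b \o ch_inv c) (ch_fun c m));
       first by rewrite mulrDr mulrA (mulrCA (a m)).
have := has_gradient_partial (has_gradientM fd gd) i.
by rewrite /= ch_funK.
Qed.

End Tangent.

(** * The actions of the group and of its Lie algebra *)

Section Action.
Variables (R : realType) (k : geometry) (G : lie_group R k) (M : G_manifold G).
Local Notation A := (gm_fun M).
Local Notation e := (lg_one G).

Lemma lg_mulrV (p : G) : lg_mul p (lg_inv p) = e.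
Proof.
rewrite -[LHS]lg_mul1 -{1}(lg_mulV (lg_inv p)) -lg_mulA.
by rewrite [lg_mul (lg_inv p) _]lg_mulA lg_mulV lg_mul1 lg_mulV.
Qed.

Lemma gm_actK (p : G) (m : M) : gm_act (lg_inv p) (gm_act p m) = m.
Proof. by rewrite -gm_actM lg_mulV gm_act1. Qed.

Lemma gm_actVK (p : G) (m : M) : gm_act p (gm_act (lg_inv p) m) = m.
Proof. by rewrite -gm_actM lg_mulrV gm_act1. Qed.

Lemma gm_actV1 (m : M) : gm_act (lg_inv e) m = m.
Proof. by rewrite -{1}[m]gm_act1 gm_actK. Qed.

Lemma lg_mul_cancel (p q : G) : lg_mul (lg_mul p (lg_inv q)) q = p.
Proof.
have r1 (x : G) : lg_mul x e = x by rewrite -(lg_mulV x) lg_mulA lg_mulrV lg_mul1.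
by rewrite -lg_mulA lg_mulV r1.
Qed.

Lemma opens_open (W : opens A) : open (oset W).
Proof. exact: sheaf_open (gm_funP M) (oset_open W). Qed.

Lemma section_smooth (W : opens A) (a : sec W) : smooth_fun (oset W) a.
Proof. exact: sheaf_smooth (gm_funP M) (oset_open W) (sec_reg a). Qed.

Lemma act_smooth (m : M) : smooth_map (fun p : G => gm_act p m).
Proof. exact: (smooth_map_slice m (gm_act_smooth M)). Qed.

Lemma inv_act_smooth (m : M) :
  smooth_map (fun p : G => gm_act (lg_inv p) m).
Proof. exact: (smooth_map_comp (lg_inv_smooth G) (act_smooth m)). Qed.

Lemma inv_act_near (W : opens A) m : oset W m ->
  \forall p \near e, oset W (gm_act (lg_inv p) m).
Proof.
move=> Wm; apply: (inv_act_smooth m).1; rewrite gm_actV1.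
exact: near_open (opens_open W) Wm.
Qed.

Lemma smooth_near_trans (W : opens A) (a : sec W) m : oset W m ->
  smooth_near e (fun p => a (gm_act (lg_inv p) m)).
Proof.
move=> Wm; exists ((fun p : G => gm_act (lg_inv p) m) @^-1` W); split.
- by apply: open_comp (opens_open W) => p _; exact: (inv_act_smooth m).1.
- by rewrite /= gm_actV1.
- exact: (inv_act_smooth m).2 (opens_open W) (section_smooth a).
Qed.

Variables (g : lie_algebra R[i]) (tau : g -> (G -> R[i]) -> R[i]).
Hypothesis g_lie_G : is_lie_algebra_of tau.
Variables (U : enveloping g) (act : U_action M tau U).
Local Notation lact x a := (uact act (env_inj U x) a).

Lemma uact_derivation (x : g) (W : opens A) (a b : sec W) :
  lact x (sec_mul a b) = sec_mul (lact x a) b + sec_mul a (lact x b).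
Proof.
apply: sec_eqP => m Wm; rewrite secDE !sec_mulE !uact_inj//.
have := tangentM (lao_tangent g_lie_G x) (smooth_near_trans a Wm)
  (smooth_near_trans b Wm).
rewrite gm_actV1 => <-; congr (tau x _); apply/funext => p.
exact: sec_mulE.
Qed.

Lemma uact_local (x : g) (V W : opens A) (a : sec V) (b : sec W) m :
  oset V m -> oset W m -> (forall n, oset V n -> oset W n -> a n = b n) ->
  lact x a m = lact x b m.
Proof.
move=> Vm Wm ab; rewrite !uact_inj//.
apply: (tangent_near (lao_tangent g_lie_G x)); first exact: smooth_near_trans.
have h1 := inv_act_near Vm; have h2 := inv_act_near Wm.
by near=> p; apply: ab; near: p.
Unshelve. all: by end_near. Qed.

End Action.

(** * Bidifferential operators in charts *)

Section RestrictedChart.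
Variables (R : realType) (k : geometry) (M : topologicalType) (n : nat).
Variables (c : chart R k M n) (O : set M) (Oo : open O).

Definition res_chart : chart R k M n.
Proof.
refine (@Chart R k M n (ch_dom c `&` O) (ch_cod c `&` ch_inv c @^-1` O)
  (ch_fun c) (ch_inv c) _ _ _ _ _ _ _ _).
- by apply: openI => //; exact: ch_dom_open.
- exact: open_chart_preim.
- by move=> m [cm Om]; split; [exact: ch_fun_in|rewrite /= ch_funK].
- by move=> x [cx Ox]; split => //; exact: ch_inv_in.
- by move=> m [cm _]; exact: ch_funK.
- by move=> x [cx _]; exact: ch_invK.
- by move=> m [cm _]; exact: ch_fun_cont.
- by move=> x [cx _]; exact: ch_inv_cont.
Defined.

End RestrictedChart.

Lemma res_chart_compatible (R : realType) (k : geometry) (M : manifold R k)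
    (c : chart R k M (man_dim M)) (O : set M) (Oo : open O) :
  compatible c -> compatible (res_chart c Oo).
Proof.
move=> cM d dA; have [cd dc] := cM d dA; split=> i.
  by apply: ksmooth_sub (cd i) => x [[cx _] dx].
by apply: ksmooth_sub (dc i) => x [dx [cx _]].
Qed.

Section Bidifferential.
Variables (R : realType) (k : geometry) (M : manifold R k) (A : fun_sheaf R M).

Definition bidiff_sum (V : opens A) (L : seq (sec V * bidiff_term M))
    (c : chart R k M (man_dim M)) (a b : M -> R[i]) m :=
  \sum_(t <- L) t.1 m *
    foldr (@kpartial R k _) (a \o ch_inv c) t.2.1 (ch_fun c m) *
    foldr (@kpartial R k _) (b \o ch_inv c) t.2.2 (ch_fun c m).

(** The local condition in [bidifferential], with the domain and the coordinates fixed,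
    so that operators can be added. *)
Definition bidiff_on (V : opens A) (x : M -> 'rV[ground R k]_(man_dim M))
    (L : seq (sec V * bidiff_term M)) (B : sheaf_op2 A) :=
  forall (W : opens A), W `<=` V -> forall c, coord_chart W x c ->
  forall (a b : sec W) m', ch_dom c m' -> B W a b m' = bidiff_sum L c a b m'.

Lemma bidiff_onP (B : sheaf_op2 A) : bidifferential B <->
  sheaf_bilin B /\ forall m, exists (V : opens A) (x : M -> 'rV[ground R k]_(man_dim
    M)) (L : seq (sec V * bidiff_term M)),
    [/\ oset V m, coordinates V x & bidiff_on x L B].
Proof.
split=> -[Bb h]; split=> // m; have [V [x [L [Vm Vx hL]]]] := h m; exists V, x, L;
  split=> //.
  move=> W WV c cc a b m' cm'; rewrite (hL W WV c cc a b m' cm') /bidiff_sum.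
  by have [_ _ ->] := cc.
move=> W WV c cc a b m' cm'; rewrite (hL W WV c cc a b m' cm') /bidiff_sum.
by have [_ _ ->] := cc.
Qed.

Lemma foldr_kpartial_chart (c : chart R k M (man_dim M)) (a b : M -> R[i]) al m :
  ch_dom c m -> (forall n, ch_dom c n -> a n = b n) ->
  foldr (@kpartial R k _) (a \o ch_inv c) al (ch_fun c m) =
  foldr (@kpartial R k _) (b \o ch_inv c) al (ch_fun c m).
Proof.
move=> cm ab; apply: (foldr_kpartial_eq _ (@ch_cod_open _ _ _ _ c));
  last exact: ch_fun_in.
by move=> y cy /=; apply: ab; exact: ch_inv_in.
Qed.

(** W need not lie in V: the formula is applied on their intersection. *)
Lemma bidiff_value (V : opens A) x L (B : sheaf_op2 A) (W : opens A) c (a b : sec W) m :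
  sheaf_bilin B -> @bidiff_on V x L B -> coord_chart V x c -> ch_dom c `<=` W ->
  ch_dom c m -> B W a b m = bidiff_sum L c a b m.
Proof.
move=> Bb BL [cM cV cx] cW cm.
have Im : oset (opensI V W) m by split; [exact: cV|exact: cW].
have cI : coord_chart (opensI V W) x c by split=> // n cn; split; [exact: cV|exact: cW].
rewrite (@op2_local _ _ _ B W (opensI V W) a b (sec_res (@opensIr _ _ _ V W) a)
  (sec_res (@opensIr _ _ _ V W) b)) //; last 3 first.
- exact: cW.
- by move=> n _ In; rewrite sec_resE.
- by move=> n _ In; rewrite sec_resE.
rewrite (BL _ (@opensIl _ _ _ V W) _ cI)//; apply: eq_bigr => t _.
by congr (_ * _ * _); apply: foldr_kpartial_chart => // n cn; rewrite sec_resE//;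
  exact: (conj (cV _ cn) (cW _ cn)).
Qed.

Lemma bidiff_onD (V : opens A) x (L L' : seq (sec V * bidiff_term M))
  (B B' : sheaf_op2 A) :
  bidiff_on x L B -> bidiff_on x L' B' ->
  bidiff_on x (L ++ L') (fun W a b => B W a b + B' W a b).
Proof.
move=> BL BL' W WV c cc a b m cm.
by rewrite secDE (BL W WV c cc)// (BL' W WV c cc)// /bidiff_sum big_cat.
Qed.

Lemma bidiff_on_swap (V : opens A) x (L : seq (sec V * bidiff_term M)) (B : sheaf_op2 A) :
  bidiff_on x L B ->
  bidiff_on x [seq (- t.1, (t.2.2, t.2.1)) | t <- L] (fun W a b => - B W b a).
Proof.
move=> BL W WV c cc a b m cm.
rewrite secNE (BL W WV c cc)// /bidiff_sum big_map -sumrN; apply: eq_bigr => t _.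
by rewrite secNE /= !mulNr mulrAC.
Qed.

Lemma bidiff_on_sum (V : opens A) x I (r : seq I) (B : I -> sheaf_op2 A) :
  (forall i, exists L, @bidiff_on V x L (B i)) ->
  exists L, @bidiff_on V x L (fun W a b => \sum_(i <- r) B i W a b).
Proof.
move=> h; elim: r => [|i r [L IH]].
  exists [::] => W WV c cc a b m cm; by rewrite big_nil /bidiff_sum big_nil.
have [L' BL'] := h i; exists (L' ++ L) => W WV c cc a b m cm.
by rewrite big_cons; exact: (bidiff_onD BL' IH WV cc).
Qed.

End Bidifferential.

(** * The Lie algebra acts by vector fields *)

Section ActionCoordinates.
Variables (R : realType) (k : geometry) (G : lie_group R k) (M : G_manifold G).
Local Notation A := (gm_fun M).
Local Notation K := (ground R k).
Local Notation gi := (@ground_incl R k).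
Local Notation e := (lg_one G).
Variables (g : lie_algebra R[i]) (tau : g -> (G -> R[i]) -> R[i]).
Hypothesis g_lie_G : is_lie_algebra_of tau.
Variables (U : enveloping g) (act : U_action M tau U).
Local Notation lact x a := (uact act (env_inj U x) a).

(** The chain rule: elements of g act by vector fields. *)
Lemma uact_coord x (W : opens A) (a : sec W) (c : chart R k M (man_dim M)) m :
  compatible c -> ch_dom c `<=` W -> ch_dom c m ->
  lact x a m = \sum_j tau x (fun p => gi (ch_fun c (gm_act (lg_inv p) m) 0 j)) *
    kpartial j (a \o ch_inv c) (ch_fun c m).
Proof.
move=> cM cW cm; have Wm := cW _ cm.
have [c1 [w [c1A c1e vE]]] := lao_tangent g_lie_G x.
have sj j : smooth_near e (fun p => gi (ch_fun c (gm_act (lg_inv p) m) 0 j)).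
  exists ((fun p : G => gm_act (lg_inv p) m) @^-1` ch_dom c); split.
  - by apply: open_comp (@ch_dom_open _ _ _ _ c) => p _; exact: (inv_act_smooth m).1.
  - by rewrite /= gm_actV1.
  - exact: (inv_act_smooth m).2 (@ch_dom_open _ _ _ _ c) (compatible_coord j cM).
rewrite uact_inj// vE; last exact: smooth_near_trans.
under [RHS]eq_bigr do rewrite (vE _ (sj _)) mulr_suml.
rewrite exchange_big; apply: eq_bigr => i _ /=.
pose phi (u : 'rV[K]_(man_dim G)) := ch_fun c (gm_act (lg_inv (ch_inv c1 u)) m).
have phi0 : phi (ch_fun c1 e) = ch_fun c m by rewrite /phi ch_funK// gm_actV1.
have -> : kpartial i ((fun p => a (gm_act (lg_inv p) m)) \o ch_inv c1) (ch_fun c1 e)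
  = kpartial i ((a \o ch_inv c) \o phi) (ch_fun c1 e).
  apply: kpartial_near.
  have nc : \forall p \near e, ch_dom c (gm_act (lg_inv p) m).
    apply: (inv_act_smooth m).1; rewrite gm_actV1.
    exact: near_open (@ch_dom_open _ _ _ _ c) cm.
  have := @near_chart _ _ _ _ c1 (fun p => ch_dom c (gm_act (lg_inv p) m)) c1e nc.
  by apply: filterS => u cu; rewrite /= /phi ch_funK.
rewrite kpartial_comp.
- by rewrite phi0 mulr_sumr; apply: eq_bigr => j _; rewrite mulrA mulrAC.
- rewrite phi0; apply: ksmooth_kdiff (smooth_compatible cM (opens_open W)
    (section_smooth a)) _.
  by split; [exact: ch_fun_in|rewrite /= ch_funK].
- move=> j; apply: ksmooth_kdiff (smooth_map_coord j (inv_act_smooth m)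
    (atlas_compatible c1A) cM) _.
  by split; [exact: ch_fun_in|rewrite /= ch_funK// gm_actV1].
Qed.

(** The coefficients of the vector fields x and y are their values on the coordinate
    functions, which are sections over V. *)
Lemma bidiff_on_act (V : opens A) xc x y : coordinates V xc ->
  exists L, @bidiff_on R k M A V xc L (fun W a b => sec_mul (lact x a) (lact y b)).
Proof.
move=> [xcr xcc].
pose z j : sec V := mksec (xcr j).
exists [seq (sec_mul (lact x (z i)) (lact y (z j)), ([:: i], [:: j]))
  | i <- index_enum 'I_(man_dim M), j <- index_enum 'I_(man_dim M)].
move=> W WV c [cM cW cx] a b m cm.
have zE x' j : tau x' (fun p => gi (ch_fun c (gm_act (lg_inv p) m) 0 j))
  = lact x' (z j) m.
  have Vm : oset V m by exact/WV/cW.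
  rewrite uact_inj//; apply/esym.
  apply: (tangent_near (lao_tangent g_lie_G x')); first exact: smooth_near_trans.
  have nc : \forall p \near e, ch_dom c (gm_act (lg_inv p) m).
    apply: (inv_act_smooth m).1; rewrite gm_actV1.
    exact: near_open (@ch_dom_open _ _ _ _ c) cm.
  apply: filterS nc => p cp; rewrite mksecE ?cx//.
  exact/WV/cW.
rewrite sec_mulE !(uact_coord _ _ cM cW cm) /bidiff_sum.
rewrite big_allpairs_dep mulr_suml; apply: eq_bigr => i _.
rewrite mulr_sumr; apply: eq_bigr => j _.
rewrite -[RHS]/(sec_mul (lact x (z i)) (lact y (z j)) m *
  kpartial i (a \o ch_inv c) (ch_fun c m) * kpartial j (b \o ch_inv c) (ch_fun c m)).
by rewrite sec_mulE !zE; ring.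
Qed.

End ActionCoordinates.

(** * From infinitesimal to global invariance *)

Lemma sum_indicator (F : pzRingType) N (w : 'I_N -> F) i :
  \sum_j w j * (i == j)%:R = w i.
Proof.
rewrite (bigD1 i)//= eqxx mulr1 big1 ?addr0// => j ji.
by rewrite eq_sym (negbTE ji) mulr0.
Qed.

Section MoreCalculus.
Variables (R : realType) (k : geometry) (n : nat).
Local Notation C := (complex R : numFieldType).
Local Notation K := (ground R k).
Implicit Types (f : 'rV[K]_n -> C) (x : 'rV[K]_n).

Lemma has_gradient_sum I (r : seq I) (F : I -> 'rV[K]_n -> C) w x :
  (forall i, has_gradient (F i) x (w i)) ->
  has_gradient (fun y => \sum_(i <- r) F i y) x (fun j => \sum_(i <- r) w i j).
Proof.
move=> Fw; elim: r => [|i r IH].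
  under eq_fun do rewrite big_nil.
  rewrite (_ : (fun j => _) = fun=> 0); first exact: has_gradient_cst.
  by apply/funext => j; rewrite big_nil.
under eq_fun do rewrite big_cons.
rewrite (_ : (fun j => _) = fun j => w i j + \sum_(i <- r) w i j);
  first exact: has_gradientD.
by apply/funext => j; rewrite big_cons.
Qed.

Lemma has_gradientB f f' w w' x : has_gradient f x w -> has_gradient f' x w' ->
  has_gradient (fun y => f y - f' y) x (fun j => w j - w' j).
Proof.
move=> fw fw'.
have := has_gradientD fw (has_gradientM (has_gradient_cst (-1) x) fw').
rewrite (_ : (fun i => _) = (fun j => w j - w' j)); last first.
  by apply/funext => j; rewrite mul0r add0r mulN1r.
by under eq_fun do rewrite mulN1r.
Qed.

End MoreCalculus.

Section Invariance.
Variables (R : realType) (k : geometry) (G : lie_group R k) (M : G_manifold G).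
Local Notation A := (gm_fun M).
Local Notation C := (complex R : numFieldType).
Local Notation K := (ground R k).
Local Notation gi := (@ground_incl R k).
Local Notation e := (lg_one G).
Variables (g : lie_algebra R[i]) (tau : g -> (G -> R[i]) -> R[i]).
Hypothesis g_lie_G : is_lie_algebra_of tau.
Variables (U : enveloping g) (act : U_action M tau U).
Local Notation lact x a := (uact act (env_inj U x) a).

Lemma gm_transE (q : G) (W : opens A) (a : sec W) n : oset W (gm_act (lg_inv q) n) ->
  gm_trans q a n = a (gm_act (lg_inv q) n).
Proof.
move=> Wn; apply: mksecE; exists (gm_act (lg_inv q) n) => //; exact: gm_actVK.
Qed.

Lemma gm_opensP (q : G) (W : opens A) n :
  oset (gm_opens q W) n <-> oset W (gm_act (lg_inv q) n).
Proof.
split=> [[m Wm <-]|Wn]; first by rewrite gm_actK.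
by exists (gm_act (lg_inv q) n) => //; exact: gm_actVK.
Qed.

Variable f : sheaf_op2 A.

(** Invariance of f under G says that this function of q is constant. *)
Definition transport (W : opens A) (a b : sec W) m (q : G) : C :=
  f (gm_trans q a) (gm_trans q b) (gm_act q m).

Hypothesis fb : sheaf_bilin f.

(** By this rule the behaviour near q1 follows from the behaviour near 1. *)
Lemma transport_mul (W : opens A) (a b : sec W) m (q q1 : G) : oset W m ->
  transport a b m (lg_mul q q1) =
  transport (gm_trans q1 a) (gm_trans q1 b) (gm_act q1 m) q.
Proof.
move=> Wm; have E n : gm_act (lg_inv (lg_mul q q1)) n = gm_act (lg_inv q1)
  (gm_act (lg_inv q) n).
  have {1}-> : n = gm_act (lg_mul q q1) (gm_act (lg_inv q1) (gm_act (lg_inv q) n)).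
    by rewrite gm_actM !gm_actVK.
  by rewrite gm_actK.
rewrite /transport gm_actM; apply: op2_local => //.
- by apply/gm_opensP; rewrite E !gm_actK.
- by do 2 (apply/gm_opensP; rewrite gm_actK).
- move=> n /gm_opensP h1 /gm_opensP/gm_opensP h2.
  by rewrite !gm_transE ?E//; apply/gm_opensP.
- move=> n /gm_opensP h1 /gm_opensP/gm_opensP h2.
  by rewrite !gm_transE ?E//; apply/gm_opensP.
Qed.

Lemma transport1 (W : opens A) (a b : sec W) m : oset W m ->
  transport a b m e = f a b m.
Proof.
move=> Wm; rewrite /transport gm_act1; apply: op2_local => //.
- by apply/gm_opensP; rewrite gm_actV1.
- by move=> n h1 h2; rewrite gm_transE gm_actV1.
- by move=> n h1 h2; rewrite gm_transE gm_actV1.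
Qed.

Section AtOne.
Variables (V : opens A) (xc : M -> 'rV[K]_(man_dim M)) (L : seq (sec V * bidiff_term M)).
Hypothesis fL : bidiff_on xc L f.
Hypothesis f_inv : forall (x : g) W (a b : sec W),
  lact x (f a b) = f (lact x a) b + f a (lact x b).
Variables (cG : chart R k G (man_dim G)) (cGA : man_atlas cG) (cG1 : ch_dom cG e).
Variables (W : opens A) (a b : sec W).
Variables (c : chart R k M (man_dim M)).
Hypotheses (cV : coord_chart V xc c) (cW : ch_dom c `<=` W).
Let u0 := ch_fun cG e.
Let N := man_dim G.
Let n := man_dim M.

(** The translate (q a') (n) = a' (q^-1 n) as a function of the coordinates of q in G
    and of n in M. *)
Definition moved (a' : sec W) (v : 'rV[K]_(N + n)) : C :=
  a' (gm_act (lg_inv (ch_inv cG (lsubmx v))) (ch_inv c (rsubmx v))).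

Let O := product_dom (fun u : G * M => gm_act u.1 u.2) (@lg_inv _ _ G) cG c (oset W).

Let Oo : open O.
Proof. exact: (product_dom_open (gm_act_smooth M) (lg_inv_smooth G) (opens_open W)). Qed.

Let cM : compatible c. Proof. by have [] := cV. Qed.

Lemma moved_smooth a' : ksmooth O (moved a').
Proof.
exact: (product_smooth (gm_act_smooth M) (lg_inv_smooth G) (atlas_compatible cGA) cM
  (opens_open W) (section_smooth a')).
Qed.

Lemma moved_rowE a' u y : moved a' (row_mx u y) =
  a' (gm_act (lg_inv (ch_inv cG u)) (ch_inv c y)).
Proof. by rewrite /moved row_mxKl row_mxKr. Qed.

Lemma inv_u0 : ch_inv cG u0 = e. Proof. by rewrite /u0 ch_funK. Qed.

Lemma moved_at1 a' y : moved a' (row_mx u0 y) = a' (ch_inv c y).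
Proof. by rewrite moved_rowE inv_u0 gm_actV1. Qed.

Lemma O_at1 y : ch_cod c y -> O (row_mx u0 y).
Proof.
move=> cy; split; rewrite ?row_mxKl ?row_mxKr//; first exact: ch_fun_in.
by rewrite /= inv_u0 gm_actV1; exact/cW/ch_inv_in.
Qed.

(** By [moved_fE], f (q a, q b) (n) as a function of the coordinates of q and n. *)
Definition moved_f (v : 'rV[K]_(N + n)) : C :=
  \sum_(t <- L) t.1 (ch_inv c (rsubmx v)) *
    foldr (@kpartial R k _) (moved a) (map (@rshift N n) t.2.1) v *
    foldr (@kpartial R k _) (moved b) (map (@rshift N n) t.2.2) v.

Lemma moved_foldr a' al v : O v ->
  foldr (@kpartial R k _) (gm_trans (ch_inv cG (lsubmx v)) a' \o ch_inv c) al (rsubmx v) =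
  foldr (@kpartial R k _) (moved a') (map (@rshift N n) al) v.
Proof.
move=> [h1 h2 h3]; rewrite -[in RHS](hsubmxK v) foldr_kpartial_rshift.
set q := ch_inv cG (lsubmx v).
apply: (@foldr_kpartial_eq _ _ _ _ _ (ch_cod c `&` ch_inv c @^-1` oset (gm_opens q W))).
- by apply: open_chart_preim; exact: opens_open.
- by move=> y [cy /gm_opensP qy]; rewrite moved_rowE; exact: gm_transE.
- by split=> //; apply/gm_opensP.
Qed.

Lemma moved_fE v : O v ->
  f (gm_trans (ch_inv cG (lsubmx v)) a) (gm_trans (ch_inv cG (lsubmx v)) b)
    (ch_inv c (rsubmx v)) = moved_f v.
Proof.
move=> Ov; have [h1 h2 h3] := Ov; set q := ch_inv cG (lsubmx v).
have [_ cVs cx] := cV.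
pose c' := res_chart c (opens_open (gm_opens q W)).
have c'n : ch_dom c' (ch_inv c (rsubmx v)) by split; [exact: ch_inv_in|apply/gm_opensP].
rewrite (@bidiff_value _ _ _ _ V xc L f (gm_opens q W) c' _ _ _ fb fL _ _ c'n).
- apply: eq_bigr => t _.
  have -> : ch_fun c' (ch_inv c (rsubmx v)) = rsubmx v by exact: (ch_invK h2).
  by congr (_ * _ * _); exact: moved_foldr.
- split; [exact: res_chart_compatible|by move=> m [/cVs]|by move=> m [/cx]].
- by move=> m [].
Qed.

(** The coefficients of f depend on the point of M alone. *)
Lemma coeff_has_gradient (t : sec V) y : ch_cod c y ->
  exists2 w, has_gradient (fun v : 'rV[K]_(N + n) => t (ch_inv c (rsubmx v)))
    (row_mx u0 y) w &
    forall i, w (lshift n i) = 0.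
Proof.
move=> cy; have [_ cVs _] := cV.
have : ksmooth O (fun v => t (ch_inv c (rsubmx v))).
  have OV v : O v -> (ch_cod c `&` ch_inv c @^-1` oset V) (rsubmx v).
    by move=> [_ h _]; split => //; exact/cVs/ch_inv_in.
  have Vo : open (ch_cod c `&` ch_inv c @^-1` oset V).
    by apply: open_chart_preim; exact: opens_open.
  apply: (ksmooth_comp Oo Vo OV (smooth_compatible cM (opens_open V)
    (section_smooth t))) => j.
  apply: (@ksmooth_eq _ _ _ (fun v => gi (v 0 (rshift _ j)))) => //.
    by move=> v _; rewrite mxE.
  exact: ksmooth_coord.
move=> /ksmooth_kdiff/(_ (O_at1 cy)) h; exists (fun i => kpartial i (fun v =>
  t (ch_inv c (rsubmx v))) (row_mx u0 y)) => // i.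
rewrite kpartial_lshift.
under eq_fun do rewrite row_mxKr.
by rewrite (has_gradient_partial (has_gradient_cst _ _)).
Qed.

Lemma foldr_moved_at1 a' al y : ch_cod c y ->
  foldr (@kpartial R k _) (moved a') (map (@rshift N n) al) (row_mx u0 y) =
  foldr (@kpartial R k _) (a' \o ch_inv c) al (ch_fun c (ch_inv c y)).
Proof.
move=> cy; rewrite foldr_kpartial_rshift ch_invK//.
by congr (foldr _ _ al y); apply/funext => z; rewrite moved_at1.
Qed.

Lemma moved_f_kdiff y : ch_cod c y -> has_gradient moved_f (row_mx u0 y)
  (fun j => \sum_(t <- L) kpartial j (fun v => t.1 (ch_inv c (rsubmx v)) *
    foldr (@kpartial R k _) (moved a) (map (@rshift N n) t.2.1) v *
    foldr (@kpartial R k _) (moved b) (map (@rshift N n) t.2.2) v) (row_mx u0 y)).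
Proof.
move=> cy; apply: has_gradient_sum => t.
have [w h0 _] := coeff_has_gradient t.1 cy.
have ha := ksmooth_kdiff (ksmooth_foldr (map (@rshift N n) t.2.1) (moved_smooth a))
  (O_at1 cy).
have hb := ksmooth_kdiff (ksmooth_foldr (map (@rshift N n) t.2.2) (moved_smooth b))
  (O_at1 cy).
exact: has_gradient_kdiff (has_gradientM (has_gradientM h0 ha) hb).
Qed.

Lemma moved_defect_has_gradient y : ch_cod c y ->
  has_gradient (fun v => moved_f v - moved (f a b) v) (row_mx u0 y)
     (fun j => kpartial j moved_f (row_mx u0 y) - kpartial j (moved (f a b))
       (row_mx u0 y)).
Proof.
move=> cy; apply: has_gradientB; first exact: has_gradient_kdiff (moved_f_kdiff cy).
exact: ksmooth_kdiff (moved_smooth _) (O_at1 cy).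
Qed.

(** Let D (q, n) = f (q a, q b) (n) - (q f (a, b)) (n).  Then
    D (q, q m) = f (q a, q b) (q m) - f (a, b) (m), and D (1, n) = 0 for all n, so only the
    derivatives of D in the direction of G contribute to the derivative at q = 1. *)
Lemma transport_has_gradient m : ch_dom c m ->
  has_gradient (transport a b m \o ch_inv cG) u0 (fun i => kpartial (lshift n i)
    (fun v => moved_f v - moved (f a b) v) (row_mx u0 (ch_fun c m))).
Proof.
move=> cm; have Wm := cW cm; have cym := ch_fun_in cm.
pose y u := ch_fun c (gm_act (ch_inv cG u) m).
have y0 : y u0 = ch_fun c m by rewrite /y inv_u0 gm_act1.
pose D v := moved_f v - moved (f a b) v.
have D0 z : ch_cod c z -> D (row_mx u0 z) = 0.
  move=> cz; rewrite /D -(moved_fE (O_at1 cz)) row_mxKl row_mxKr inv_u0 moved_at1.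
  have Wz : oset W (ch_inv c z) by exact/cW/ch_inv_in.
  by rewrite -(transport1 _ _ Wz) /transport gm_act1 subrr.
have D_at1 := moved_defect_has_gradient cym; rewrite -/D in D_at1.
have Dr j : kpartial (rshift N j) D (row_mx u0 (ch_fun c m)) = 0.
  rewrite kpartial_rshift.
  have -> : kpartial j (fun z => D (row_mx u0 z)) (ch_fun c m) = kpartial j (fun=> 0)
    (ch_fun c m).
    apply: kpartial_near.
    by apply: filterS (near_open (@ch_cod_open _ _ _ _ c) cym) => z /D0.
  by rewrite (has_gradient_partial (has_gradient_cst _ _)).
have near_dom : \forall u \near u0, ch_cod cG u /\ ch_dom c (gm_act (ch_inv cG u) m).
  have cG0 : ch_cod cG u0 by exact: ch_fun_in.
  have h2 : \forall q \near e, ch_dom c (gm_act q m).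
    apply: (act_smooth m).1; rewrite gm_act1; exact: near_open (@ch_dom_open _ _ _ _ c)
      cm.
  exact: (filterI (near_open (@ch_cod_open _ _ _ _ cG) cG0)
    (@near_chart _ _ _ _ cG (fun q => ch_dom c (gm_act q m)) cG1 h2)).
have E : \forall u \near u0, D (row_mx u (y u)) + f a b m = (transport a b m \o ch_inv
  cG) u.
  apply: filterS near_dom => u [cu cqm].
  have yK : ch_inv c (y u) = gm_act (ch_inv cG u) m by rewrite /y ch_funK.
  have Ou : O (row_mx u (y u)).
    split; rewrite ?row_mxKl ?row_mxKr//; first exact: ch_fun_in.
    by rewrite /= yK gm_actK.
  rewrite /D -(moved_fE Ou) row_mxKl row_mxKr moved_rowE yK gm_actK.
  by rewrite subrK.
have phi_kdiff j : kdiff (fun u => gi (row_mx u (y u) 0 j)) u0.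
  case: (split_ordP j) => l ->.
    rewrite (_ : (fun u => _) = fun u : 'rV[K]_N => gi (u 0 l));
      first exact: has_gradient_kdiff (has_gradient_coord _ _).
    by apply/funext => u; rewrite row_mxEl.
  rewrite (_ : (fun u => _) = fun u : 'rV[K]_N => gi (ch_fun c (gm_act (ch_inv cG u) m)
    0 l)); last first.
    by apply/funext => u; rewrite row_mxEr.
  apply: ksmooth_kdiff (smooth_map_coord l (act_smooth m) (atlas_compatible cGA) cM) _.
  by split; [exact: ch_fun_in|rewrite /= inv_u0 gm_act1].
pose phi u := row_mx u (y u).
have phi0 : phi u0 = row_mx u0 (ch_fun c m) by rewrite /phi y0.
have Dd : kdiff D (phi u0) by rewrite phi0; exact: has_gradient_kdiff D_at1.
have cD := has_gradient_comp Dd phi_kdiff.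
have cDf := has_gradientD cD (has_gradient_cst (f a b m) u0).
have cT := has_gradient_near E cDf.
suff <- : (fun i => \sum_j kpartial j D (phi u0) * kpartial i (fun u =>
  gi (phi u 0 j)) u0 + 0)
  = (fun i => kpartial (lshift n i) D (row_mx u0 (ch_fun c m))) by [].
apply/funext => i; rewrite addr0 phi0 big_split_ord /=.
rewrite [X in _ + X]big1 ?addr0; last by move=> j _; rewrite Dr mul0r.
have coordE j : kpartial i (fun u => gi (phi u 0 (lshift n j))) u0 = (i == j)%:R.
  have -> : (fun u => gi (phi u 0 (lshift n j))) = fun u : 'rV[K]_N => gi (u 0 j).
    by apply/funext => u; rewrite /phi row_mxEl.
  by rewrite (has_gradient_partial (has_gradient_coord _ _)).
under eq_bigr => j _ do rewrite (coordE j).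
exact: (sum_indicator (fun j => kpartial (lshift n j) D (row_mx u0 (ch_fun c m))) i).
Qed.

Section Direction.
Variables (i : 'I_N) (x : g).
Hypothesis xi : forall b, smooth_near e b -> tau x b = kpartial i (b \o ch_inv cG) u0.

Lemma moved_lshift a' y : ch_cod c y ->
  kpartial (lshift n i) (moved a') (row_mx u0 y) = lact x a' (ch_inv c y).
Proof.
move=> cy; have Wy := cW (ch_inv_in cy).
rewrite uact_inj// xi; last exact: smooth_near_trans.
by rewrite kpartial_lshift; congr (kpartial i _ u0); apply/funext =>
  u; rewrite moved_rowE.
Qed.

(** Derivatives along G commute with derivatives along M, by the symmetry of second
    derivatives. *)
Lemma foldr_moved_lshift a' al y : ch_cod c y ->
  kpartial (lshift n i) (foldr (@kpartial R k _) (moved a') (map (@rshift N n) al))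
    (row_mx u0 y) =
  foldr (@kpartial R k _) (lact x a' \o ch_inv c) al (ch_fun c (ch_inv c y)).
Proof.
move=> cy; rewrite (kpartial_foldr _ _ Oo (moved_smooth a') (O_at1 cy)).
rewrite foldr_kpartial_rshift ch_invK//.
apply: (foldr_kpartial_eq _ (@ch_cod_open _ _ _ _ c) _ cy) => z cz.
exact: moved_lshift.
Qed.

Lemma moved_f_lshift y : ch_cod c y ->
  kpartial (lshift n i) moved_f (row_mx u0 y) = lact x (f a b) (ch_inv c y).
Proof.
move=> cy; rewrite (has_gradient_partial (moved_f_kdiff cy)).
have cy' := ch_inv_in cy.
rewrite f_inv secDE !(bidiff_value _ _ fb fL cV cW cy') -big_split; apply: eq_bigr => t _.
have [w h0 w0] := coeff_has_gradient t.1 cy.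
have ha := ksmooth_kdiff (ksmooth_foldr (map (@rshift N n) t.2.1) (moved_smooth a))
  (O_at1 cy).
have hb := ksmooth_kdiff (ksmooth_foldr (map (@rshift N n) t.2.2) (moved_smooth b))
  (O_at1 cy).
rewrite (has_gradient_partial (has_gradientM (has_gradientM h0 ha) hb))
  w0 !foldr_moved_lshift// !foldr_moved_at1//.
by rewrite row_mxKr mul0r add0r.
Qed.

(** The derivative of D along G at q = 1 is the failure of f to be invariant under x. *)
Lemma transport_partial m : ch_dom c m ->
  kpartial i (transport a b m \o ch_inv cG) u0 = 0.
Proof.
move=> cm; have cym := ch_fun_in cm; rewrite (has_gradient_partial
  (transport_has_gradient cm)).
by rewrite (has_gradient_partial (moved_defect_has_gradient cym))
  moved_f_lshift// moved_lshift// subrr.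
Qed.

End Direction.
End AtOne.

Hypothesis f_bidiff : bidifferential f.
Hypothesis f_inv : forall (x : g) W (a b : sec W),
  lact x (f a b) = f (lact x a) b + f a (lact x b).

Lemma transport_has_gradient1 (cG : chart R k G (man_dim G)) W (a b : sec W) m :
  man_atlas cG -> ch_dom cG e -> oset W m ->
  has_gradient (transport a b m \o ch_inv cG) (ch_fun cG e) (fun=> 0).
Proof.
move=> cGA cG1 Wm; have [_ /(_ m) [V [xc [L [Vm [_ xcc] fL]]]]] := (bidiff_onP f).1
  f_bidiff.
have [c0 [c0M c0V c0x] c0m] := xcc m Vm.
pose c := res_chart c0 (opens_open W).
have cV : coord_chart V xc c.
  by split; [exact: res_chart_compatible|move=> n [/c0V]|move=> n [/c0x]].
have cW : ch_dom c `<=` W by move=> n [].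
have cm : ch_dom c m by [].
have kd := has_gradient_kdiff (transport_has_gradient fL cGA cG1 a b cV cW cm).
rewrite (_ : (fun=> 0) = fun i => kpartial i (transport a b m \o ch_inv cG)
  (ch_fun cG e))//.
apply/funext => i; apply/esym.
have vT : tangent e (fun a' => kpartial i (a' \o ch_inv cG) (ch_fun cG e)).
  exists cG, (delta_mx 0 i); split=> // a' _.
  rewrite (bigD1 i)//= mxE !eqxx mul1r big1 ?addr0// => j /negbTE ji.
  by rewrite mxE eqxx ji mul0r.
have [x xi] := lao_surj g_lie_G vT.
exact: (transport_partial fL f_inv cGA cG1 a b cV cW xi cm).
Qed.

(** Right translations move the previous lemma to all points of the group. *)
Lemma transport_has_gradient_all (d : chart R k G (man_dim G)) W (a b : sec W) m u :
  man_atlas d -> ch_cod d u -> oset W m ->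
  has_gradient (transport a b m \o ch_inv d) u (fun=> 0).
Proof.
move=> dA du Wm; set q1 := ch_inv d u.
have [cG cGA cG1] := man_cover e.
pose phi v := ch_fun cG (lg_mul (ch_inv d v) (lg_inv q1)).
have mulS : smooth_map (fun p : G => lg_mul p (lg_inv q1)).
  exact: (smooth_map_slice (lg_inv q1) (lg_mul_smooth G)).
have phi0 : phi u = ch_fun cG e by rewrite /phi lg_mulrV.
have W1m : oset (gm_opens q1 W) (gm_act q1 m) by exists m.
have T1 := transport_has_gradient1 (gm_trans q1 a) (gm_trans q1 b) cGA cG1 W1m.
rewrite -phi0 in T1.
have phid j : kdiff (fun v => gi (phi v 0 j)) u.
  apply: ksmooth_kdiff (smooth_map_coord j mulS (atlas_compatible dA)
    (atlas_compatible cGA)) _.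
  by split=> //; rewrite /= lg_mulrV.
have T2 := has_gradient_comp T1 phid.
have E : \forall v \near u, ((transport (gm_trans q1 a) (gm_trans q1 b) (gm_act q1 m)
  \o ch_inv cG) \o phi) v
     = (transport a b m \o ch_inv d) v.
  have q1d : ch_dom d q1 by exact: ch_inv_in.
  have h : \forall p \near q1, ch_dom cG (lg_mul p (lg_inv q1)).
    apply: mulS.1; rewrite lg_mulrV; exact: near_open (@ch_dom_open _ _ _ _ cG) cG1.
  have := @near_chart _ _ _ _ d (fun p => ch_dom cG (lg_mul p (lg_inv q1))) q1d h.
  rewrite ch_invK//; apply: filterS => v cv.
  by rewrite /= /phi ch_funK// -transport_mul// lg_mul_cancel.
have T3 := has_gradient_near E T2.
rewrite (_ : (fun=> 0) = (fun i => \sum_j 0 * kpartial i (fun v => gi (phi v 0 j)) u))//.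
by apply/funext => i; rewrite big1// => j _; rewrite mul0r.
Qed.

Lemma transport_locally_constant W (a b : sec W) m q : oset W m ->
  \forall p \near q, transport a b m p = transport a b m q.
Proof.
move=> Wm; have [d dA dq] := man_cover q.
have dq' : ch_cod d (ch_fun d q) by exact: ch_fun_in.
have /nbhs_ballP[r r0 rd] := near_open (@ch_cod_open _ _ _ _ d) dq'.
have cst := has_gradient0_const r0 (fun y yr => transport_has_gradient_all a b dA (rd y
  yr) Wm).
have nb := ch_fun_cont dq (nbhsx_ballx (ch_fun d q) r r0).
have nd := near_open (@ch_dom_open _ _ _ _ d) dq.
near=> p.
have pd : ch_dom d p by near: p.
have pb : ball (ch_fun d q) r (ch_fun d p) by near: p.
by have := cst _ pb; rewrite /= !ch_funK.
Unshelve. all: by end_near. Qed.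

(** The function [transport] is locally constant and G is connected. *)
Lemma infinitesimal_invariance : connected [set: G] -> G_invariant f.
Proof.
move=> Gc q W a b.
suff key m : oset W m -> transport a b m q = f a b m.
  apply: sec_eqP => n [m Wm <-].
  by rewrite gm_transE gm_actK// -key.
move=> Wm; rewrite -(transport1 a b Wm).
pose S := [set p : G | transport a b m p = transport a b m e].
have So : open S.
  apply: open_near => p Sp; have := transport_locally_constant a b p Wm.
  by apply: filterS => p' E; rewrite /S /= E.
have Sc : closed S.
  rewrite -[S]setCK; apply: open_closedC; apply: open_near => p Sp.
  have := transport_locally_constant a b p Wm.
  by apply: filterS => p' E; rewrite /S /= E.
have -> // : S q.
have -> // : S = [set: G].
by apply: Gc; [exists e|exists S; rewrite ?setTI|exists S; rewrite ?setTI].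
Qed.

End Invariance.

(** * Bilinear maps and tensors *)

Section Bilinear.
Variable C : comNzRingType.

Lemma bilinPl (V W X : lmodType C) (f : V -> W -> X) : bilin f ->
  forall z u v w, f (z *: u + v) w = z *: f u w + f v w.
Proof. by move=> [fl _] z u v w; exact: (fl w). Qed.

Lemma bilinPr (V W X : lmodType C) (f : V -> W -> X) : bilin f ->
  forall z u v w, f w (z *: u + v) = z *: f w u + f w v.
Proof. by move=> [_ fr] z u v w; exact: (fr w). Qed.

Lemma linfun0 (V W : lmodType C) (f : V -> W) : linear f -> f 0 = 0.
Proof. by move=> fl; have := fl (-1) 0 0; rewrite scaler0 addr0 scaleN1r addNr. Qed.

Lemma linfunD (V W : lmodType C) (f : V -> W) : linear f ->
  forall u v, f (u + v) = f u + f v.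
Proof. by move=> fl u v; have := fl 1 u v; rewrite !scale1r. Qed.

Lemma linfunZ (V W : lmodType C) (f : V -> W) : linear f ->
  forall z u, f (z *: u) = z *: f u.
Proof. by move=> fl z u; have := fl z u 0; rewrite (linfun0 fl) !addr0. Qed.

Lemma linfunN (V W : lmodType C) (f : V -> W) : linear f -> forall u, f (- u) = - f u.
Proof. by move=> fl u; rewrite -scaleN1r (linfunZ fl) scaleN1r. Qed.

Lemma linfunB (V W : lmodType C) (f : V -> W) : linear f ->
  forall u v, f (u - v) = f u - f v.
Proof. by move=> fl u v; rewrite (linfunD fl) (linfunN fl). Qed.

Lemma linfun_sum (V W : lmodType C) (f : V -> W) I (r : seq I) (F : I -> V) :
  linear f -> f (\sum_(i <- r) F i) = \sum_(i <- r) f (F i).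
Proof.
move=> fl; elim: r => [|i r IH]; first by rewrite !big_nil (linfun0 fl).
by rewrite !big_cons (linfunD fl) IH.
Qed.

Lemma linear_bigsum (V W : lmodType C) I (r : seq I) (F : I -> V -> W) :
  (forall i, linear (F i)) -> linear (fun v => \sum_(i <- r) F i v).
Proof.
move=> Fl z u v; rewrite scaler_sumr -big_split; apply: eq_bigr => i _.
exact: Fl.
Qed.

Lemma bilin_sum (V W X : lmodType C) I (r : seq I) (F : I -> V -> W -> X) :
  (forall i, bilin (F i)) -> bilin (fun v w => \sum_(i <- r) F i v w).
Proof.
by move=> Fb; split=> [w|v]; apply: linear_bigsum => i; [exact: (Fb i).1|exact: (Fb i).2].
Qed.

Lemma bilin_add (V W X : lmodType C) (f h : V -> W -> X) :
  bilin f -> bilin h -> bilin (fun v w => f v w + h v w).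
Proof.
move=> fb hb; split=> [w|v] z u u'.
  by rewrite (bilinPl fb) (bilinPl hb) scalerDr addrACA.
by rewrite (bilinPr fb) (bilinPr hb) scalerDr addrACA.
Qed.

Lemma tlift_sum (V W T : lmodType C) (t : tensor_on V W T) (X : lmodType C)
    (f : V -> W -> X) (l : seq (V * W)) : bilin f ->
  tlift t f (\sum_(u <- l) pure t u.1 u.2) = \sum_(u <- l) f u.1 u.2.
Proof.
move=> fb; rewrite (linfun_sum _ _ (tlift_linear t fb)).
by apply: eq_bigr => u _; rewrite tlift_pure.
Qed.

End Bilinear.

(** The linear map that expands in bases of V and W agrees with the identity on pure
    tensors. *)
Lemma tensor_decomp (C : fieldType) (V W : vectType C) (T : lmodType C)
    (t : tensor_on V W T) (r : T) :
  exists l : seq (V * W), r = \sum_(u <- l) pure t u.1 u.2.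
Proof.
pose e := vbasis (fullv : {vspace V}); pose e' := vbasis (fullv : {vspace W}).
pose cf i j : V -> W -> C^o := fun v w => coord e i v * coord e' j w.
have cfb i j : bilin (cf i j).
  split=> [w|v] z u u'; rewrite /cf linearP.
    by rewrite mulrDl -[LHS]/(z * coord e i u * coord e' j w + _) -mulrA.
  by rewrite mulrDr -[LHS]/(coord e i v * (z * coord e' j u) + _) mulrCA.
exists [seq (tlift t (cf i j) r *: e`_i, e'`_j) | i <- index_enum 'I_(\dim (fullv :
  {vspace V})), j <- index_enum 'I_(\dim (fullv : {vspace W}))].
rewrite big_allpairs_dep /=.
have E : r = \sum_i \sum_j tlift t (cf i j) r *: pure t e`_i e'`_j.
  apply: (@tensor_ext _ _ _ _ t T id (fun r => \sum_i \sum_j tlift t (cf i j)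
    r *: pure t e`_i e'`_j)).
  - by [].
  - apply: linear_bigsum => i; apply: linear_bigsum => j z u u'.
    by rewrite (tlift_linear t (cfb i j)) scalerDl scalerA.
  - move=> v w; have pb := pure_bilin t.
    rewrite {1}(coord_vbasis (memvf v)) (linfun_sum _ _ (pb.1 w)); apply: eq_bigr => i _.
    rewrite (linfunZ (pb.1 w)) {1}(coord_vbasis (memvf w)) (linfun_sum _ _ (pb.2 _))
      scaler_sumr.
    apply: eq_bigr => j _; rewrite (tlift_pure t (cfb i j)) (linfunZ (pb.2 _)) scalerA.
    by [].
rewrite {1}E; apply: eq_bigr => i _; apply: eq_bigr => j _.
by rewrite (linfunZ ((pure_bilin t).1 _)).
Qed.

(** * Brackets obtained by skew-symmetrization *)

(** The signed combination of six identities, one for each order of three arguments. *)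
Lemma alternating_sum0 (C : zmodType) (L1 R1 L2 R2 L3 R3 L4 R4 L5 R5 L6 R6 X : C) :
  L1 = R1 -> L2 = R2 -> L3 = R3 -> L4 = R4 -> L5 = R5 -> L6 = R6 ->
  X = - ((L1 - R1) + (L2 - R2) + (L3 - R3) - (L4 - R4) - (L5 - R5) - (L6 - R6)) ->
  X = 0.
Proof. by move=> -> -> -> -> -> -> ->; rewrite !subrr !subr0 !addr0 oppr0. Qed.

Section Brackets.
Variables (R : realType) (k : geometry) (M : manifold R k) (A : fun_sheaf R M).
Implicit Types (B f : sheaf_op2 A) (V W : opens A).

Lemma sec_congr W (a b : sec W) m : a = b -> a m = b m. Proof. by move=> ->. Qed.

Lemma sec_mulC W (a b : sec W) : sec_mul a b = sec_mul b a.
Proof. by apply: sec_eqP => m _; rewrite !sec_mulE mulrC. Qed.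

Lemma sec_mul_bilin W : bilin (@sec_mul R M A W).
Proof.
split=> [w|v] z a b; apply: sec_eqP => m _; rewrite secDE secZE !sec_mulE secDE secZE.
  by rewrite mulrDl mulrA.
by rewrite mulrDr mulrCA.
Qed.

Lemma sec_mulDl W (a b c : sec W) : sec_mul (a + b) c = sec_mul a c + sec_mul b c.
Proof. exact: (linfunD ((sec_mul_bilin W).1 c)). Qed.

Lemma sec_mulDr W (a b c : sec W) : sec_mul a (b + c) = sec_mul a b + sec_mul a c.
Proof. exact: (linfunD ((sec_mul_bilin W).2 a)). Qed.

Lemma sec_mulNl W (a c : sec W) : sec_mul (- a) c = - sec_mul a c.
Proof. exact: (linfunN ((sec_mul_bilin W).1 c)). Qed.

Lemma sec_res_linear V W (VW : V `<=` W) : linear (@sec_res R M A V W VW).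
Proof.
move=> z a b; apply: sec_eqP => m Vm.
by rewrite secDE secZE !sec_resE// secDE secZE.
Qed.

Section Bilinear.
Variables (B : sheaf_op2 A) (Bb : sheaf_bilin B).
Lemma opDl W (a b c : sec W) : B (a + b) c = B a c + B b c.
Proof. exact: (linfunD ((Bb.1 W).1 c)). Qed.
Lemma opDr W (a b c : sec W) : B a (b + c) = B a b + B a c.
Proof. exact: (linfunD ((Bb.1 W).2 a)). Qed.
Lemma opNl W (a c : sec W) : B (- a) c = - B a c.
Proof. exact: (linfunN ((Bb.1 W).1 c)). Qed.
Lemma opNr W (a c : sec W) : B a (- c) = - B a c.
Proof. exact: (linfunN ((Bb.1 W).2 a)). Qed.
End Bilinear.

Lemma sheaf_bilin_add B B' : sheaf_bilin B -> sheaf_bilin B' ->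
  sheaf_bilin (fun W a b => B W a b + B' W a b).
Proof.
move=> [Bl Br] [Bl' Br']; split=> [W|V W VW a b]; first exact: bilin_add.
by rewrite (linfunD (sec_res_linear VW)) Br Br'.
Qed.

Lemma sheaf_bilin_swap B : sheaf_bilin B -> sheaf_bilin (fun W a b => - B W b a).
Proof.
move=> [Bl Br]; split=> [W|V W VW a b].
  split=> [w|v] z a b.
    by rewrite (bilinPr (Bl W)) opprD scalerN.
  by rewrite (bilinPl (Bl W)) opprD scalerN.
by rewrite (linfunN (sec_res_linear VW)) Br.
Qed.

Lemma antisym_bilin B : sheaf_bilin B -> sheaf_bilin (antisym B).
Proof. by move=> Bb; exact: (sheaf_bilin_add Bb (sheaf_bilin_swap Bb)). Qed.

(** The Leibniz rule is the combination
    delta B (a, b, c) - delta B (a, c, b) + delta B (c, a, b) of cocycle identities. *)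
Lemma antisym_bracket B : sheaf_bilin B ->
  (forall W (a b c : sec W), sec_mul (B W a b) c + B W (sec_mul a b) c =
     B W a (sec_mul b c) + sec_mul a (B W b c)) ->
  is_bracket (antisym B).
Proof.
move=> Bb cocycle; split; first exact: antisym_bilin.
- by move=> W a b; rewrite /antisym opprB.
- move=> W a b c; apply: sec_eqP => m _; rewrite /antisym.
  rewrite !secDE !sec_mulE !secDE !secNE.
  have h1 := sec_congr m (cocycle W a b c).
  have h2 := sec_congr m (cocycle W a c b).
  have h3 := sec_congr m (cocycle W c a b).
  move: h1 h2 h3; rewrite !secDE !sec_mulE (sec_mulC c b) (sec_mulC c a) => h1 h2 h3.
  apply/eqP; rewrite -subr_eq0; apply/eqP.
  transitivity ((B W a b m * c m + B W (sec_mul a b) c m - (B W a (sec_mul b c)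
    m + a m * B W b c m))
   - (B W a c m * b m + B W (sec_mul a c) b m - (B W a (sec_mul b c) m + a m * B W c b m))
   + (B W c a m * b m + B W (sec_mul a c) b m - (B W c (sec_mul a b)
       m + c m * B W a b m))).
    by ring.
  by rewrite h1 h2 h3 !subrr addr0.
Qed.

(** Skew-symmetrizing the second-order associativity identity kills the
    coefficient B2, because the multiplication is commutative. *)
Lemma antisym_compatible B B' B2 : sheaf_bilin B -> sheaf_bilin B' -> sheaf_bilin B2 ->
  (forall W (a b c : sec W),
     sec_mul (B2 W a b) c + B W (B' W a b) c + B' W (B W a b) c + B2 W (sec_mul a b) c =
     sec_mul a (B2 W b c) + B W a (B' W b c) + B' W a (B W b c) + B2 W a (sec_mul b c)) ->
  compatible_brackets (antisym B) (antisym B').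
Proof.
move=> Bb Bb' Bb2 H W a b c; apply: sec_eqP => m _; rewrite /schouten_bv /antisym.
rewrite !(opDl Bb) !(opDl Bb') !(opDr Bb) !(opDr Bb') !(opNl Bb) !(opNl Bb') !(opNr Bb)
  !(opNr Bb').
have h1 := sec_congr m (H W a b c); have h2 := sec_congr m (H W b c a).
have h3 := sec_congr m (H W c a b); have h4 := sec_congr m (H W b a c).
have h5 := sec_congr m (H W a c b); have h6 := sec_congr m (H W c b a).
move: h1 h2 h3 h4 h5 h6.
rewrite !secDE !sec_mulE (sec_mulC b a) (sec_mulC c b) (sec_mulC c a)
  sec0E !(secDE, secNE).
move=> h1 h2 h3 h4 h5 h6.
by apply: (alternating_sum0 h1 h2 h3 h4 h5 h6); ring.
Qed.

(** Up to sign, half of the Schouten bracket, not symmetrized in f and f'. *)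
Definition jacobiator f f' W (a b c : sec W) : sec W :=
  f W (f' W a b) c + f W (f' W b c) a + f W (f' W c a) b.

Lemma schouten_jacobiator f f' W (a b c : sec W) :
  schouten_bv f f' a b c = - (jacobiator f f' a b c + jacobiator f' f a b c).
Proof.
apply: sec_eqP => m _; rewrite /schouten_bv /jacobiator !(secNE, secDE); ring.
Qed.

Lemma schouten_bvC f f' W (a b c : sec W) : schouten_bv f f' a b c = schouten_bv f' f a
  b c.
Proof. by rewrite !schouten_jacobiator addrC. Qed.

Lemma schouten_bvDl f f' h W (a b c : sec W) : sheaf_bilin h ->
  schouten_bv (fun W a b => f W a b + f' W a b) h a b c =
  schouten_bv f h a b c + schouten_bv f' h a b c.
Proof.
move=> hb; rewrite /schouten_bv !(opDl hb).
apply: sec_eqP => m _; rewrite !(secNE, secDE); ring.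
Qed.

End Brackets.

(** * The Poisson brackets of a quantization *)

Section Quantization.
Variables (R : realType) (k : geometry) (M : manifold R k) (A : fun_sheaf R M).
Variable m : nat -> nat -> sheaf_op2 A.
Hypothesis mq : two_parameter_quantization m.
Implicit Types W : opens A.

Lemma tpq_bilin i j : sheaf_bilin (m i j).
Proof. by have [] := tpq_bidiff mq i j. Qed.

Definition const_series W (a : sec W) : nat -> nat -> sec W :=
  fun i j => if (i + j == 0)%N then a else 0.

Lemma op0l i j W (a : sec W) : m i j 0 a = 0.
Proof. exact: linfun0 (((tpq_bilin i j).1 W).1 a). Qed.

Lemma op0r i j W (a : sec W) : m i j a 0 = 0.
Proof. exact: linfun0 (((tpq_bilin i j).1 W).2 a). Qed.

Lemma th_mul_constl W (a : sec W) (y : nat -> nat -> sec W) i j :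
  th_mul m (const_series a) y i j =
  \sum_(i1 < i.+1) \sum_(j1 < j.+1) m i1 j1 a (y (i - i1)%N (j - j1)%N).
Proof.
apply: eq_bigr => i1 _; rewrite big_ord_recl [X in _ + X]big1 ?addr0; last first.
  by move=> i2 _; rewrite big1// => j1 _; rewrite big1// => j2 _; rewrite op0l.
apply: eq_bigr => j1 _; rewrite big_ord_recl [X in _ + X]big1 ?addr0; last first.
  by move=> j2 _; rewrite op0l.
by rewrite /= !subn0.
Qed.

Lemma th_mul_constr W (c : sec W) (x : nat -> nat -> sec W) i j :
  th_mul m x (const_series c) i j =
  \sum_(i1 < i.+1) \sum_(j1 < j.+1) m i1 j1 (x (i - i1)%N (j - j1)%N) c.
Proof.
apply: eq_bigr => i1 _; rewrite big_ord_recr /= [X in X + _]big1 ?add0r; last first.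
  move=> i2 _; rewrite big1// => j1 _; rewrite big1// => j2 _.
  have : (0 < i - i1 - i2)%N by rewrite subn_gt0; exact: ltn_ord.
  by rewrite /const_series addn_eq0; case: (_ - i2)%N => //= *; rewrite op0r.
apply: eq_bigr => j1 _; rewrite big_ord_recr /= [X in X + _]big1 ?add0r; last first.
  move=> j2 _; have : (0 < j - j1 - j2)%N by rewrite subn_gt0; exact: ltn_ord.
  by rewrite /const_series addn_eq0 andbC; case: (_ - j2)%N => //= *; rewrite op0r.
by rewrite !subnn.
Qed.

Lemma th_mul_const W (a b : sec W) i j :
  th_mul m (const_series a) (const_series b) i j = m i j a b.
Proof.
rewrite th_mul_constl big_ord_recr /= [X in X + _]big1 ?add0r; last first.
  move=> i1 _; rewrite big1// => j1 _.
  have : (0 < i - i1)%N by rewrite subn_gt0; exact: ltn_ord.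
  by rewrite /const_series addn_eq0; case: (_ - i1)%N => //= *; rewrite op0r.
rewrite big_ord_recr /= [X in X + _]big1 ?add0r; last first.
  move=> j1 _; have : (0 < j - j1)%N by rewrite subn_gt0; exact: ltn_ord.
  by rewrite /const_series addn_eq0 andbC; case: (_ - j1)%N => //= *; rewrite op0r.
by rewrite !subnn.
Qed.

Lemma assoc_coeff W (a b c : sec W) i j :
  \sum_(i1 < i.+1) \sum_(j1 < j.+1) m i1 j1 (m (i - i1)%N (j - j1)%N a b) c =
  \sum_(i1 < i.+1) \sum_(j1 < j.+1) m i1 j1 a (m (i - i1)%N (j - j1)%N b c).
Proof.
have := congr1 (fun F => F i j) (tpq_assoc mq (const_series a) (const_series b)
  (const_series c)).
rewrite th_mul_constr th_mul_constl => E.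
transitivity (\sum_(i1 < i.+1) \sum_(j1 < j.+1)
   m i1 j1 (th_mul m (const_series a) (const_series b) (i - i1)%N (j - j1)%N) c).
  by apply: eq_bigr => i1 _; apply: eq_bigr => j1 _; rewrite th_mul_const.
rewrite E; apply: eq_bigr => i1 _; apply: eq_bigr => j1 _.
by rewrite th_mul_const.
Qed.

Lemma cocycle_h W (a b c : sec W) :
  sec_mul (m 0 1 a b) c + m 0 1 (sec_mul a b) c =
  m 0 1 a (sec_mul b c) + sec_mul a (m 0 1 b c).
Proof.
have := assoc_coeff a b c 0 1; rewrite !big_ord_recl !big_ord0 /= !addr0 !(tpq_00 mq)
  => ->.
exact: addrC.
Qed.

Lemma cocycle_t W (a b c : sec W) :
  sec_mul (m 1 0 a b) c + m 1 0 (sec_mul a b) c =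
  m 1 0 a (sec_mul b c) + sec_mul a (m 1 0 b c).
Proof.
have := assoc_coeff a b c 1 0; rewrite !big_ord_recl !big_ord0 /= !addr0 !(tpq_00 mq)
  => ->.
exact: addrC.
Qed.

Lemma poisson_h : is_poisson (antisym (m 0 1)).
Proof.
have b1 := tpq_bilin 0 1; have b2 := tpq_bilin 0 2.
split; first exact: antisym_bracket (@cocycle_h).
apply: (@antisym_compatible _ _ _ _ _ _ (fun W a b => m 0 2 a b + m 0 2 a b)) => //.
  exact: sheaf_bilin_add.
move=> W a b c; have := assoc_coeff a b c 0 2.
rewrite !big_ord_recl !big_ord0 /= !addr0 !(tpq_00 mq) /bump /= => E.
rewrite sec_mulDl sec_mulDr.
have {}E : sec_mul (m 0 2 a b) c + (m 0 1 (m 0 1 a b) c + m 0 2 (sec_mul a b) c) =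
  sec_mul a (m 0 2 b c) + (m 0 1 a (m 0 1 b c) + m 0 2 a (sec_mul b c)) := E.
have dbl (u v w : sec W) : u + u + v + v + (w + w) = (u + (v + w)) + (u + (v + w)).
  by apply: sec_eqP => n _; rewrite !secDE; ring.
by rewrite !dbl E.
Qed.

Lemma poisson_t : is_poisson (antisym (m 1 0)).
Proof.
have b1 := tpq_bilin 1 0; have b2 := tpq_bilin 2 0.
split; first exact: antisym_bracket (@cocycle_t).
apply: (@antisym_compatible _ _ _ _ _ _ (fun W a b => m 2 0 a b + m 2 0 a b)) => //.
  exact: sheaf_bilin_add.
move=> W a b c; have := assoc_coeff a b c 2 0.
rewrite !big_ord_recl !big_ord0 /= !addr0 !(tpq_00 mq) /bump /= => E.
rewrite sec_mulDl sec_mulDr.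
have {}E : sec_mul (m 2 0 a b) c + (m 1 0 (m 1 0 a b) c + m 2 0 (sec_mul a b) c) =
  sec_mul a (m 2 0 b c) + (m 1 0 a (m 1 0 b c) + m 2 0 a (sec_mul b c)) := E.
have dbl (u v w : sec W) : u + u + v + v + (w + w) = (u + (v + w)) + (u + (v + w)).
  by apply: sec_eqP => n _; rewrite !secDE; ring.
by rewrite !dbl E.
Qed.

Lemma compatible_th : compatible_brackets (antisym (m 1 0)) (antisym (m 0 1)).
Proof.
have b1 := tpq_bilin 1 0; have b2 := tpq_bilin 0 1; have b3 := tpq_bilin 1 1.
apply: (@antisym_compatible _ _ _ _ _ _ (m 1 1)) => //.
move=> W a b c; have := assoc_coeff a b c 1 1.
rewrite !big_ord_recl !big_ord0 /= !addr0 !(tpq_00 mq) /bump /= => E.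
have {}E : sec_mul (m 1 1 a b) c + m 0 1 (m 1 0 a b) c + (m 1 0 (m 0 1 a b)
  c + m 1 1 (sec_mul a b) c) =
  sec_mul a (m 1 1 b c) + m 0 1 a (m 1 0 b c) + (m 1 0 a (m 0 1 b c)
    + m 1 1 a (sec_mul b c)) := E.
have ac (u v w z : sec W) : u + v + w + z = u + w + (v + z).
  by apply: sec_eqP => n _; rewrite !secDE; ring.
by rewrite !ac.
Qed.

End Quantization.

(** * Cocommutativity of the enveloping algebra *)

Section Comultiplication.
Variables (C : fieldType) (g : lie_algebra C) (U : enveloping g) (U2 : tensor_alg U U).
Local Notation inj := (env_inj U).

Let prim (x : g) : U2 := pure U2 (inj x) 1 + pure U2 1 (inj x).

Let prim_linear : linear prim.
Proof.
move=> z x y; have pb := pure_bilin U2.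
rewrite /prim (env_inj_linear U) (bilinPl pb) (bilinPr pb) scalerDr.
by rewrite addrACA.
Qed.

Let prim_bracket x y : prim (lie_br x y) = prim x * prim y - prim y * prim x.
Proof.
have pb := pure_bilin U2.
rewrite /prim !mulrDl !mulrDr !tensor_alg_mul !mul1r !mulr1 env_inj_br.
rewrite (linfunB (pb.1 1)) (linfunB (pb.2 1)).
set a := pure U2 (inj x * inj y) 1; set b := pure U2 (inj y * inj x) 1.
set c := pure U2 1 (inj x * inj y); set d := pure U2 1 (inj y * inj x).
set u := pure U2 (inj x) (inj y); set v := pure U2 (inj y) (inj x).
have -> : a + u + (v + c) = (a + c) + (u + v) by rewrite [v + c]addrC addrACA.
have -> : b + v + (u + d) = (b + d) + (u + v) by rewrite [u + d]addrC addrACA [v +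
  u]addrC.
by rewrite [in RHS]opprD [RHS]addrACA subrr addr0 opprD addrACA.
Qed.

Lemma comul_linear : linear (@env_comul C g U U2).
Proof. by have [] := env_liftP U prim_linear prim_bracket. Qed.

Lemma comul_morph : monoid_morphism (@env_comul C g U U2).
Proof. by have [] := env_liftP U prim_linear prim_bracket. Qed.

Lemma comul_inj x : env_comul U2 (inj x) = pure U2 (inj x) 1 + pure U2 1 (inj x).
Proof. by have [_ _] := env_liftP U prim_linear prim_bracket; exact. Qed.

Definition tensor_flip : U2 -> U2 := tlift U2 (fun u v => pure U2 v u).

Let flip_bilin : bilin (fun u v => pure U2 v u).
Proof.
by have [pl pr] := pure_bilin U2; split=> w; [exact: pr|exact: pl].
Qed.

Lemma flip_linear : linear tensor_flip.
Proof. exact: tlift_linear flip_bilin. Qed.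

Lemma flip_pure u v : tensor_flip (pure U2 u v) = pure U2 v u.
Proof. exact: (tlift_pure _ flip_bilin). Qed.

Lemma flipM S T : tensor_flip (S * T) = tensor_flip S * tensor_flip T.
Proof.
have fl := flip_linear.
apply: (@tensor_ext _ _ _ _ U2 U2 (fun S => tensor_flip (S * T)) (fun S =>
  tensor_flip S * tensor_flip T)).
- by move=> z S1 S2; rewrite mulrDl -scalerAl fl.
- by move=> z S1 S2; rewrite fl mulrDl -scalerAl.
move=> u v.
apply: (@tensor_ext _ _ _ _ U2 U2 (fun T => tensor_flip (pure U2 u v * T)) (fun T =>
  tensor_flip (pure U2 u v) * tensor_flip T)).
- by move=> z S1 S2; rewrite mulrDr -scalerAr fl.
- by move=> z S1 S2; rewrite fl mulrDr -scalerAr.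
by move=> u' v'; rewrite tensor_alg_mul !flip_pure tensor_alg_mul.
Qed.

(** Primitive elements are symmetric, and they generate U(g). *)
Lemma cocommutative u : tensor_flip (env_comul U2 u) = env_comul U2 u.
Proof.
have fl := flip_linear; have cl := comul_linear; have [c1 cm] := comul_morph.
apply: (@env_ext _ _ U U2 (fun u => tensor_flip (env_comul U2 u)) (@env_comul C g U U2)).
- by move=> z u1 u2; rewrite cl fl.
- split; last by move=> u1 u2; rewrite cm flipM.
  by rewrite c1 -tensor_alg_one flip_pure.
- exact: cl.
- exact: comul_morph.
- by move=> x; rewrite comul_inj (linfunD fl) !flip_pure addrC.
Qed.

End Comultiplication.

(** * The bivector field of an r-matrix *)

Section BivectorField.
Variables (R : realType) (k : geometry) (G : lie_group R k) (M : G_manifold G).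
Local Notation A := (gm_fun M).
Variables (g : lie_algebra R[i]) (tau : g -> (G -> R[i]) -> R[i]).
Hypothesis g_lie_G : is_lie_algebra_of tau.
Variables (U : enveloping g) (act : U_action M tau U).
Local Notation lact x a := (uact act (env_inj U x) a).
Local Notation "x ** y" := (sec_mul x y) (at level 40, left associativity).
Implicit Types V W : opens A.

Lemma lact_bilin W : bilin (fun (x : g) (a : sec W) => lact x a).
Proof.
have ub := uact_bilin act W; split=> [a|x] z u v.
  by rewrite (env_inj_linear U) (bilinPl ub).
by rewrite (bilinPr ub).
Qed.

Lemma lact_linear W (x : g) : linear (fun a : sec W => lact x a).
Proof. exact: (lact_bilin W).2. Qed.

Lemma lactM (x : g) W (a b : sec W) : lact x (a ** b) = lact x a ** b + a ** lact x b.
Proof. exact: uact_derivation. Qed.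

Lemma lact_br (x y : g) W (a : sec W) :
  lact (lie_br x y) a = lact x (lact y a) - lact y (lact x a).
Proof.
have ub := uact_bilin act W.
by rewrite env_inj_br (linfunB (ub.1 a)) !uactM.
Qed.

Lemma lact_res (x : g) V W (VW : V `<=` W) (a : sec W) :
  sec_res VW (lact x a) = lact x (sec_res VW a).
Proof.
apply: sec_eqP => m Vm; rewrite sec_resE//.
by apply: (uact_local g_lie_G) => // [|n Wn Vn]; [exact: VW|by rewrite sec_resE].
Qed.

Lemma sec_mul_res V W (VW : V `<=` W) (a b : sec W) :
  sec_res VW (a ** b) = sec_res VW a ** sec_res VW b.
Proof. by apply: sec_eqP => m Vm; rewrite sec_resE// !sec_mulE !sec_resE. Qed.

Variables (g2 : tensor g g) (g3 : tensor g2 g).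

Lemma r_M_term_bilin W (a b : sec W) : bilin (fun x y : g => lact x a ** lact y b).
Proof.
have mb := sec_mul_bilin W; have lb := lact_bilin W.
split=> [y|x] z u v; first by rewrite (bilinPl lb) (bilinPl mb).
by rewrite (bilinPl lb) (bilinPr mb).
Qed.

Variables (r : g2) (l : seq (g * g)).
Hypothesis rE : r = \sum_(u <- l) pure g2 u.1 u.2.
Hypothesis r_skew : skew2 r.

Lemma r_ME W (a b : sec W) : r_M act r a b = \sum_(u <- l) lact u.1 a ** lact u.2 b.
Proof. by rewrite /r_M rE tlift_sum//; exact: r_M_term_bilin. Qed.

(** Skew-symmetry of r, as a rule that exchanges the two factors in sums over its terms. *)
Lemma skew_sum (X : lmodType R[i]) (F : g -> g -> X) : bilin F ->
  \sum_(u <- l) F u.2 u.1 = - \sum_(u <- l) F u.1 u.2.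
Proof.
move=> Fb; have fb : bilin (fun x y : g => pure g2 y x).
  by have [pl pr] := pure_bilin g2; split=> w; [exact: pr|exact: pl].
have := r_skew; rewrite /skew2 rE tlift_sum// => /(congr1 (tlift g2 F)).
have Fl := tlift_linear g2 Fb.
rewrite (linfunN Fl) !(linfun_sum _ _ Fl).
under eq_bigr do rewrite tlift_pure//.
by under [X in _ = - X -> _]eq_bigr do rewrite tlift_pure//.
Qed.

Lemma r_M_bilin : sheaf_bilin (r_M act r).
Proof.
have mb := sec_mul_bilin; have lb := lact_bilin.
split=> [W|V W VW a b].
  have -> : @r_M _ _ _ M g tau U act g2 r W = fun a b => \sum_(u <- l)
    lact u.1 a ** lact u.2 b.
    by apply/funext => a; apply/funext => b; exact: r_ME.
  apply: bilin_sum => u; split=> [b|a] z a1 a2.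
    by rewrite (bilinPr (lb W)) (bilinPl (mb _ _ _ _ W)).
  by rewrite (bilinPr (lb W)) (bilinPr (mb _ _ _ _ W)).
rewrite !r_ME (linfun_sum _ _ (sec_res_linear VW)); apply: eq_bigr => u _.
by rewrite sec_mul_res !lact_res.
Qed.

Lemma r_M_skew W (a b : sec W) : r_M act r a b = - r_M act r b a.
Proof.
rewrite !r_ME -(skew_sum (r_M_term_bilin b a)).
by apply: eq_bigr => u _; exact: sec_mulC.
Qed.

Lemma r_M_bracket : is_bracket (r_M act r).
Proof.
split; [exact: r_M_bilin|exact: r_M_skew|] => W a b c.
rewrite !r_ME.
have mb := sec_mul_bilin W.
rewrite (linfun_sum _ _ (mb.2 a)) (linfun_sum _ _ (mb.1 b)) -big_split.
apply: eq_bigr => u _; rewrite lactM.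
apply: sec_eqP => m _; rewrite !(secDE, sec_mulE); ring.
Qed.

End BivectorField.

(** * Schouten brackets with the bivector field *)

Section SchoutenOfR.
Variables (R : realType) (k : geometry) (G : lie_group R k) (M : G_manifold G).
Local Notation A := (gm_fun M).
Variables (g : lie_algebra R[i]) (tau : g -> (G -> R[i]) -> R[i]).
Hypothesis g_lie_G : is_lie_algebra_of tau.
Variables (U : enveloping g) (act : U_action M tau U).
Local Notation lact x a := (uact act (env_inj U x) a).
Local Notation "x ** y" := (sec_mul x y) (at level 40, left associativity).
Implicit Types V W : opens A.
Variables (g2 : tensor g g) (g3 : tensor g2 g).
Variables (r : g2) (l : seq (g * g)).
Hypothesis rE : r = \sum_(u <- l) pure g2 u.1 u.2.
Hypothesis r_skew : skew2 r.

Let r_ME := r_ME act rE.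
Let skew_sum := skew_sum rE r_skew.

Let lactPl W z x y (a : sec W) : lact (z *: x + y) a = z *: lact x a + lact y a.
Proof. by rewrite (bilinPl (lact_bilin act W)). Qed.
Let lactPr W z x (a b : sec W) : lact x (z *: a + b) = z *: lact x a + lact x b.
Proof. by rewrite (bilinPr (lact_bilin act W)). Qed.
Let mulPl W z (a b c : sec W) : (z *: a + b) ** c = z *: (a ** c) + b ** c.
Proof. by rewrite (bilinPl (sec_mul_bilin W)). Qed.
Let mulPr W z (a b c : sec W) : c ** (z *: a + b) = z *: (c ** a) + c ** b.
Proof. by rewrite (bilinPr (sec_mul_bilin W)). Qed.
Let actP := (lactPl, lactPr, mulPl, mulPr).

(** [[f, r_M]] is the sum, over the tensor r, of the failures of f to be
    preserved by the vector fields occurring in r. *)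
Lemma invariant_compatible f : is_bracket f ->
  (forall (x : g) W (a b : sec W), lact x (f W a b) = f W (lact x a)
    b + f W a (lact x b)) ->
  compatible_brackets f (r_M act r).
Proof.
move=> [fb fskew fleib] finv W a b c.
have fPl z (a1 a2 a3 : sec W) : f W (z *: a1 + a2) a3 = z *: f W a1 a3 + f W a2 a3.
  by rewrite (bilinPl (fb.1 W)).
have fPr z (a1 a2 a3 : sec W) : f W a3 (z *: a1 + a2) = z *: f W a3 a1 + f W a3 a2.
  by rewrite (bilinPr (fb.1 W)).
pose F (a b c : sec W) := \sum_(u <- l) f W (lact u.1 a) b ** lact u.2 c.
have frE a' b' c' : f W (r_M act r a' b') c' = F a' c' b' - F b' c' a'.
  rewrite r_ME (linfun_sum _ _ ((fb.1 W).1 c')).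
  under eq_bigr do rewrite fleib.
  rewrite big_split addrC; congr (_ + _).
  rewrite -(skew_sum (F := fun x y => f W (lact x b') c' ** lact y a')).
    by apply: eq_bigr => u _; exact: sec_mulC.
  by split=> [y|x] z u v; rewrite !(actP, fPl, fPr).
have rfE a' b' c' : r_M act r (f W a' b') c' = F a' b' c' - F b' a' c'.
  rewrite r_ME.
  under eq_bigr do rewrite finv sec_mulDl.
  rewrite big_split; congr (_ + _); rewrite -sumrN; apply: eq_bigr => u _.
  by rewrite [f W a' _]fskew sec_mulNl.
rewrite schouten_jacobiator /jacobiator !frE !rfE.
apply: sec_eqP => m _; rewrite !(secNE, secDE, sec0E); ring.
Qed.

Let T W (a b c : sec W) := \sum_(u <- l) \sum_(u' <- l)
   lact u'.1 (lact u.1 a) ** lact u.2 b ** lact u'.2 c.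

Let sum2_skewl (X : lmodType R[i]) (H : g -> g -> g -> g -> X) :
  (forall x' y', bilin (fun x y => H x y x' y')) ->
  \sum_(u <- l) \sum_(u' <- l) H u.2 u.1 u'.1 u'.2 =
  - \sum_(u <- l) \sum_(u' <- l) H u.1 u.2 u'.1 u'.2.
Proof.
move=> Hb; apply: (skew_sum (F := fun x y => \sum_(u' <- l) H x y u'.1 u'.2)).
by apply: bilin_sum => u'; exact: Hb.
Qed.

Let sum2_skewr (X : lmodType R[i]) (H : g -> g -> g -> g -> X) :
  (forall x y, bilin (fun x' y' => H x y x' y')) ->
  \sum_(u <- l) \sum_(u' <- l) H u.1 u.2 u'.2 u'.1 =
  - \sum_(u <- l) \sum_(u' <- l) H u.1 u.2 u'.1 u'.2.
Proof.
move=> Hb; rewrite -sumrN; apply: eq_bigr => u _.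
exact: (skew_sum (Hb u.1 u.2)).
Qed.

Let second_b W (a b c : sec W) :
  \sum_(u <- l) \sum_(u' <- l) lact u.1 a ** lact u'.1 (lact u.2 b)
    ** lact u'.2 c = - T b a c.
Proof.
rewrite /T -(sum2_skewl (H := fun x y x' y' => lact x' (lact x b)
  ** lact y a ** lact y' c)).
  by apply: eq_bigr => u _; apply: eq_bigr => u' _; rewrite (sec_mulC (lact u.1 a)).
by move=> x' y'; split=> [y|x] z u v; rewrite !actP.
Qed.

Lemma r_M_jacobiator W (a b c : sec W) :
  r_M act r (r_M act r a b) c = T a b c - T b a c.
Proof.
have lb := lact_bilin act W; have mb := sec_mul_bilin W.
rewrite r_ME -second_b /T.
rewrite [X in _ = X + _]exchange_big [X in _ = _ + X]exchange_big -big_split.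
apply: eq_bigr => u' _; rewrite r_ME (linfun_sum _ _ (lb.2 _)) (linfun_sum _ _ (mb.1 _)).
rewrite -big_split; apply: eq_bigr => u _ /=.
by rewrite (lactM g_lie_G) sec_mulDl.
Qed.

(** Both sides are combinations of the sums T (a, b, c) of x' x a . y b . y' c over two
    copies of r, with the arguments permuted: the terms in which one function is differentiated
    twice. *)
Lemma phi_M_yang_baxter W (a b c : sec W) :
  phi_M act (yang_baxter g3 r r) a b c = - jacobiator (r_M act r) (r_M act r) a b c.
Proof.
have pb2 := pure_bilin g2; have pb3 := pure_bilin g3; have lieb := lie_bilin g.
have pP := (bilinPl pb2, bilinPr pb2, bilinPl pb3, bilinPr pb3, bilinPl lieb,
  bilinPr lieb).
pose Y (x y x' y' : g) := pure g3 (pure g2 (lie_br x x') y) y'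
  + pure g3 (pure g2 x (lie_br y x')) y' + pure g3 (pure g2 x x') (lie_br y y').
have Yb1 x y : bilin (Y x y).
  by do 2?apply: bilin_add; split=> [y'|x'] z u v; rewrite !pP.
have Yb2 x' y' : bilin (fun x y => Y x y x' y').
  by do 2?apply: bilin_add; split=> [y|x] z u v; rewrite !pP.
have -> : yang_baxter g3 r r = \sum_(u <- l) \sum_(u' <- l) Y u.1 u.2 u'.1 u'.2.
  rewrite /yang_baxter.
  have -> : (fun x y : g => tlift g2 (fun x' y' : g => Y x y x' y') r) =
            (fun x y => \sum_(u' <- l) Y x y u'.1 u'.2).
    by apply/funext => x; apply/funext => y; rewrite rE tlift_sum.
  rewrite {1}rE tlift_sum//; apply: bilin_sum => u'; exact: Yb2.
have rlin : linear (fun t : g2 => r_M act t a b).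
  by apply: tlift_linear; exact: r_M_term_bilin.
pose Phi (t : g2) (z : g) := r_M act t a b ** lact z c.
have Phib : bilin Phi.
  split=> [x|t] z u v; rewrite /Phi; first by rewrite rlin !actP.
  by rewrite !actP.
have PhiE x y z : tlift g3 Phi (pure g3 (pure g2 x y) z)
  = lact x a ** lact y b ** lact z c.
  by rewrite (tlift_pure _ Phib) /Phi /r_M (tlift_pure _ (r_M_term_bilin act a b)).
have Pl := tlift_linear g3 Phib.
rewrite -[LHS]/(tlift g3 Phi _) (linfun_sum _ _ Pl).
under eq_bigr do rewrite (linfun_sum _ _ Pl).
under eq_bigr do under eq_bigr do rewrite !(linfunD Pl) !PhiE.
have first_sum : \sum_(u <- l) \sum_(u' <- l) lact (lie_br u.1 u'.1)
  a ** lact u.2 b ** lact u'.2 c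
    = T a c b - T a b c.
  rewrite /T [X in _ = X - _]exchange_big -sumrB; apply: eq_bigr => u _.
  rewrite -sumrB; apply: eq_bigr => u' _.
  by apply: sec_eqP => m _; rewrite lact_br !(secNE, secDE, sec_mulE); ring.
have second_sum : \sum_(u <- l) \sum_(u' <- l) lact u.1 a ** lact (lie_br u.2 u'.1)
  b ** lact u'.2 c
    = T b a c - T b c a.
  have -> : T b a c = - \sum_(u <- l) \sum_(u' <- l) lact u.1 a ** lact u'.1 (lact u.2
    b) ** lact u'.2 c.
    by rewrite second_b opprK.
  have -> : T b c a = - \sum_(u <- l) \sum_(u' <- l) lact u.1 a ** lact u.2 (lact u'.1
    b) ** lact u'.2 c.
    rewrite -(sum2_skewl (H := fun x y x' y' => lact x a ** lact y (lact x' b)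
      ** lact y' c)); last first.
      by move=> x' y'; split=> [y|x] z u v; rewrite !actP.
    rewrite /T exchange_big; apply: eq_bigr => u _; apply: eq_bigr => u' _.
    by apply: sec_eqP => m _; rewrite !sec_mulE; ring.
  rewrite opprK addrC -sumrB; apply: eq_bigr => u _.
  rewrite -sumrB; apply: eq_bigr => u' _.
  by apply: sec_eqP => m _; rewrite lact_br !(secNE, secDE, sec_mulE); ring.
have third_sum : \sum_(u <- l) \sum_(u' <- l) lact u.1 a ** lact u'.1 b ** lact (lie_br
  u.2 u'.2) c
    = T c b a - T c a b.
  have -> : \sum_(u <- l) \sum_(u' <- l) lact u.1 a ** lact u'.1 b ** lact (lie_br u.2
    u'.2) c
     = \sum_(u <- l) \sum_(u' <- l) lact u.2 a ** lact u'.2 b ** lact (lie_br u.1 u'.1) c.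
    apply: oppr_inj.
    rewrite -(sum2_skewl (H := fun x y x' y' => lact x a ** lact x' b ** lact (lie_br y
      y') c)); last first.
      by move=> x' y'; split=> [y|x] z u v; rewrite !(pP, actP).
    rewrite -(sum2_skewr (H := fun x y x' y' => lact y a ** lact y' b ** lact (lie_br x
      x') c))//.
    by move=> x y; split=> [y'|x'] z u v; rewrite !(pP, actP).
  rewrite /T [X in _ = X - _]exchange_big -sumrB; apply: eq_bigr => u _.
  rewrite -sumrB; apply: eq_bigr => u' _.
  by apply: sec_eqP => m _; rewrite lact_br !(secNE, secDE, sec_mulE); ring.
transitivity ((T a c b - T a b c) + (T b a c - T b c a) + (T c b a - T c a b)).
  rewrite -first_sum -second_sum -third_sum -!big_split; apply: eq_bigr => u _.
  by rewrite -!big_split.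
rewrite /jacobiator !r_M_jacobiator.
by apply: sec_eqP => m _; rewrite !(secNE, secDE); ring.
Qed.

(** The symmetrizations in the two Schouten brackets give the same factor 2. *)
Lemma schouten_r_M W (a b c : sec W) :
  schouten_bv (r_M act r) (r_M act r) a b c = phi_M act (schouten g3 r r) a b c.
Proof.
have mb := sec_mul_bilin W; have lb := lact_bilin act W.
have Phib : bilin (fun (t : g2) (z : g) => r_M act t a b ** lact z c).
  have rlin : linear (fun t : g2 => r_M act t a b).
    by apply: tlift_linear; exact: r_M_term_bilin.
  split=> [x|t] z u v; first by rewrite rlin !actP.
  by rewrite !actP.
rewrite /schouten -[RHS]/(tlift g3 _ _) (linfunD (tlift_linear g3 Phib)).
rewrite -[tlift g3 _ _]/(phi_M act (yang_baxter g3 r r) a b c) phi_M_yang_baxter.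
by rewrite schouten_jacobiator opprD.
Qed.

End SchoutenOfR.

(** * Invariance in first order *)

Lemma hmul0 (A : pzRingType) (x y : hseries A) : hmul x y 0 = x 0%N * y 0%N.
Proof. by rewrite /hmul big_ord1 subn0. Qed.

Lemma hmul1 (A : pzRingType) (x y : hseries A) :
  hmul x y 1 = x 0%N * y 1%N + x 1%N * y 0%N.
Proof. by rewrite /hmul !big_ord_recr big_ord0 /= add0r subn0 subnn. Qed.

Section QuantumInvariance.
Variables (R : realType) (k : geometry) (G : lie_group R k) (M : G_manifold G).
Local Notation A := (gm_fun M).
Variables (g : lie_algebra R[i]) (tau : g -> (G -> R[i]) -> R[i]).
Variables (g2 : tensor g g) (g3 : tensor g2 g).
Variables (U : enveloping g) (U2 : tensor_alg U U) (U3 : tensor_alg U2 U).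
Variables (act : U_action M tau U).
Local Notation lact x a := (uact act (env_inj U x) a).
Local Notation inj := (env_inj U).

Section Act2.
Variables (B : sheaf_op2 A) (Bb : sheaf_bilin B) (W : opens A) (a b : sec W).

Lemma act2_bilin : bilin (fun u v : U => B (uact act u a) (uact act v b)).
Proof.
have ub := uact_bilin act W.
split=> [v|u] z x y; first by rewrite (bilinPl ub) (bilinPl (Bb.1 W)).
by rewrite (bilinPl ub) (bilinPr (Bb.1 W)).
Qed.

Lemma act2_linear : linear (fun T : U2 => act2 act B T a b).
Proof. exact: tlift_linear act2_bilin. Qed.

Lemma act2_pure u v : act2 act B (pure U2 u v) a b = B (uact act u a) (uact act v b).
Proof. exact: tlift_pure act2_bilin _ _. Qed.

Lemma act2_primitive x : act2 act B (env_comul U2 (inj x)) a b = B (lact x a)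
  b + B a (lact x b).
Proof. by rewrite comul_inj (linfunD act2_linear) !act2_pure !uact1. Qed.

End Act2.

Lemma sheaf_bilin_flip (B : sheaf_op2 A) : sheaf_bilin B ->
  sheaf_bilin (fun W a b => B W b a).
Proof.
move=> [Bl Br]; split=> [W|V W VW a b]; last exact: Br.
by have [h1 h2] := Bl W; split.
Qed.

Lemma act2_flip (B : sheaf_op2 A) (T : U2) W (a b : sec W) : sheaf_bilin B ->
  act2 act B (tensor_flip T) b a = act2 act (fun W a b => B W b a) T a b.
Proof.
move=> Bb; have Bb' := sheaf_bilin_flip Bb.
apply: (@tensor_ext _ _ _ _ U2 (sec W) (fun T => act2 act B (tensor_flip T) b a)
   (fun T => act2 act (fun W a b => B W b a) T a b)).
- by move=> z S T'; rewrite flip_linear (act2_linear Bb).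
- exact: (act2_linear Bb').
by move=> u v; rewrite flip_pure (act2_pure Bb) (act2_pure Bb').
Qed.

(** Cocommutativity of U(g) makes invariance compatible with skew-symmetrization. *)
Lemma antisym_invariant (B : sheaf_op2 A) : sheaf_bilin B ->
  U_invariant act U2 B -> U_invariant act U2 (antisym B).
Proof.
move=> Bb Binv u W a b; rewrite /antisym; have Bb' := sheaf_bilin_flip Bb.
have ub := uact_bilin act W.
rewrite (linfunB (ub.2 u)) !Binv -[in X in _ - X](cocommutative U2 u) act2_flip//.
apply: (@tensor_ext _ _ _ _ U2 (sec W)
   (fun T => act2 act B T a b - act2 act (fun W a b => B W b a) T a b)
   (fun T => act2 act (fun W a b => B W a b - B W b a) T a b)).
- move=> z S T; rewrite (act2_linear Bb) (act2_linear Bb') scalerBr.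
  by rewrite opprD addrACA.
- exact: (act2_linear (antisym_bilin Bb)).
by move=> u' v; rewrite (act2_pure Bb) (act2_pure Bb') (act2_pure (antisym_bilin Bb)).
Qed.

Variables (r : g2) (Q : quantum_group g3 U3 r).

Lemma qFinv0 : qFinv Q 0 = 1.
Proof.
by have := congr1 (fun F => F 0%N) (qF_inv_r Q); rewrite hmul0 qF0 mul1r.
Qed.

Lemma qFinv1 : qFinv Q 1 = - (2^-1 *: inj2 U2 r).
Proof.
have := congr1 (fun F => F 1%N) (qF_inv_r Q).
by rewrite hmul1 qF0 qF1 qFinv0 mul1r mulr1 => /eqP; rewrite addr_eq0 => /eqP.
Qed.

Lemma qcomul0 u : qcomul Q (hconst u) 0 = env_comul U2 u.
Proof. by rewrite /qcomul !hmul0 qF0 qFinv0 mul1r mulr1. Qed.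

Lemma qcomul1 u : qcomul Q (hconst u) 1 =
  2^-1 *: (inj2 U2 r * env_comul U2 u - env_comul U2 u * inj2 U2 r).
Proof.
rewrite /qcomul !hmul1 !hmul0 qF0 qF1 qFinv0 qFinv1 !mul1r !mulr1 /=.
rewrite (linfun0 (comul_linear U2)) add0r mulrN -scalerAl -scalerAr.
by rewrite scalerBr addrC.
Qed.

Variable l : seq (g * g).
Hypothesis rE : r = \sum_(u <- l) pure g2 u.1 u.2.
Hypothesis r_skew : skew2 r.
Hypothesis g_lie_G : is_lie_algebra_of tau.
Variable m : nat -> nat -> sheaf_op2 A.
Hypothesis mq : two_parameter_quantization m.
Hypothesis m_inv : quantum_invariant Q act m.

Lemma inj2E : inj2 U2 r = \sum_(u <- l) pure U2 (inj u.1) (inj u.2).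
Proof.
have pb := pure_bilin U2; have il := env_inj_linear U.
rewrite /inj2 rE tlift_sum//; split=> [y|x] z u v.
  by rewrite il (bilinPl pb).
by rewrite il (bilinPr pb).
Qed.

Lemma act2_r W (a b : sec W) u v :
  act2 act (m 0 0) (inj2 U2 r * pure U2 u v) a b =
  r_M act r (uact act u a) (uact act v b).
Proof.
have Bb := tpq_bilin mq 0 0.
rewrite inj2E mulr_suml (linfun_sum _ _ (act2_linear Bb a b)) (r_ME act rE).
apply: eq_bigr => w _.
by rewrite tensor_alg_mul (act2_pure Bb) !uactM (tpq_00 mq).
Qed.

Lemma act2_r_left W (a b : sec W) x :
  act2 act (m 0 0) (env_comul U2 (inj x) * inj2 U2 r) a b = lact x (r_M act r a b).
Proof.
have Bb := tpq_bilin mq 0 0; have al := act2_linear Bb a b.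
rewrite inj2E mulr_sumr (linfun_sum _ _ al) (r_ME act rE).
rewrite (linfun_sum _ _ (lact_linear act x)); apply: eq_bigr => w _.
rewrite comul_inj mulrDl (linfunD al) !tensor_alg_mul !mul1r !(act2_pure Bb) !uactM.
by rewrite !(tpq_00 mq) (lactM g_lie_G).
Qed.

Lemma invariant_t : U_invariant act U2 (antisym (m 1 0)).
Proof.
apply: antisym_invariant; first exact: tpq_bilin.
by move=> u W a b; have := m_inv u a b 1 0; rewrite big_ord1 /= subn0 qcomul0.
Qed.

Lemma invariant_t_lie x W (a b : sec W) : let s := antisym (m 1 0) in
  lact x (s W a b) = s W (lact x a) b + s W a (lact x b).
Proof.
by rewrite /= invariant_t (act2_primitive (antisym_bilin (tpq_bilin mq 1 0))).
Qed.

(** The defect of invariance of m_01 is half the commutator of r with Delta x; its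
    skew-symmetrization is cancelled by r_M. *)
Lemma invariant_h x W (a b : sec W) :
  let f := fun (W : opens A) (a b : sec W) => antisym (m 0 1) a b + r_M act r a b in
  lact x (f W a b) = f W (lact x a) b + f W a (lact x b).
Proof.
have Bb := tpq_bilin mq 0 1; have Bb0 := tpq_bilin mq 0 0.
have ll := lact_linear act x.
have half (c d : sec W) : lact x (m 0 1 c d) = m 0 1 (lact x c) d + m 0 1 c (lact x d) +
    2^-1 *: (r_M act r (lact x c) d + r_M act r c (lact x d) - lact x (r_M act r c d)).
  have := m_inv (inj x) c d 0 1; rewrite !big_ord_recr big_ord0 /= add0r subn0 subnn.
  rewrite qcomul0 qcomul1 (act2_primitive Bb) (linfunZ (act2_linear Bb0 c d)).
  rewrite (linfunB (act2_linear Bb0 c d)) act2_r_left comul_inj mulrDr.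
  by rewrite (linfunD (act2_linear Bb0 c d)) !act2_r !uact1.
rewrite /= /antisym (linfunD (ll W)) (linfunB (ll W)) !half.
rewrite (r_M_skew act rE r_skew b (lact x a)) (r_M_skew act rE r_skew (lact x b) a).
rewrite (r_M_skew act rE r_skew b a) (linfunN (ll W)).
by apply: sec_eqP => n _; rewrite !(secNE, secDE, secZE); field.
Qed.

End QuantumInvariance.

(** * The theorem *)

Theorem corollary4p2 (R : realType) (k : geometry)
    (G : lie_group R k) (G_connected : connected [set: G])
    (g : lie_algebra R[i]) (tau : g -> (G -> R[i]) -> R[i])
    (g_lie_G : is_lie_algebra_of tau) (g_semisimple : lie_semisimple g)
    (M : G_manifold G)
    (g2 : tensor g g) (g3 : tensor g2 g)
    (U : enveloping g) (U2 : tensor_alg U U) (U3 : tensor_alg U2 U)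
    (act : U_action M tau U)
    (r : g2) (r_rmatrix : classical_rmatrix g3 r)
    (Q : quantum_group g3 U3 r)
    (m : nat -> nat -> sheaf_op2 (gm_fun M))
    (m_quantization : two_parameter_quantization m)
    (m_invariant : quantum_invariant Q act m) :
  let p := antisym (m 0%N 1%N) in
  let s := antisym (m 1%N 0%N) in
  [/\ is_poisson p,
      is_poisson s,
      U_invariant act U2 s,
      compatible_brackets s p &
      exists f : sheaf_op2 (gm_fun M),
        [/\ forall W (a b : sec W), p W a b = f W a b - r_M act r a b,
            is_phi_bracket act (schouten g3 r r) f &
            compatible_brackets f s]].
Proof.
move=> p s; have [l rE] := tensor_decomp g2 r; have [r_skew _] := r_rmatrix.
have pP : is_poisson p by exact: poisson_h.
have sP : is_poisson s by exact: poisson_t.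
have sp : compatible_brackets s p by exact: compatible_th.
split=> //; first exact: invariant_t m_quantization m_invariant.
pose f : sheaf_op2 (gm_fun M) := fun W a b => p W a b + r_M act r a b.
have [pbr pp] := pP; have [sbr _] := sP.
have rbr := r_M_bracket g_lie_G act rE r_skew.
have finv x W (a b : sec W) : uact act (env_inj U x) (f W a b) =
    f W (uact act (env_inj U x) a) b + f W a (uact act (env_inj U x) b).
  exact: (invariant_h rE r_skew g_lie_G m_quantization m_invariant).
have [pb pskew pleib] := pbr; have [rb rskew rleib] := rbr.
have fb : sheaf_bilin f by exact: sheaf_bilin_add.
have fbr : is_bracket f.
  split=> // W; first by move=> a b; rewrite /f [p W a b]pskew [r_M act r a b]rskew
    [RHS]opprD.
  by move=> a b c; rewrite /f pleib rleib sec_mulDr sec_mulDl addrACA.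
have fr := invariant_compatible rE r_skew fbr finv.
have sr : compatible_brackets s (r_M act r).
  apply: (invariant_compatible rE r_skew sbr) => x W a b.
  exact: (invariant_t_lie m_quantization m_invariant).
have fbd : bidifferential f.
  apply/bidiff_onP; split=> // n.
  have [_ /(_ n) [V [x [L [Vn Vx mL]]]]] := (bidiff_onP _).1 (tpq_bidiff m_quantization
    0 1).
  have [L' rL] := bidiff_on_sum l (fun u => bidiff_on_act g_lie_G act u.1 u.2 Vx).
  exists V, x, ((L ++ [seq (- t.1, (t.2.2, t.2.1)) | t <- L]) ++ L'); split=> //.
  apply: bidiff_onD; first exact: (bidiff_onD mL (bidiff_on_swap mL)).
  by move=> W WV c cc a b n' cn'; rewrite (r_ME act rE); exact: rL.
exists f; split.
- by move=> W a b; rewrite /f addrK.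
- split=> //.
    exact: (infinitesimal_invariance g_lie_G fb fbd finv G_connected).
  move=> W a b c.
  (* 0 = [[f, r_M]] = [[p, r_M]] + [[r_M, r_M]] *)
  have pr : schouten_bv p (r_M act r) a b c = - schouten_bv (r_M act r) (r_M act r) a b c.
    by apply/eqP; rewrite -addr_eq0 -(schouten_bvDl _ _ _ _ _ rb); apply/eqP; exact: fr.
  rewrite {1}/f (schouten_bvDl _ _ _ _ _ fb) [X in _ + X]schouten_bvC fr addr0.
  rewrite schouten_bvC /f (schouten_bvDl _ _ _ _ _ pb) pp add0r schouten_bvC pr.
  by rewrite (schouten_r_M g_lie_G act g3 rE r_skew).
- move=> W a b c.
  have [sb _ _] := sbr.
  rewrite /f (schouten_bvDl _ _ _ _ _ sb) schouten_bvC sp add0r schouten_bvC.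
  exact: sr.
Qed.
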